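(* Let $C\subset\mathbb{P}^2(\overline{\mathbb{Q}})$ be the line $x_0+x_1+x_2=0$, and let $(\omega_\ell)_{\ell\ge1}$ be a strict sequence in $(\overline{\mathbb{Q}}^\times)^2$ of nontrivial torsion points. Then \[ \lim_{\ell\to+\infty}\mathrm{h}(C\cap\omega_\ell C)=\frac{2\,\zeta(3)}{3\,\zeta(2)}, \] where $\zeta$ is the Riemann zeta function.
   Context: $\overline{\mathbb{Q}}$ is an algebraic closure of $\mathbb{Q}$. A torsion point $\omega=(\omega_1,\omega_2)$ of $(\overline{\mathbb{Q}}^\times)^2$ is a pair of roots of unity; it is nontrivial if it differs from $(1,1)$. A sequence in $(\overline{\mathbb{Q}}^\times)^2$ is strict if for every proper algebraic (i.e. Zariski closed) subgroup $H\subsetneq(\overline{\mathbb{Q}}^\times)^2$ there is $\ell_0\ge 1$ such that the $\ell$-th term is not in $H$ for all $\ell\ge\ell_0$. The torus acts on $\mathbb{P}^2(\overline{\mathbb{Q}})$ by $\omega\,[\xi_0:\xi_1:\xi_2]=[\xi_0:\omega_1\xi_1:\omega_2\xi_2]$, so that $\omega C$ is the line $x_0+\omega_1^{-1}x_1+\omega_2^{-1}x_2=0$. For $\omega$ a nontrivial torsion point, $C\cap\omega C$ consists of the single point $[\omega_2^{-1}-\omega_1^{-1}:1-\omega_2^{-1}:\omega_1^{-1}-1]$, and $\mathrm{h}(C\cap\omega C)$ denotes the height of this point. The (canonical) height of $\xi=[\xi_0:\dots:\xi_n]\in\mathbb{P}^n(\overline{\mathbb{Q}})$ is \[ \mathrm{h}(\xi)=\sum_{v}\sum_{w\mid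 v}\frac{[K_w:\mathbb{Q}_v]}{[K:\mathbb{Q}]}\log\max(|\xi_0|_w,\dots,|\xi_n|_w), \] where $K$ is any number field containing all $\xi_i$, $v$ ranges over the places of $\mathbb{Q}$ (with the usual Archimedean absolute value and the usual $p$-adic absolute values), $w$ ranges over the places of $K$ above $v$, and $|\cdot|_w$ is the absolute value in the class of $w$ extending $|\cdot|_v$. It depends neither on $K$ nor on the choice of homogeneous coordinates. *)

(* Defs.v *)
From mathcomp Require Import all_boot all_order all_algebra all_field.
From mathcomp Require Import all_classical all_reals all_analysis.
From mathcomp Require Import ring.

Set Implicit Arguments.
Unset Strict Implicit.
Unset Printing Implicit Defensive.

Import Order.TTheory GRing.Theory Num.Theory.
Import numFieldNormedType.Exports.

Local Open Scope classical_set_scope.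
Local Open Scope ring_scope.

(* The field of algebraic numbers [algC] plays the role of the algebraic      *)
(* closure of Q; number fields are the types [K : fieldExtType rat]; real     *)
(* quantities take values in an arbitrary model [R : realType] of the reals.  *)

Definition zeta (R : realType) (s : nat) : R :=
  limn (series (fun k : nat => (k.+1%:R : R) ^- s)).

Definition absolute_value (R : realType) (K : fieldType) (w : K -> R) : Prop :=
  [/\ forall x, 0 <= w x,
      forall x, w x = 0 <-> x = 0,
      forall x y, w (x * y) = w x * w y
    & forall x y, w (x + y) <= w x + w y].

(* [None] is the Archimedean place. *)
Definition placeQ := option {p : nat | prime p}.

Definition absQ (R : realType) (v : placeQ) (q : rat) : R :=
  match v with
  | None => `|ratr q|
  | Some p =>
      if q == 0 then 0 else
      (val p)%:R ^ ((logn (val p) `|denq q|)%:Z - (logn (val p) `|numq q|)%:Z)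
  end.

(* A place w above v is represented by the only absolute value in its class   *)
(* that extends the normalized absolute value of v.                           *)
Definition places_above (R : realType) (K : fieldExtType rat) (v : placeQ) :
    set (K -> R) :=
  [set w | absolute_value w /\ forall q : rat, w (ratr q) = absQ R v q].

Definition cauchy_for (R : realType) (L : fieldType) (W : L -> R)
    (u : nat -> L) : Prop :=
  forall e : R, 0 < e ->
  exists N, forall m n, (N <= m)%N -> (N <= n)%N -> W (u m - u n) < e.

Definition converges_for (R : realType) (L : fieldType) (W : L -> R)
    (u : nat -> L) (l : L) : Prop :=
  forall e : R, 0 < e -> exists N, forall n, (N <= n)%N -> W (u n - l) < e.

Definition is_completion (R : realType) (K : fieldType) (w : K -> R)
    (L : fieldType) (j : {rmorphism K -> L}) (W : L -> R) : Prop :=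
  [/\ absolute_value W,
      forall x, W (j x) = w x,
      forall (y : L) (e : R), 0 < e -> exists x : K, W (y - j x) < e
    & forall u : nat -> L, cauchy_for W u -> exists l, converges_for W u l].

(* In a completion L of (K, w), Q_v is the topological closure of Q. *)
Definition closureQ (R : realType) (L : fieldType) (W : L -> R) : set L :=
  [set y | forall e : R, 0 < e -> exists q : rat, W (y - ratr q) < e].

Definition has_degree (L : fieldType) (F : set L) (n : nat) : Prop :=
  exists b : 'I_n -> L,
    (forall y, exists2 a : 'I_n -> L,
       (forall i, F (a i)) & y = \sum_(i < n) a i * b i) /\
    (forall a : 'I_n -> L, (forall i, F (a i)) ->
       \sum_(i < n) a i * b i = 0 -> forall i, a i = 0).

(* [K_w : Q_v]; a completion exists and is unique up to isometric             *)
(* isomorphism, so that exactly one n qualifies when w lies above v.          *)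
Definition local_degree (R : realType) (K : fieldExtType rat) (w : K -> R) :
    nat :=
  xget 0%N [set n | exists (L : fieldType) (j : {rmorphism K -> L})
    (W : L -> R), is_completion w j W /\ has_degree (closureQ W) n].

(* Height of the point with homogeneous coordinates x in K.  Both sums are    *)
(* finitely supported; the default 0 in the maximum is harmless as x <> 0.    *)
Definition heightK (R : realType) (K : fieldExtType rat) (n : nat)
    (x : 'rV[K]_n.+1) : R :=
  \sum_(v \in [set: placeQ]) \sum_(w \in @places_above R K v)
    (local_degree w)%:R / (\dim {: K})%:R
    * ln (\big[Num.max/0]_(i < n.+1) w (x ord0 i)).

(* The height depends neither on the number field containing the coordinates  *)
(* nor on their common scaling; for given coordinates it is computed here     *)
(* in the field they generate over Q, as provided by [num_field_exists].      *)
Definition height (R : realType) (n : nat) (xi : 'rV[algC]_n.+1) : R :=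
  let: existT K (existT _ (exist2 s _ _)) :=
    num_field_exists [seq xi ord0 i | i <- enum 'I_n.+1] in
  heightK R (\row_(i < n.+1) (s`_i : K)).

Definition torus : set (algC * algC) := [set x | x.1 != 0 /\ x.2 != 0].

Definition root_of_unity (z : algC) : Prop :=
  exists2 n, (0 < n)%N & n.-unity_root z.

Definition torsion_point (om : algC * algC) : Prop :=
  root_of_unity om.1 /\ root_of_unity om.2.

(* Polynomials suffice to define the Zariski topology of the torus, since     *)
(* Laurent polynomials become polynomials after multiplication by a monomial. *)
Definition zariski_closed (H : set (algC * algC)) : Prop :=
  exists S : set {poly {poly algC}},
    H = [set x | torus x /\ forall p, S p -> p.[x.2%:P].[x.1] = 0].

Definition algebraic_subgroup (H : set (algC * algC)) : Prop :=
  [/\ H `<=` torus,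
      zariski_closed H,
      H (1, 1),
      forall x y, H x -> H y -> H (x.1 * y.1, x.2 * y.2)
    & forall x, H x -> H (x.1^-1, x.2^-1)].

(* Sequences are indexed by l >= 1: the term of index 0 is ignored. *)
Definition strict_sequence (om : nat -> algC * algC) : Prop :=
  forall H : set (algC * algC), algebraic_subgroup H -> H <> torus ->
  exists2 l0, (1 <= l0)%N & forall l, (l0 <= l)%N -> ~ H (om l).

(* Subsets of P^2 are described by the homogeneous coordinates (in            *)
(* 'rV[algC]_3 minus 0) of their points.                                      *)

Definition row3 (a b c : algC) : 'rV[algC]_3 := \row_(i < 3) [:: a; b; c]`_i.

Definition lineC : set 'rV[algC]_3 :=
  [set x : 'rV[algC]_3 | x != 0 /\ \sum_(i < 3) x ord0 i = 0].

Definition torus_act (om : algC * algC) (x : 'rV[algC]_3) : 'rV[algC]_3 :=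
  \row_(i < 3) (row3 1 om.1 om.2 ord0 i * x ord0 i).

(* Homogeneous coordinates of the only point of the intersection of C with    *)
(* its translate by om, see [lineC_capE].                                     *)
Definition lineC_cap (om : algC * algC) : 'rV[algC]_3 :=
  row3 (om.2^-1 - om.1^-1) (1 - om.2^-1) (om.1^-1 - 1).

Lemma row3P (x : 'rV[algC]_3) : exists a b c, x = row3 a b c.
Proof.
exists (x ord0 (inord 0)), (x ord0 (inord 1)), (x ord0 (inord 2)).
apply/rowP => i; rewrite !mxE.
by case: i => [[|[|[|//]]] lti] /=; congr (x _ _); apply: val_inj;
  rewrite /= inordK.
Qed.

Lemma row3_inj a b c a' b' c' :
  row3 a b c = row3 a' b' c' -> [/\ a = a', b = b' & c = c'].
Proof.
move=> /rowP E; have := (E (inord 0), E (inord 1), E (inord 2)).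
by rewrite !mxE !inordK // => -[[]].
Qed.

Lemma row3_neq0 a b c : (row3 a b c != 0) = [|| a != 0, b != 0 | c != 0].
Proof.
have -> : 0 = row3 0 0 0 by apply/rowP => -[[|[|[|//]]] lti]; rewrite !mxE.
rewrite -!negb_and; congr (~~ _); apply/eqP/and3P => [/row3_inj[-> -> ->]//|].
by case=> /eqP-> /eqP-> /eqP->.
Qed.

Lemma row3Z k a b c : k *: row3 a b c = row3 (k * a) (k * b) (k * c).
Proof. by apply/rowP => -[[|[|[|//]]] lti]; rewrite !mxE. Qed.

Lemma lineCE a b c :
  lineC (row3 a b c) <-> [|| a != 0, b != 0 | c != 0] /\ a + b + c = 0.
Proof.
have -> : a + b + c = \sum_i row3 a b c ord0 i.
  by rewrite !big_ord_recl big_ord0 !mxE /= addr0 addrA.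
by rewrite -row3_neq0.
Qed.

Lemma torus_actE om a b c :
  torus_act om (row3 a b c) = row3 a (om.1 * b) (om.2 * c).
Proof. by apply/rowP => -[[|[|[|//]]] lti]; rewrite !mxE //= mul1r. Qed.

Lemma translate_lineCE om a b c : torus om ->
  (torus_act om @` lineC) (row3 a b c) <->
  [|| a != 0, b != 0 | c != 0] /\ a + om.1^-1 * b + om.2^-1 * c = 0.
Proof.
case: om => u v [/= u0 v0]; split.
  move=> [y]; have [a' [b' [c' ->]]] := row3P y => /lineCE[ny Cy].
  rewrite torus_actE /= => /row3_inj[<- <- <-].
  by rewrite !mulKf // !mulf_eq0 (negPf u0) (negPf v0).
move=> [nx Cx]; exists (row3 a (u^-1 * b) (v^-1 * c)).
  by apply/lineCE; rewrite !mulf_eq0 !invr_eq0 (negPf u0) (negPf v0).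
by rewrite torus_actE /= !mulVKf.
Qed.

Lemma lineC_capE om : torus om -> om <> (1, 1) ->
  lineC `&` (torus_act om @` lineC) =
  [set k *: lineC_cap om | k in [set k | k != 0]].
Proof.
move=> tom om1; have [u0 v0] := tom.
set p := om.1^-1; set q := om.2^-1.
have nz : [|| q - p != 0, 1 - q != 0 | p - 1 != 0].
  apply/negPn/negP; rewrite !negb_or !negbK !subr_eq0 => /and3P[_ /eqP q1 /eqP p1].
  apply: om1; rewrite [om]surjective_pairing.
  by rewrite -[om.1]invrK -[om.2]invrK -/p -/q p1 -q1 !invr1.
apply/seteqP; split => [x [Cx Tx]|_ [k /= k0 <-]].
  have [a [b [c xE]]] := row3P x; rewrite xE in Cx Tx *.
  move: Cx Tx => /lineCE[nx Cx] /(translate_lineCE _ _ _ tom)[_ Tx].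
  rewrite -/p -/q in Tx.
  have aE : a = - b - c by rewrite -[LHS](addrK (b + c)) addrA Cx sub0r opprD.
  have bc : (p - 1) * b = (1 - q) * c.
    apply/eqP; rewrite -subr_eq0 -Tx aE; apply/eqP; ring.
  rewrite /lineC_cap -/p -/q.
  have [q1|q1] := eqVneq (1 - q) 0.
    have p1 : p - 1 != 0.
      by apply: contraL nz => /eqP p1; rewrite !negb_or !negbK q1 p1 eqxx /=
        andbT -(subrK 1 q) -addrA -opprB q1; move: p1 => /eqP; rewrite subr_eq0
        => /eqP->; rewrite subrr oppr0 addr0.
    have b0 : b = 0 by apply: (mulfI p1); rewrite bc q1 mul0r mulr0.
    have c0 : c != 0.
      by move: nx; rewrite aE b0 oppr0 sub0r oppr_eq0 eqxx /= orbb.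
    exists (c / (p - 1)); first by rewrite /= mulf_neq0 ?invr_eq0.
    rewrite row3Z q1 mulr0 b0 divfK // aE b0.
    have -> : q - p = - (p - 1) - (1 - q) by ring.
    by rewrite q1 subr0 mulrN divfK // oppr0 sub0r.
  have b0 : b != 0.
    apply: contraL nx => /eqP b0; have c0 : c = 0.
      by apply: (mulfI q1); rewrite -bc b0 !mulr0.
    by rewrite aE b0 c0 subr0 oppr0 eqxx.
  exists (b / (1 - q)); first by rewrite /= mulf_neq0 ?invr_eq0.
  have cE : c = b / (1 - q) * (p - 1).
    by apply: (mulfI q1); rewrite -bc mulrA mulrCA divff // mulr1 mulrC.
  have bE : b = b / (1 - q) * (1 - q) by rewrite divfK.
  move: (b / (1 - q)) cE bE => k cE bE.
  by rewrite row3Z aE cE bE; congr row3; ring.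
rewrite /lineC_cap -/p -/q row3Z.
have nkz : [|| k * (q - p) != 0, k * (1 - q) != 0 | k * (p - 1) != 0].
  by rewrite !mulf_eq0 !(negPf k0).
split; first by apply/lineCE; split=> //; ring.
by apply/translate_lineCE => //; split=> //; rewrite -/p -/q; ring.
Qed.

(* Main.v *)
(** Put [a = om.1^-1] and [b = om.2^-1].  If [z] is a primitive [n]-th root of
unity generating the group generated by [a] and [b], the coordinates [b - a],
[1 - b], [a - 1] generate the same ideal of [Z[z]] as [1 - z].  So the finite
places contribute nothing, unless [n] is a power of a prime [p], in which case
the contribution of the place over [p] is at most [2 ln n / n] in absolute value.
The Archimedean places contribute the mean, over the Galois conjugates [(x, y)]
of [(a, b)], of [ln D] where [D] is the largest of the chords [|y - x|],
[|1 - y|], [|x - 1|].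

By strictness [n] tends to infinity and the Galois orbits equidistribute: a
character mean is a normalized Ramanujan sum, hence small unless its order
divides a fixed factorial, and Fejer kernels pass from characters to Lipschitz
functions, comparing the orbit with the full group of [N]-torsion points.  The
logarithm is unbounded near [(1, 1)].  With [t = 1 - D^2/2], which is the
minimum of [Re x], [Re y] and [Re (y / x)], and [g_r t = ln (1 - 2rt + r^2) / 2],
pointwise [g_r t - g_r (Re x) + ln |1 - x| <= ln D <= g_r t - (ln r) / 2],
where [ln |1 - x|] has mean at least [0] because the norm of [1 - a] is a nonzero
integer, and [g_r (Re x)] has mean close to [0].

Finally [g_r t = - sum_m r^m T_m(t) / m] with the Chebyshev polynomials [T_m].
On [N]-torsion points [t = cos (2 pi c / N)], where [c] is the longest of the
three arcs cut out on the circle by [1], [x], [y].  The number of points with a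
given [c] is piecewise linear in [c], and a second difference gives the mean
of [T_m(t)] as [(3 / (2 pi^2 m^2)) (8 [2|m] - 9/2 [3|m] - 7/2)] in the limit.
Summing over [m] with signs yields [4 zeta(3) / pi^2]. *)

(* Because [local_degree] refers to an arbitrary completion, the Archimedean places need an exact
   answer: every completion is shown to be isometric to the complex numbers, and an absolute value
   of any other shape receives degree 0 and drops out. At a ramified finite place the degree enters
   only an error term, so the upper bound [totient n] is enough, and neither a place nor a
   completion is constructed there. The logarithm is replaced by [g_r] with [r < 1] because the
   Chebyshev series of [g_r] converges uniformly: a truncation is a combination of Lipschitz
   functions, to which equidistribution applies. One fixes [r], then the truncation, and only then
   lets the orbit grow. In the lower bound the singularity of [ln D] is absorbed by [ln |1 - x|], so
   that orbit points near (1, 1) are never counted. Torsion means are taken at levels [N = 6 M]: the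
   breakpoints [N / 3] and [N / 2] of the count of longest arcs are then integers, and the second
   difference involves cube and square roots of unity only. *)
From HB Require Import structures.
Require Import Defs.
From mathcomp Require Import all_boot all_order all_algebra all_field.
From mathcomp Require Import all_classical all_reals all_analysis.
From mathcomp Require Import complex.
From mathcomp Require Import ring lra zify.

Set Implicit Arguments.
Unset Strict Implicit.
Unset Printing Implicit Defensive.

Import Order.TTheory GRing.Theory Num.Theory.
Import numFieldNormedType.Exports.

Local Open Scope classical_set_scope.
Local Open Scope ring_scope.

(** * Absolute values *)

Lemma bernoulli_ler (R : realType) (d : R) k : 0 <= d -> 1 + d *+ k <= (1 + d) ^+ k.
Proof.
move=> d0; elim: k => [|k IH]; first by rewrite mulr0n addr0 expr0.
rewrite exprS; apply: (@le_trans _ _ ((1 + d) * (1 + d *+ k))).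
  have h : 0 <= k%:R * (d * d) by rewrite !mulr_ge0.
  rewrite -!(mulr_natl d) -natr1; nra.
by rewrite ler_wpM2l // addr_ge0.
Qed.

(** Power trick: a factor growing linearly in the exponent cannot hide an exponential gap. It serves
    both to derive the ultrametric inequality and to turn a comparison of norms up to a constant
    into a sharp one. *)
Lemma le_of_expr_le_linear (R : realType) (u v a : R) : 0 <= u -> 0 <= v ->
  (forall k, u ^+ k <= a * k.+1%:R * v ^+ k) -> u <= v.
Proof.
move=> u0 v0 H; rewrite leNgt; apply/negP => vu.
have v_gt0 : 0 < v.
  rewrite lt_def v0 andbT; apply/eqP => vE; have := H 1%N.
  by rewrite vE expr1 expr1 mulr0 leNgt -vE vu.
pose d := u / v - 1.
have d0 : 0 < d by rewrite subr_gt0 ltr_pdivlMr // mul1r.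
have Hq k : (1 + d) ^+ k <= a * k.+1%:R.
  rewrite /d addrC subrK expr_div_n ler_pdivrMr ?exprn_gt0 //; exact: H.
(* At exponent [2k], the square of Bernoulli's inequality is quadratic in [k] and beats the linear
   right-hand side as soon as [k > 3a / d^2]. *)
have Hk k : (k%:R * d) ^+ 2 <= a * (k.*2).+1%:R.
  apply: le_trans (Hq k.*2); rewrite -muln2 exprM ler_pXn2r ?nnegrE //.
  - by apply: le_trans (bernoulli_ler k (ltW d0)); rewrite mulr_natl lerDr.
  - by rewrite mulr_ge0 // ltW.
  - by rewrite exprn_ge0 // addr_ge0 // ltW.
have a0 : 1 <= a by have := Hq 0%N; rewrite expr0 mulr1.
have [k hk] : exists k : nat, 3 * a / d ^+ 2 < k%:R.
  exists (Num.truncn (3 * a / d ^+ 2)).+1; exact: truncnS_gt.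
have k0 : 0 < k%:R :> R.
  by apply: le_lt_trans hk; rewrite divr_ge0 ?sqr_ge0 // mulr_ge0 // (le_trans _ a0).
have := Hk k; rewrite leNgt => /negP; apply.
move: hk; rewrite ltr_pdivrMr ?exprn_gt0 // => hk.
have k1 : 1 <= k%:R :> R by rewrite ler1n -(ltr0n R).
apply: (@le_lt_trans _ _ (k%:R * (3 * a))).
  rewrite -natr1 -muln2 natrM; nra.
rewrite exprMn expr2 -mulrA ltr_pM2l //.
Qed.

Section AbsoluteValue.
Variables (R : realType) (K : fieldType) (w : K -> R).
Hypothesis hw : absolute_value w.

Lemma absv_ge0 x : 0 <= w x. Proof. by case: hw. Qed.
Lemma absv_eq0 x : (w x == 0) = (x == 0).
Proof. by case: hw => _ h _ _; apply/eqP/eqP => /h. Qed.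
Lemma absvM : {morph w : x y / x * y}. Proof. by case: hw. Qed.
Lemma absvD x y : w (x + y) <= w x + w y. Proof. by case: hw. Qed.
Lemma absv0 : w 0 = 0. Proof. by apply/eqP; rewrite absv_eq0. Qed.
Lemma absv_gt0 x : (0 < w x) = (x != 0).
Proof. by rewrite lt_def absv_ge0 andbT absv_eq0. Qed.
Lemma absv1 : w 1 = 1.
Proof.
apply: (@mulfI _ (w 1)); first by rewrite absv_eq0 oner_eq0.
by rewrite -absvM !mulr1.
Qed.
Lemma absvX x n : w (x ^+ n) = w x ^+ n.
Proof. by elim: n => [|n IH]; rewrite ?expr0 ?absv1 // !exprS absvM IH. Qed.
Lemma absvN x : w (- x) = w x.
Proof.
rewrite -mulN1r absvM; suff -> : w (-1) = 1 by rewrite mul1r.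
have /eqP : w (-1) ^+ 2 = 1 by rewrite -absvX sqrrN expr1n absv1.
rewrite sqrf_eq1 => /orP[/eqP //|/eqP h].
by have := absv_ge0 (-1); rewrite h ler0N1.
Qed.
Lemma absvBC x y : w (x - y) = w (y - x).
Proof. by rewrite -absvN opprB. Qed.
Lemma absv_sum (I : Type) (r : seq I) (P : pred I) (F : I -> K) :
  w (\sum_(i <- r | P i) F i) <= \sum_(i <- r | P i) w (F i).
Proof.
elim/big_rec2: _ => [|i y x _ h]; first by rewrite absv0.
by apply: le_trans (absvD _ _) _; rewrite lerD2l.
Qed.
Lemma absv_prod (I : Type) (r : seq I) (P : pred I) (F : I -> K) :
  w (\prod_(i <- r | P i) F i) = \prod_(i <- r | P i) w (F i).
Proof. by apply: (big_morph w absvM absv1). Qed.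
Lemma absv_dist x y z : w (x - z) <= w (x - y) + w (y - z).
Proof. by rewrite -[x - z](subrKA y); apply: absvD. Qed.
Lemma absvV x : w x^-1 = (w x)^-1.
Proof.
have [->|x0] := eqVneq x 0; first by rewrite invr0 absv0 invr0.
apply: (@mulfI _ (w x)); first by rewrite absv_eq0.
by rewrite -absvM !divff ?absv1 // absv_eq0.
Qed.
Lemma absv_unity_root x n : (0 < n)%N -> x ^+ n = 1 -> w x = 1.
Proof.
move=> n0 xn; apply/eqP; rewrite -(@pexpr_eq1 _ _ n) ?absv_ge0 //.
by rewrite -absvX xn absv1.
Qed.
Lemma absv_eq x y : (forall e, 0 < e -> w (x - y) <= e) -> x = y.
Proof.
move=> h; apply/eqP; rewrite -subr_eq0 -absv_eq0 eq_le absv_ge0 andbT.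
apply/ler_addgt0Pr => e e0; rewrite add0r; exact: h.
Qed.
Lemma absv_dist_le x y : `|w x - w y| <= w (x - y).
Proof.
rewrite ler_norml lerNl opprB !lerBlDr; apply/andP; split.
  by rewrite absvBC -{1}(subrK x y) absvD.
by rewrite -{1}(subrK y x) absvD.
Qed.

Section Ultrametric.
Hypothesis w_nat : forall m : nat, w m%:R <= 1.

(** Binomial coefficients have absolute value at most 1, so the expansion of [(x + y)^k] has [k + 1]
    terms of size at most [c^k]; the power trick removes the factor [k + 1]. *)
Lemma ultrametricD x y c : w x <= c -> w y <= c -> w (x + y) <= c.
Proof.
move=> xc yc; have c0 : 0 <= c := le_trans (absv_ge0 x) xc.
apply: (@le_of_expr_le_linear _ _ _ 1); rewrite ?absv_ge0 // => k.
rewrite -absvX exprDn mul1r; apply: (le_trans (absv_sum _ _ _)).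
have -> : k.+1%:R * c ^+ k = \sum_(i < k.+1) c ^+ k.
  by rewrite sumr_const card_ord mulr_natl.
apply: ler_sum => i _; rewrite -mulr_natl absvM.
apply: (@le_trans _ _ (1 * w (x ^+ (k - i) * y ^+ i))).
  by rewrite ler_wpM2r // absv_ge0.
have ik : (i <= k)%N by rewrite -ltnS.
rewrite mul1r absvM !absvX -[in leRHS](subnK ik) exprD.
by apply: ler_pM; rewrite ?exprn_ge0 ?absv_ge0 // lerXn2r ?nnegrE ?absv_ge0.
Qed.

Lemma ultrametricB x y c : w x <= c -> w y <= c -> w (x - y) <= c.
Proof. by move=> xc yc; apply: ultrametricD; rewrite ?absvN. Qed.

Lemma ultrametric_sum (I : Type) (r : seq I) (P : pred I) (F : I -> K) c :
  0 <= c -> (forall i, P i -> w (F i) <= c) -> w (\sum_(i <- r | P i) F i) <= c.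
Proof.
move=> c0 h; elim/big_rec: _ => [|i x Pi]; first by rewrite absv0.
by apply: ultrametricD; apply: h.
Qed.
End Ultrametric.
End AbsoluteValue.

Definition rmorphism_of (A B : pzRingType) (f : A -> B) (f1 : f 1 = 1)
    (fB : {morph f : x y / x - y}) (fM : {morph f : x y / x * y}) :
  {g : {rmorphism A -> B} | g =1 f}.
Proof.
pose g : {rmorphism A -> B} :=
  HB.pack f (GRing.isZmodMorphism.Build _ _ f fB)
            (GRing.isMonoidMorphism.Build _ _ f (conj f1 fM)).
by exists g.
Qed.

(** * Complex numbers and roots of unity *)

Section Complex.
Variable R : realType.
Implicit Types (z : R[i]) (t : R).

Definition cabs : R[i] -> R := @Normc.normc R.

Lemma cabs_absv : absolute_value cabs.
Proof.
split.
- by case=> a b; rewrite /cabs /= sqrtr_ge0.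
- move=> z; split; [exact: Normc.eq0_normc | move=> ->; exact: Normc.normc0].
- exact: Normc.normcM.
- exact: le_normcD.
Qed.

Lemma cabsE z : cabs z = Num.sqrt (complex.Re z ^+ 2 + complex.Im z ^+ 2).
Proof. by case: z. Qed.

Lemma cabs_sqr z : cabs z ^+ 2 = complex.Re z ^+ 2 + complex.Im z ^+ 2.
Proof. by rewrite cabsE sqr_sqrtr // addr_ge0 // sqr_ge0. Qed.

Lemma cabs_real t : cabs t%:C%C = `|t|.
Proof. by rewrite cabsE /= expr0n addr0 sqrtr_sqr. Qed.

Lemma Re_le_cabs z : `|complex.Re z| <= cabs z.
Proof. by rewrite cabsE -sqrtr_sqr ler_wsqrtr // lerDl sqr_ge0. Qed.

Lemma Im_le_cabs z : `|complex.Im z| <= cabs z.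
Proof. by rewrite cabsE -sqrtr_sqr ler_wsqrtr // lerDr sqr_ge0. Qed.

Lemma cabs_le_ReIm z : cabs z <= `|complex.Re z| + `|complex.Im z|.
Proof.
rewrite -(ler_pXn2r (ltn0Sn 1)) ?nnegrE ?addr_ge0 ?(absv_ge0 cabs_absv) //.
rewrite cabs_sqr sqrrD !real_normK ?num_real // -addrA [_ *+ 2 + _]addrC addrA.
by rewrite lerDl mulrn_wge0 // mulr_ge0.
Qed.

Lemma ReB z1 z2 : complex.Re (z1 - z2) = complex.Re z1 - complex.Re z2.
Proof. by case: z1; case: z2. Qed.
Lemma ImB z1 z2 : complex.Im (z1 - z2) = complex.Im z1 - complex.Im z2.
Proof. by case: z1; case: z2. Qed.
Lemma ReD z1 z2 : complex.Re (z1 + z2) = complex.Re z1 + complex.Re z2.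
Proof. by case: z1; case: z2. Qed.
Lemma ImD z1 z2 : complex.Im (z1 + z2) = complex.Im z1 + complex.Im z2.
Proof. by case: z1; case: z2. Qed.
Lemma ReM z1 z2 : complex.Re (z1 * z2) =
  complex.Re z1 * complex.Re z2 - complex.Im z1 * complex.Im z2.
Proof. by case: z1; case: z2. Qed.
Lemma ImM z1 z2 : complex.Im (z1 * z2) =
  complex.Re z1 * complex.Im z2 + complex.Im z1 * complex.Re z2.
Proof. by case: z1 => a b; case: z2 => c d /=; rewrite addrC. Qed.

Lemma real_cauchy_cvg (u : nat -> R) :
  (forall e, 0 < e -> exists N, forall m n, (N <= m)%N -> (N <= n)%N ->
     `|u m - u n| < e) ->
  exists l, forall e, 0 < e -> exists N, forall n, (N <= n)%N -> `|u n - l| < e.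
Proof.
move=> hu; have : cvg (u @ \oo).
  apply/cauchy_cvgP/cauchy_exP => _/posnumP[e].
  have [N hN] := hu _ (gt0 e); exists (u N); exists N => // n /= Nn; exact: hN.
move=> /cvgrPdist_lt hl; exists (lim (u @ \oo)) => e e0.
have [N _ hN] := hl e e0; exists N => n Nn.
by rewrite distrC; apply: hN.
Unshelve. all: by end_near. Qed.

Lemma complex_complete (u : nat -> R[i]) : cauchy_for cabs u ->
  exists l, converges_for cabs u l.
Proof.
move=> hu.
have [a ha] : exists a, forall e, 0 < e -> exists N, forall n, (N <= n)%N ->
    `|complex.Re (u n) - a| < e.
  apply: real_cauchy_cvg => e /hu[N hN]; exists N => m n Nm Nn.
  by rewrite -ReB; apply: le_lt_trans (Re_le_cabs _) (hN _ _ Nm Nn).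
have [b hb] : exists b, forall e, 0 < e -> exists N, forall n, (N <= n)%N ->
    `|complex.Im (u n) - b| < e.
  apply: real_cauchy_cvg => e /hu[N hN]; exists N => m n Nm Nn.
  by rewrite -ImB; apply: le_lt_trans (Im_le_cabs _) (hN _ _ Nm Nn).
exists (a +i* b)%C => e e0.
have e2 : 0 < e / 2 by rewrite divr_gt0.
have [N hN] := ha _ e2; have [M hM] := hb _ e2.
exists (maxn N M) => n; rewrite geq_max => /andP[/hN h1 /hM h2].
apply: le_lt_trans (cabs_le_ReIm _) _; rewrite ReB ImB /=.
by rewrite [e]splitr ltrD.
Qed.

Definition cis t : R[i] := (cos t +i* sin t)%C.

Lemma cisD t1 t2 : cis (t1 + t2) = cis t1 * cis t2.
Proof. by apply/eqP; rewrite eq_complex /= cosD sinD [_ * sin t2 + _]addrC !eqxx. Qed.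

Lemma cis0 : cis 0 = 1.
Proof. by apply/eqP; rewrite eq_complex /= cos0 sin0 !eqxx. Qed.

Lemma cisX t n : cis t ^+ n = cis (n%:R * t).
Proof.
elim: n => [|n IH]; first by rewrite mul0r cis0.
by rewrite exprS IH -cisD -natr1 mulrDl mul1r addrC.
Qed.

Lemma cabs_cis t : cabs (cis t) = 1.
Proof. by rewrite cabsE /= cos2Dsin2 sqrtr1. Qed.

Lemma cis_2pi : cis (2 * pi) = 1.
Proof. by rewrite mulr_natl /cis cos2pi sin2pi. Qed.

Lemma cos_eq1 t : 0 <= t -> t < 2 * pi -> cos t = 1 -> t = 0.
Proof.
move=> t0 t2 h; have p0 := pi_ge0 R.
have [tp|tp] := leP t pi.
  by apply: cos_inj; rewrite ?in_itv /= ?t0 ?lexx ?p0 // h cos0.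
have : 2 * pi - t = 0.
  apply: cos_inj; rewrite ?in_itv /= ?lexx ?p0 //; first by apply/andP; split; lra.
  by rewrite cos0 cosB h mulr_natl cos2pi sin2pi mul1r mul0r addr0.
by move=> ?; lra.
Qed.

Definition xi n : R[i] := cis (2 * pi / n%:R).

Lemma xiX n k : xi n ^+ k = cis (2 * pi * k%:R / n%:R).
Proof. by rewrite cisX; congr cis; rewrite mulrC mulrAC. Qed.

Lemma xi_prim n : (0 < n)%N -> n.-primitive_root (xi n).
Proof.
move=> n0; apply/andP; split => //; apply/forallP => k; rewrite unity_rootE xiX.
have n0' : 0 < n%:R :> R by rewrite ltr0n.
apply/eqP; have [->|nk] := eqVneq k.+1 n.
  by rewrite mulfK ?cis_2pi ?eqxx // gt_eqF.
apply/negbTE/eqP => /(congr1 (@complex.Re R)) /= h.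
have := cos_eq1 _ _ h; rewrite divr_ge0 ?mulr_ge0 ?pi_ge0 //.
have kn : k.+1%:R < n%:R :> R by rewrite ltr_nat ltn_neqAle nk ltn_ord.
rewrite ltr_pdivrMr // ltr_pM2l ?mulr_gt0 ?pi_gt0 // kn.
move=> /(_ isT isT)/eqP; apply/negP.
by rewrite !mulf_neq0 ?invr_neq0 ?pnatr_eq0 ?gt_eqF ?pi_gt0.
Qed.

Lemma rat_dense t e : 0 < e -> exists q : rat, `|t - ratr q| < e.
Proof.
move=> e0; have /rat_in_itvoo[q] : t - e < t + e by rewrite ltrD2l gt0_cp.
by rewrite in_itv /= => /andP[h1 h2]; exists q; rewrite ltr_distlC; apply/andP; split; lra.
Qed.

Section RealEmbedding.
Variables (L : fieldType) (W : L -> R) (iota : {rmorphism rat -> L}).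
Hypothesis hW : absolute_value W.
Hypothesis W_complete :
  forall u : nat -> L, cauchy_for W u -> exists l, converges_for W u l.
Hypothesis W_rat : forall q : rat, W (ratr q) = `|ratr q|.

Lemma ratrE_rmorph q : ratr q = iota q :> L.
Proof. by rewrite (fmorph_eq_rat iota). Qed.

Lemma iota_ratrB q1 q2 : ratr (q1 - q2) = ratr q1 - ratr q2 :> L.
Proof. by rewrite !ratrE_rmorph rmorphB. Qed.

(* The image of [t] in the completion [L], characterized by its distances to Q. *)
Lemma real_point_exists t : exists l : L, forall q, W (l - ratr q) = `|t - ratr q|.
Proof.
have /choice[u hu] : forall k : nat, exists q : rat, `|t - ratr q| < k.+1%:R^-1.
  by move=> k; apply: rat_dense; rewrite invr_gt0.
have inv_small (e : R) : 0 < e -> exists N, forall n, (N <= n)%N -> n.+1%:R^-1 < e.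
  move=> e0; exists (Num.truncn e^-1) => n hn.
  rewrite invf_plt ?posrE //; apply: lt_le_trans (truncnS_gt _) _.
  by rewrite ler_nat.
have uc : cauchy_for W (fun k => ratr (u k)).
  move=> e e0; have e2 : 0 < e / 2 by rewrite divr_gt0.
  have [N hN] := inv_small _ e2; exists N => m n Nm Nn.
  rewrite -iota_ratrB W_rat rmorphB /= -(subrKA t).
  apply: le_lt_trans (ler_normD _ _) _; rewrite [e]splitr ltrD //.
    by rewrite distrC; apply: lt_trans (hu m) (hN _ Nm).
  by apply: lt_trans (hu n) (hN _ Nn).
have [l hl] := W_complete uc; exists l => q.
apply/eqP; rewrite -subr_eq0 -normr_eq0 eq_le normr_ge0 andbT.
apply/ler_addgt0Pr => e e0; rewrite add0r.
have e2 : 0 < e / 2 by rewrite divr_gt0.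
have [N hN] := inv_small _ e2; have [M hM] := hl _ e2.
set n := maxn N M; have := hM n (leq_maxr _ _); have := hN n (leq_maxl _ _).
move=> h1 h2; have := hu n => h3.
have -> : W (l - ratr q) - `|t - ratr q| =
  (W (l - ratr q) - W (ratr (u n) - ratr q)) +
  (`|ratr (u n) - ratr q| - `|t - ratr q|).
  by rewrite -iota_ratrB W_rat rmorphB /= subrKA.
apply: le_trans (ler_normD _ _) _; rewrite [e]splitr lerD //.
  apply: le_trans (absv_dist_le hW _ _) _.
  by rewrite opprB addrA subrK (absvBC hW) ltW.
apply: le_trans (ler_dist_dist _ _) _; rewrite opprB addrA subrK distrC.
by rewrite ltW // (lt_trans h3).
Qed.

Lemma absv_small_eq (x y : L) c : (forall e, 0 < e -> W (x - y) <= c * e) -> x = y.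
Proof.
move=> h; apply: (absv_eq hW) => e e0.
have c1 : 0 < `|c| + 1 by rewrite ltr_wpDl.
apply: le_trans (h (e / (`|c| + 1)) _) _; first by rewrite divr_gt0.
rewrite mulrA ler_pdivrMr // mulrC ler_wpM2l ?(ltW e0) //.
by apply: le_trans (ler_norm _) _; rewrite lerDl.
Qed.

(** The distances of a point of [L] to Q determine it, so a choice of [real_point_exists] is a
    function; it is a morphism because each identity holds on Q and both sides vary little when the
    arguments are approximated by rationals. *)
Lemma real_embedding : exists f : {rmorphism R -> L}, forall t, W (f t) = `|t|.
Proof.
have /choice[f hf] := real_point_exists.
have norm_f t : W (f t) = `|t|.
  by have := hf t 0; rewrite ratrE_rmorph !rmorph0 !subr0.
have f1 : f 1 = 1.
  apply: (@absv_small_eq _ _ 0) => e _.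
  by have := hf 1 1; rewrite ratrE_rmorph !rmorph1 mul0r => ->; rewrite subrr normr0.
have fB : {morph f : x y / x - y}.
  move=> x y; apply: (@absv_small_eq _ _ 4) => e e0.
  have [p hp] := rat_dense x e0; have [q hq] := rat_dense y e0.
  have -> : f (x - y) - (f x - f y) = (f (x - y) - ratr (p - q)) -
      ((f x - ratr p) - (f y - ratr q)) by rewrite iota_ratrB; ring.
  apply: le_trans (absvD hW _ _) _; rewrite (absvN hW) hf.
  have h2 := absvD hW (f x - ratr p) (- (f y - ratr q)).
  rewrite (absvN hW) !hf in h2.
  have h3 : `|x - y - ratr (p - q)| <= `|x - ratr p| + `|y - ratr q|.
    have -> : x - y - ratr (p - q) = (x - ratr p) - (y - ratr q).
      by rewrite rmorphB /=; ring.
    exact: ler_normB.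
  by lra.
have fM : {morph f : x y / x * y}.
  move=> x y; apply: (@absv_small_eq _ _ (2 * (`|x| + `|y| + 1))) => e e0.
  (* Capping the precision at 1 bounds [ratr p] by [|x| + 1], whence the factor [|x| + |y| + 1] of
     the error. *)
  pose d := Num.min e 1; have d0 : 0 < d by rewrite lt_min e0 ltr01.
  have de : d <= e by rewrite ge_min lexx.
  have d1 : d <= 1 by rewrite ge_min lexx orbT.
  have [p hp] := rat_dense x d0; have [q hq] := rat_dense y d0.
  have -> : f (x * y) - f x * f y = (f (x * y) - ratr (p * q)) -
     ((f x - ratr p) * f y + ratr p * (f y - ratr q)).
    by rewrite !ratrE_rmorph rmorphM /=; ring.
  apply: le_trans (absvD hW _ _) _; rewrite (absvN hW) hf.
  have h2 := absvD hW ((f x - ratr p) * f y) (ratr p * (f y - ratr q)).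
  rewrite 2!(absvM hW) !hf W_rat norm_f in h2.
  have h3 : `|x * y - ratr (p * q)| <= `|x - ratr p| * `|y| + `|ratr p| * `|y - ratr q|.
    rewrite rmorphM /= -!normrM; apply: le_trans (ler_normD _ _); rewrite le_eqVlt.
    by apply/orP; left; apply/eqP; congr `|_|; ring.
  have h4 : `|ratr p| <= `|x| + 1.
    rewrite -[ratr p](subrK x); apply: le_trans (ler_normD _ _) _.
    by rewrite addrC lerD2l distrC; apply: le_trans (ltW hp) _.
  have := normr_ge0 x; have := normr_ge0 y; have := normr_ge0 (x - ratr p).
  have := normr_ge0 (y - ratr q); have := normr_ge0 (ratr p : R).
  move: h2 h3 h4 hp hq de d0; move: (W _) (`|x * y - _|) (`|x - _|) (`|y - _|) (`|ratr p|).
  move=> a b c k l h2 h3 h4 hp hq de d0 l0 k0 c0 y0 x0.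
  have : c * `|y| <= e * `|y| by rewrite ler_wpM2r //; lra.
  have : l * k <= (`|x| + 1) * e by apply: ler_pM => //; lra.
  by lra.
have [g hg] := rmorphism_of f1 fB fM.
by exists g => t; rewrite hg.
Qed.
End RealEmbedding.
End Complex.

(** * Places of cyclotomic fields *)

(** Some factor [Phi_d] of [X^n - 1] vanishes at [x]; then [x^d = 1], which forces [d = n]. This
    works in any field, where irreducibility of [Phi_n] is meaningless. *)
Lemma root_Cyclotomic_prim (F : fieldType) n (x : F) :
  n.-primitive_root x -> (map_poly intr 'Phi_n).[x] = 0.
Proof.
move=> prx; have n0 := prim_order_gt0 prx.
have /(congr1 (fun p => (map_poly (intr : int -> F) p).[x])) := prod_Cyclotomic n0.
rewrite rmorphB rmorph1 /= map_polyXn rmorph_prod horner_prod !hornerE.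
rewrite (prim_expr_order prx) subrr => /eqP; rewrite prodf_seq_eq0 => /hasP[d].
rewrite -dvdn_divisors // => dn /= /eqP hd.
suff -> : n = d by [].
apply/eqP; rewrite eqn_dvd dn andbT (prim_order_dvd prx).
have d0 : (0 < d)%N := dvdn_gt0 n0 dn.
have /(congr1 (fun p => (map_poly (intr : int -> F) p).[x])) := prod_Cyclotomic d0.
rewrite rmorphB rmorph1 /= map_polyXn rmorph_prod horner_prod !hornerE.
rewrite (bigD1_seq d) /= ?divisors_uniq -?dvdn_divisors //.
rewrite hd mul0r => /esym/eqP; rewrite subr_eq0 //.
Qed.

Section CyclotomicField.
Variables (K : fieldExtType rat) (toC : {rmorphism K -> algC}) (n : nat) (z : K).
Hypothesis z_prim : n.-primitive_root z.
Hypothesis z_gen : <<1%AS; z>>%VS = fullv.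

Lemma poly_horner_exists x : exists p : {poly rat}, x = (map_poly (in_alg K) p).[z].
Proof.
have : x \in <<1%AS; z>>%VS by rewrite z_gen memvf.
by move=> /Fadjoin_polyP[p /polyOver1P[q ->] ->]; exists q.
Qed.

(** This is the irreducibility of [Phi_n] over Q, read off in [algC], where [Phi_n] is the minimal
    polynomial of [toC z]. *)
Lemma Cyclotomic_dvd (p : {poly rat}) :
  (map_poly (in_alg K) p).[z] = 0 -> map_poly intr 'Phi_n %| p.
Proof.
move=> pz; have [q [qE _] qP] := minCpolyP (toC z).
have tz : n.-primitive_root (toC z) by rewrite fmorph_primitive_root.
have -> : map_poly intr 'Phi_n = q.
  apply: (map_inj_poly (fmorph_inj (ratr : {rmorphism rat -> algC}))); rewrite ?rmorph0 //.
  rewrite -qE (minCpoly_cyclotomic tz) -(Cintr_Cyclotomic tz) -map_poly_comp.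
  by apply: eq_map_poly => i /=; rewrite ratr_int.
rewrite -qP /root -(rmorph0 toC) -pz -horner_map -map_poly_comp /=.
by apply/eqP; congr (_.[_]); apply: eq_map_poly => i /=; exact/esym/(fmorph_eq_rat (toC \o in_alg K)).
Qed.

(** [K] is the quotient of Q[X] by [Phi_n]: any choice of polynomials representing the elements of
    [K] at [z] can be evaluated at [x], and [Cyclotomic_dvd] makes the value independent of the
    choice. *)
Lemma cyclotomic_embedding (F : fieldType) (iota : {rmorphism rat -> F}) (x : F) :
  n.-primitive_root x -> exists s : {rmorphism K -> F}, s z = x.
Proof.
move=> prx.
have wd (p q : {poly rat}) : (map_poly (in_alg K) p).[z] = (map_poly (in_alg K) q).[z] ->
    (map_poly iota p).[x] = (map_poly iota q).[x].
  move=> pq; have /dvdpP[r] : map_poly intr 'Phi_n %| p - q.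
    by apply: Cyclotomic_dvd; rewrite rmorphB /= hornerD hornerN pq subrr.
  move=> /(congr1 (fun p => (map_poly iota p).[x])).
  rewrite rmorphB rmorphM /= hornerD hornerN hornerM -map_poly_comp.
  have -> : map_poly (iota \o intr) 'Phi_n = map_poly intr 'Phi_n.
    by apply: eq_map_poly => i /=; rewrite rmorph_int.
  by rewrite root_Cyclotomic_prim // mulr0 => /subr0_eq.
have /choice[f hf] := poly_horner_exists.
have fE p : (map_poly iota (f (map_poly (in_alg K) p).[z])).[x] = (map_poly iota p).[x].
  by apply: wd; rewrite -hf.
have f1 : (map_poly iota (f 1)).[x] = 1.
  by have := fE 1; rewrite !rmorph1 !hornerE.
have fB : {morph (fun y => (map_poly iota (f y)).[x]) : a b / a - b}.
  move=> a b /=; have := fE (f a - f b).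
  by rewrite !rmorphB /= !hornerD !hornerN -!hf.
have fM : {morph (fun y => (map_poly iota (f y)).[x]) : a b / a * b}.
  move=> a b /=; have := fE (f a * f b).
  by rewrite !rmorphM /= !hornerM -!hf.
have [s hs] := rmorphism_of f1 fB fM; exists s.
by rewrite hs; have := fE 'X; rewrite !map_polyX !hornerX.
Qed.

Lemma embedding_eq (F : fieldType) (s t : {rmorphism K -> F}) : s z = t z -> s =1 t.
Proof.
move=> st x; have [p ->] := poly_horner_exists x.
rewrite -!horner_map /= st -!map_poly_comp; congr (_.[_]).
apply: eq_map_poly => i /=.
exact: etrans (fmorph_eq_rat (s \o in_alg K) i)
  (esym (fmorph_eq_rat (t \o in_alg K) i)).
Qed.

Lemma dim_cyclotomic : \dim {: K} = totient n.
Proof.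
rewrite -z_gen dim_Fadjoin dimv1 muln1.
have := size_minPoly 1%AS z; suff -> : size (minPoly 1%AS z) = (totient n).+1 by case.
have mz := root_minPoly 1%AS z.
have /polyOver1P[m mE] := minPolyOver 1%AS z.
have sPhi : size (map_poly (intr : int -> rat) 'Phi_n) = (totient n).+1.
  by rewrite size_map_inj_poly ?size_Cyclotomic //; apply: intr_inj.
apply/eqP; rewrite eqn_leq; apply/andP; split.
  rewrite -sPhi -(size_map_poly (in_alg K)); apply: dvdp_leq.
    by rewrite map_poly_eq0 -size_poly_gt0 sPhi.
  apply: minPoly_dvdp; first exact: alg_polyOver.
  rewrite /root -map_poly_comp.
  have -> : map_poly (in_alg K \o intr) 'Phi_n = map_poly intr 'Phi_n.
    by apply: eq_map_poly => i /=; rewrite -(rmorph_int (in_alg K)).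
  by rewrite root_Cyclotomic_prim.
rewrite -sPhi mE size_map_poly; apply: dvdp_leq.
  by rewrite -(map_poly_eq0 (in_alg K)) -mE monic_neq0 // monic_minPoly.
by apply: Cyclotomic_dvd; rewrite -mE; apply/eqP.
Qed.
End CyclotomicField.

(** Each factor [X - xi^k] is multiplied by its conjugate. The factorization then has real
    coefficients and can be transported to any field containing the reals. *)
Lemma cos_quadratic_prod (R : realType) n : (0 < n)%N ->
  \prod_(0 <= k < n) ('X^2 - (2 * complex.Re (xi R n ^+ k)) *: 'X + 1 : {poly R})
  = ('X^n - 1) ^+ 2.
Proof.
move=> n0; apply: (map_inj_poly (@complexI R) (rmorph0 _)).
have h := factor_Xn_sub_1 (xi_prim R n0).
have /(congr1 (map_poly (@conjc R))) := h.
rewrite rmorph_prod rmorphB /= map_polyXn rmorph1 => h'.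
rewrite rmorph_prod rmorphXn rmorphB /= map_polyXn rmorph1 [RHS]expr2 -{1}h -h'.
rewrite -big_split /=; apply: eq_bigr => k _.
rewrite rmorphD rmorphB /= map_polyXn map_polyZ /= map_polyX rmorph1.
rewrite rmorphB /= map_polyX map_polyC /=.
set u := xi R n ^+ k.
have -> : (2 * complex.Re u)%:C%C = u + (u^*)%C by rewrite addcJ rmorphM /= rmorph_nat.
have uu : u * (u^*)%C = 1.
  rewrite /u xiX; apply/eqP; rewrite eq_complex /= mulrN opprK -!expr2 cos2Dsin2.
  by rewrite mulrN mulrC addNr !eqxx.
rewrite mulrBl !mulrBr -polyCM uu -mul_polyC polyCD; ring.
Qed.

Lemma complex_rmorphism (R : realType) (L : fieldType) (f : {rmorphism R -> L}) (J : L) :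
  J ^+ 2 = -1 ->
  exists I : {rmorphism R[i] -> L}, forall a b, I (a +i* b)%C = f a + f b * J.
Proof.
move=> J2.
have [] := @rmorphism_of R[i] L (fun u => f (complex.Re u) + f (complex.Im u) * J).
- by rewrite /= rmorph1 rmorph0 mul0r addr0.
- by move=> u v; rewrite ReB ImB !rmorphB /=; ring.
- move=> u v; rewrite ReM ImM rmorphB rmorphD !rmorphM /=.
  set a := f _; set b := f _; set c := f _; set d := f _.
  have -> : (a + c * J) * (d + b * J) = a * d + (a * b + c * d) * J + c * b * J ^+ 2 by ring.
  by rewrite J2; ring.
- by move=> I hI; exists I => a b; rewrite hI.
Qed.

(** * Archimedean places of a cyclotomic field *)

Section ArchimedeanPlaces.
Variables (R : realType) (K : fieldExtType rat) (toC : {rmorphism K -> algC}).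
Variables (n : nat) (z : K).
Hypothesis z_prim : n.-primitive_root z.
Hypothesis z_gen : <<1%AS; z>>%VS = fullv.
Hypothesis n_gt2 : (2 < n)%N.

Let n_gt0 : (0 < n)%N. Proof. exact: ltn_trans n_gt2. Qed.

Lemma complex_embeddings : exists E : nat -> {rmorphism K -> R[i]},
  forall k, coprime k n -> E k z = xi R n ^+ k.
Proof.
suff /choice[E hE] : forall k, exists s : {rmorphism K -> R[i]},
    coprime k n -> s z = xi R n ^+ k by exists E.
pose iota : {rmorphism rat -> R[i]} := real_complex R \o (ratr : {rmorphism rat -> R}).
move=> k; have [kn|kn] := boolP (coprime k n); last first.
  by have [s _] := cyclotomic_embedding toC z_prim z_gen iota (xi_prim R n_gt0); exists s.
have prk : n.-primitive_root (xi R n ^+ k) by rewrite prim_root_exp_coprime // xi_prim.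
by have [s hs] := cyclotomic_embedding toC z_prim z_gen iota prk; exists s.
Qed.

Variable E : nat -> {rmorphism K -> R[i]}.
Hypothesis E_z : forall k, coprime k n -> E k z = xi R n ^+ k.

Lemma ratr_complex q : ratr q = (ratr q)%:C%C :> R[i].
Proof. exact/esym/(fmorph_eq_rat (real_complex R \o (ratr : {rmorphism rat -> R}))). Qed.

Lemma Im_xiX k : coprime k n -> complex.Im (xi R n ^+ k) != 0.
Proof.
move=> kn; apply/eqP => h.
have prk : n.-primitive_root (xi R n ^+ k) by rewrite prim_root_exp_coprime // xi_prim.
have : (xi R n ^+ k) ^+ 2 = 1.
  move: h; rewrite xiX => h; rewrite expr2; apply/eqP; rewrite eq_complex /= in h *.
  rewrite h !mulr0 mul0r addr0 subr0 eqxx andbT -expr2.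
  by have := cos2Dsin2 (2 * pi * k%:R / n%:R : R); rewrite h expr0n addr0 => ->.
by move=> /eqP; rewrite -(prim_order_dvd prk) => /(dvdn_leq (ltn0Sn 1)); rewrite leqNgt n_gt2.
Qed.

Lemma closureQ_complex : closureQ (@cabs R) = [set u | complex.Im u = 0].
Proof.
apply/seteqP; split => u /= h.
  apply/eqP; rewrite -normr_eq0 eq_le normr_ge0 andbT.
  apply/ler_addgt0Pr => e e0; rewrite add0r; have [q hq] := h e e0.
  move: (Im_le_cabs (u - ratr q)) hq; rewrite ImB ratr_complex /= subr0 => h1 h2.
  exact: ltW (le_lt_trans h1 h2).
move=> e e0; have [q hq] := rat_dense (complex.Re u) e0; exists q.
case: u h hq => a b /= -> hq; rewrite ratr_complex.
have -> : (a +i* 0)%C - (ratr q)%:C%C = (a - ratr q)%:C%C by rewrite rmorphB.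
by rewrite cabs_real.
Qed.

Lemma complex_degree2 : has_degree (closureQ (@cabs R)) 2.
Proof.
rewrite closureQ_complex.
exists (fun i => if i == 0 then 1 else 'i%C); split.
  move=> y; exists (fun i => if i == 0 then (complex.Re y)%:C%C else (complex.Im y)%:C%C).
    by move=> i /=; case: ifP.
  rewrite !big_ord_recl big_ord0 /= addr0 mulr1 {1}(complexE y).
  by rewrite [X in _ = _ + X]mulrC.
move=> a ha; rewrite !big_ord_recl big_ord0 /= addr0 mulr1 => h.
have /eqP := h; have := ha 0; have := ha (lift 0 0).
case E0 : (a 0) => [u v]; case E1 : (a (lift 0 0)) => [u' v'] /= v'0 v0; rewrite v0 v'0.
rewrite eq_complex /= => /andP[/eqP u0 /eqP u1].
have {}u0 : u = 0 by lra.
have {}u1 : u' = 0 by lra.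
move=> i; case: (unliftP 0 i) => [j|] ->; last by rewrite E0 u0 v0.
by rewrite ord1 E1 u1 v'0.
Qed.

(** The real and imaginary parts of a basis form an [m x 2] real matrix; freeness makes it row free
    and spanning makes it row full, so it is square. *)
Lemma complex_degree_unique m : has_degree (closureQ (@cabs R)) m -> m = 2%N.
Proof.
rewrite closureQ_complex => -[b [span free]].
pose B := \matrix_(i < m, j < 2) (if j == 0 then complex.Re (b i) else complex.Im (b i)).
have mulB (v : 'rV[R]_m) : let s := \sum_i (v ord0 i)%:C%C * b i in
   v *m B = \row_(j < 2) (if j == 0 then complex.Re s else complex.Im s).
  apply/rowP => j; rewrite !mxE; case: ifP => j0.
    rewrite (big_morph (@complex.Re R) (@ReD R) erefl); apply: eq_bigr => i _.
    by rewrite !mxE j0 ReM /= mul0r subr0.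
  rewrite (big_morph (@complex.Im R) (@ImD R) erefl); apply: eq_bigr => i _.
  by rewrite !mxE j0 ImM /= mul0r addr0.
have Bfree : row_free B.
  apply: inj_row_free => v; rewrite mulB => /rowP h.
  have h0 := h 0; have h1 := h (lift 0 0); rewrite !mxE /= in h0 h1.
  apply/rowP => i; rewrite mxE.
  suff : (v ord0 i)%:C%C = 0 :> R[i] by case.
  apply: (free (fun i => (v ord0 i)%:C%C)) => //.
  by apply/eqP; rewrite eq_complex h0 h1 /= !eqxx.
have Bfull : row_full B.
  rewrite -sub1mx; apply/row_subP => k; set r := row k _.
  have [a ha ya] := span (r 0 0 +i* r 0 (lift 0 0))%C.
  apply/submxP; exists (\row_i complex.Re (a i)); rewrite mulB.
  have -> : \sum_i ((\row_i0 complex.Re (a i0)) ord0 i)%:C%C * b i = \sum_i a i * b i.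
    apply: eq_bigr => i _; rewrite mxE; congr (_ * _).
    by have := ha i; case: (a i) => u v /= ->.
  rewrite -ya; apply/rowP => i; rewrite [RHS]mxE.
  by have [j ->|->] := unliftP 0 i; rewrite ?ord1 //.
by move: Bfree Bfull; rewrite /row_free /row_full => /eqP-> /eqP.
Qed.

(** The image [c] of [z] is not real because [n > 2], so [1, c] is a real basis of the plane and the
    combinations with rational coefficients are already dense. *)
Lemma embedding_dense k (y : R[i]) e : coprime k n -> 0 < e ->
  exists x, cabs (y - E k x) < e.
Proof.
move=> kn e0; have Ez := E_z kn; have Im0 := Im_xiX kn; rewrite -Ez in Im0.
set c := E k z in Ez Im0.
have C0 : 0 < cabs c + 1 by rewrite ltr_wpDl // (absv_ge0 (@cabs_absv R)).
have e2 : 0 < e / 2 by rewrite divr_gt0.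
have e3 : 0 < e / 2 / (cabs c + 1) by rewrite divr_gt0.
have [q hq] := rat_dense (complex.Im y / complex.Im c) e3.
have [p hp] := rat_dense (complex.Re y - (complex.Im y / complex.Im c) * complex.Re c) e2.
exists (p%:A + q%:A * z).
set s := complex.Im y / complex.Im c in hq hp *.
set t := complex.Re y - _ in hp.
have yE : y = t%:C%C + s%:C%C * c.
  apply/eqP; rewrite eq_complex ReD ReM ImD ImM /= !mul0r subr0 addr0 add0r.
  by rewrite subrK eqxx divfK ?eqxx.
have EA r : E k r%:A = (ratr r)%:C%C.
  by rewrite -ratr_complex; apply: (fmorph_eq_rat (E k \o in_alg K)).
rewrite rmorphD rmorphM /= !EA -/c yE.
have -> : t%:C%C + s%:C%C * c - ((ratr p)%:C%C + (ratr q)%:C%C * c) =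
   (t - ratr p)%:C%C + (s - ratr q)%:C%C * c by rewrite !rmorphB /=; ring.
apply: le_lt_trans (absvD (@cabs_absv R) _ _) _.
rewrite (absvM (@cabs_absv R)) !cabs_real [e]splitr ltr_leD //.
rewrite ltr_pdivlMr // in hq.
apply: le_trans (ltW hq); rewrite ler_wpM2l //.
by rewrite lerDl.
Qed.

Lemma embedding_completion k : coprime k n ->
  is_completion (@cabs R \o E k) (E k) (@cabs R).
Proof.
move=> kn; split => //; [exact: cabs_absv | | exact: complex_complete].
by move=> y e e0; apply: embedding_dense.
Qed.

Lemma embedding_place k : places_above None (@cabs R \o E k).
Proof.
have hc := @cabs_absv R; split; last first.
  by move=> q /=; rewrite fmorph_rat ratr_complex cabs_real.
split => [x|x|x y|x y] /=.
- exact: absv_ge0 hc _.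
- split => [/eqP|->]; last by rewrite rmorph0 (absv0 hc).
  by rewrite (absv_eq0 hc) fmorph_eq0 => /eqP.
- by rewrite rmorphM /= (absvM hc).
- by rewrite rmorphD /= (absvD hc).
Qed.

(* Evaluating [prod_k (X^2 - 2 Re(xi^k) X + 1) = (X^n - 1)^2] at [j z] shows that [j z]
   satisfies a real quadratic equation, which provides a square root of -1 in [L]. *)
Lemma arch_completion (w : K -> R) (L : fieldType) (j : {rmorphism K -> L}) (W : L -> R) :
  places_above None w -> is_completion w j W ->
  exists k, [/\ (k < n)%N, coprime k n, w = @cabs R \o E k &
    exists2 I : {rmorphism R[i] -> L}, forall u, W (I u) = cabs u & forall y, exists u, y = I u].
Proof.
move=> [hw wQ] [hW Wj dense compl]; have hc := @cabs_absv R.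
have W_rat q : W (ratr q) = `|ratr q| by rewrite -(fmorph_rat j) Wj wQ.
have [f hf] := real_embedding (j \o in_alg K) hW compl W_rat.
have jz : n.-primitive_root (j z) by rewrite fmorph_primitive_root.
have /(congr1 (fun p => (map_poly f p).[j z])) := cos_quadratic_prod R n_gt0.
rewrite rmorph_prod rmorphXn rmorphB /= map_polyXn rmorph1 horner_prod !hornerE.
rewrite (prim_expr_order jz) subrr expr0n /= => /eqP; rewrite prodf_seq_eq0 => /hasP[k].
rewrite mem_index_iota => /andP[_ kn] /=.
rewrite rmorphD rmorphB /= map_polyXn map_polyZ /= map_polyX rmorph1 !hornerE => /eqP quad.
have cs : complex.Re (xi R n ^+ k) ^+ 2 + complex.Im (xi R n ^+ k) ^+ 2 = 1.
  by rewrite xiX /= cos2Dsin2.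
set c := complex.Re _ in quad cs; set s := complex.Im _ in cs.
have sq : (j z - f c) ^+ 2 = - f s ^+ 2.
  have fcs : f c ^+ 2 + f s ^+ 2 = 1 by rewrite -!rmorphXn -rmorphD cs rmorph1.
  move: quad; rewrite rmorphM rmorph_nat => quad.
  have -> : (j z - f c) ^+ 2 = (j z ^+ 2 - 2 * f c * j z + 1) + f c ^+ 2 - 1 by ring.
  by rewrite quad -fcs; ring.
have s0 : s != 0.
  apply/eqP => sE; move: sq; rewrite sE rmorph0 expr0n /= oppr0 => /eqP.
  rewrite sqrf_eq0 subr_eq0 => /eqP zc.
  have : j z ^+ 2 == 1 by rewrite zc -rmorphXn; move: cs; rewrite sE expr0n addr0 => ->; rewrite rmorph1.
  rewrite -(prim_order_dvd jz) => /(dvdn_leq (ltn0Sn 1)).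
  by rewrite leqNgt n_gt2.
have fs0 : f s != 0 by rewrite fmorph_eq0.
have J2 : ((j z - f c) / f s) ^+ 2 = -1.
  by rewrite expr_div_n sq mulNr divff // expf_neq0.
have [I hI] := complex_rmorphism f J2.
have Iz : I (xi R n ^+ k) = j z.
  have -> : xi R n ^+ k = (c +i* s)%C by rewrite /c /s; case: (xi R n ^+ k).
  by rewrite hI mulrC divfK // addrC subrK.
have prk : n.-primitive_root (xi R n ^+ k) by rewrite -(fmorph_primitive_root I) Iz.
have kn' : coprime k n by move: prk; rewrite prim_root_exp_coprime // xi_prim.
set J := _ / _ in hI.
(* The naive estimate loses the constant [1 + W J]. Applying it to the powers of [u] removes the
   loss, and applying the result to [u^-1] gives the reverse inequality. *)
have I_le u : W (I u) <= cabs u.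
  apply: (@le_of_expr_le_linear _ _ _ (1 + W J)); rewrite ?absv_ge0 // => m.
  rewrite -(absvX hW) -rmorphXn -(absvX hc); case: (u ^+ m) => a b.
  rewrite hI; apply: le_trans (absvD hW _ _) _; rewrite (absvM hW) !hf.
  have ha : `|a| <= cabs (a +i* b)%C := Re_le_cabs (a +i* b)%C.
  have hb : `|b| <= cabs (a +i* b)%C := Im_le_cabs (a +i* b)%C.
  have WJ := absv_ge0 hW J; have C0 := absv_ge0 hc (a +i* b)%C.
  have h1 : `|b| * W J <= cabs (a +i* b)%C * W J by rewrite ler_wpM2r.
  have h2 : (1 + W J) * cabs (a +i* b)%C <= (1 + W J) * m.+1%:R * cabs (a +i* b)%C.
    rewrite ler_wpM2r // ler_peMr ?ler1n // addr_ge0 //.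
  by apply: le_trans h2; lra.
have I_eq u : W (I u) = cabs u.
  have [->|u0] := eqVneq u 0; first by rewrite rmorph0 (absv0 hW) (absv0 hc).
  apply: le_anti; rewrite I_le /=.
  have := I_le u^-1; rewrite fmorphV (absvV hW) (absvV hc) lef_pV2 // posrE absv_gt0 //.
  by rewrite fmorph_eq0.
have jE x : j x = I (E k x).
  apply: (embedding_eq z_gen (s := j) (t := I \o E k)).
  by rewrite /= E_z // Iz.
exists k; split => //.
  by apply/funext => x; rewrite -Wj jE I_eq.
exists I => // y.
have /choice[x hx] : forall m : nat, exists x, W (y - j x) < m.+1%:R^-1.
  by move=> m; apply: dense; rewrite invr_gt0.
have inv_small (e : R) : 0 < e -> exists N, forall m, (N <= m)%N -> m.+1%:R^-1 < e.
  move=> e0; exists (Num.truncn e^-1) => m hm.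
  rewrite invf_plt ?posrE //; apply: lt_le_trans (truncnS_gt _) _.
  by rewrite ler_nat.
have xc : cauchy_for (@cabs R) (fun m => E k (x m)).
  move=> e e0; have e2 : 0 < e / 2 by rewrite divr_gt0.
  have [N hN] := inv_small _ e2; exists N => a b Na Nb.
  rewrite -I_eq rmorphB -!jE; apply: le_lt_trans (absv_dist hW _ y _) _.
  by rewrite [e]splitr ltrD // ?(absvBC hW (j _)); apply: lt_trans (hx _) (hN _ _).
have [u hu] := complex_complete xc; exists u.
apply: (absv_eq hW) => e e0; have e2 : 0 < e / 2 by rewrite divr_gt0.
have [N hN] := inv_small _ e2; have [M hM] := hu _ e2.
apply: le_trans (absv_dist hW _ (j (x (maxn N M))) _) _; rewrite [e]splitr lerD //.
  by apply/ltW/(lt_trans (hx _)); apply: hN; rewrite leq_maxl.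
by rewrite jE -rmorphB I_eq; apply/ltW/hM; rewrite leq_maxr.
Qed.

Lemma isometric_degree (L : fieldType) (W : L -> R) (I : {rmorphism R[i] -> L}) m :
  (forall u, W (I u) = cabs u) -> (forall y, exists u, y = I u) ->
  has_degree (closureQ W) m -> has_degree (closureQ (@cabs R)) m.
Proof.
move=> WI surj [b [span free]].
have cl u : closureQ W (I u) <-> closureQ (@cabs R) u.
  by split=> h e /h[q hq]; exists q; move: hq; rewrite -WI rmorphB fmorph_rat.
have /choice[g hg] := surj.
exists (g \o b); split => [y|a ha h i].
  have [a ha ya] := span (I y); exists (g \o a).
    by move=> i /=; apply/cl; rewrite -hg.
  apply: (fmorph_inj I); rewrite ya rmorph_sum; apply: eq_bigr => i _ /=.
  by rewrite rmorphM -!hg.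
apply: (fmorph_inj I); rewrite rmorph0; apply: (free (I \o a)).
  by move=> l /=; apply/cl.
transitivity (I (\sum_i a i * (g \o b) i)); last by rewrite h rmorph0.
rewrite rmorph_sum; apply: eq_bigr => l _ /=.
by rewrite rmorphM -hg.
Qed.

(** [xget] may have selected the degree of any completion, so both the uniqueness of the completion
    and the existence of one of degree 2 enter. *)
Lemma embedding_local_degree k : coprime k n -> local_degree (@cabs R \o E k) = 2%N.
Proof.
move=> kn; rewrite /local_degree; case: xgetP => [m -> [L [j [W [hLW hm]]]]|].
  have [l [_ _ _ [I WI surj]]] := arch_completion (embedding_place k) hLW.
  exact/complex_degree_unique/(isometric_degree WI surj hm).
move=> /(_ 2%N) []; exists R[i], (E k), (@cabs R); split.
  exact: embedding_completion.
exact: complex_degree2.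
Qed.

(** A completion would identify [w] with one of the embeddings; for any other [w] the set of degrees
    is empty and [xget] returns its default 0. *)
Lemma arch_local_degree0 (w : K -> R) : places_above None w ->
  (forall k, (k < n)%N -> coprime k n -> w <> @cabs R \o E k) -> local_degree w = 0%N.
Proof.
move=> hw hE; rewrite /local_degree; case: xgetP => // m -> [L [j [W [hLW _]]]].
by have [k [kn kn' wE _]] := arch_completion hw hLW; case: (hE k).
Qed.
End ArchimedeanPlaces.

Lemma prod_one_sub_prim (F : fieldType) n (x : F) :
  n.-primitive_root x -> \prod_(1 <= k < n) (1 - x ^+ k) = n%:R.
Proof.
move=> prx; have n0 := prim_order_gt0 prx.
have h : \prod_(1 <= k < n) ('X - (x ^+ k)%:P) = \sum_(i < n) 'X^i.
  have nz : ('X - 1%:P : {poly F}) != 0 by rewrite polyXsubC_eq0.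
  apply: (mulfI nz).
  have := factor_Xn_sub_1 prx; rewrite big_ltn // expr0 => ->.
  by rewrite subrX1 polyC1.
have := congr1 (fun p => p.[1]) h; rewrite horner_prod horner_sum.
rewrite (eq_bigr (fun k => 1 - x ^+ k)); last by move=> k _; rewrite !hornerE.
move=> ->; rewrite (eq_bigr (fun=> 1)); last by move=> i _; rewrite hornerXn expr1n.
by rewrite sumr_const card_ord.
Qed.

Lemma big_dvdn_mul (T : Type) (idx : T) (op : Monoid.com_law idx) p m (F : nat -> T) :
  (0 < p)%N -> \big[op/idx]_(0 <= k < m * p | (p %| k)%N) F k =
               \big[op/idx]_(0 <= j < m) F (j * p)%N.
Proof.
move=> p0; rewrite big_mkcond /= big_nat_mul; apply: eq_bigr => i _.
rewrite big_ltn ?ltn_mul2r ?p0 ?ltnSn // dvdn_mull // big1_seq ?Monoid.mulm1 //.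
move=> k /=; rewrite mem_index_iota => /andP[k1 k2]; case: ifP => // /dvdnP[q qE].
by move: k1 k2; rewrite qE !ltn_mul2r p0 /= ltnS => a b; have := leq_trans a b; rewrite ltnn.
Qed.

(** This is the value at 1 of the cyclotomic polynomial of a prime power. The product over all
    nonzero exponents is [p^(e+1)]; the exponents divisible by [p] account for the same product
    taken at [x^p], which is [p^e]. *)
Lemma prod_one_sub_prim_coprime (F : fieldType) p e (x : F) : prime p ->
  (p ^ e.+1).-primitive_root x -> (p ^ e)%:R != 0 :> F ->
  \prod_(k < p ^ e.+1 | coprime k (p ^ e.+1)) (1 - x ^+ k) = p%:R.
Proof.
move=> pp prx ne0; have p0 := prime_gt0 pp.
have pn0 : (0 < p ^ e)%N by rewrite expn_gt0 p0.
have cop k : coprime k (p ^ e.+1) = ~~ (p %| k)%N.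
  by rewrite coprime_pexpr // coprime_sym prime_coprime.
apply: (mulfI ne0); rewrite -natrM mulnC -expnS -(prod_one_sub_prim prx).
have prxp : (p ^ e).-primitive_root (x ^+ p).
  by have := dvdn_prim_root prx (dvdn_exp2l p (leqnSn e)); rewrite expnS mulnK.
rewrite -(prod_one_sub_prim prxp).
have nz : (0 < p ^ e.+1)%N by rewrite expn_gt0 p0.
rewrite [RHS](bigID (fun k => (p %| k)%N)) /=; congr (_ * _).
  (* The vanishing factor at exponent 0 is replaced by 1, because [big_dvdn_mul] handles products
     starting at 0. *)
  transitivity (\prod_(1 <= k < p ^ e) (fun j => if j == 0%N then 1 else 1 - x ^+ j) (k * p)%N).
    apply: eq_big_nat => k /andP[k1 _]; rewrite muln_eq0 !gtn_eqF //=.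
    by rewrite -exprM mulnC.
  have := @big_dvdn_mul F 1 *%R p (p ^ e) (fun j => if j == 0%N then 1 else 1 - x ^+ j) p0.
  rewrite -expnSr [X in _ = X -> _]big_ltn // mul0n eqxx Monoid.mul1m => h.
  apply: etrans (esym h) _.
  rewrite [LHS]big_mkcond [RHS]big_mkcond [LHS]big_ltn // dvdn0 eqxx Monoid.mul1m.
  by apply: eq_big_nat => -[|k].
rewrite -(big_mkord (fun k => coprime k _) (fun k => 1 - x ^+ k)) big_mkcond big_ltn //.
rewrite cop dvdn0 /= mul1r -big_mkcond; apply: eq_bigl => k; exact: cop.
Qed.

Lemma card_coprime_totient n : #|[pred k : 'I_n | coprime k n]| = totient n.
Proof.
rewrite totient_count_coprime big_mkord -sum1_card big_mkcond.
by apply: eq_bigr => i _; rewrite inE coprime_sym.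
Qed.

(* Bounds the number of independent vectors without knowing that the subring [F]
   (the closure of Q in a completion) is a field. *)
Lemma fraction_free_elimination (L : fieldType) (F : set L) :
  F 0 -> F 1 -> (forall x y, F x -> F y -> F (x - y)) ->
  (forall x y, F x -> F y -> F (x * y)) ->
  forall N m (A : 'I_m -> 'I_N -> L), (N < m)%N -> (forall i j, F (A i j)) ->
  exists v : 'I_m -> L, [/\ forall i, F (v i), exists i, v i != 0 &
    forall j, \sum_i v i * A i j = 0].
Proof.
move=> F0 F1 FB FM.
have FN x : F x -> F (- x) by move=> hx; rewrite -sub0r; apply: FB.
have FD x y : F x -> F y -> F (x + y) by move=> hx hy; rewrite -[y]opprK; apply/FB/FN.
elim=> [|N IH] [|m] A // Nm FA.
  by exists (fun=> 1); split=> // [|[]//]; exists ord0; rewrite oner_neq0.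
have [/existsP[i0 Ai0]|h] := boolP [exists i, A i ord0 != 0]; last first.
  have [v [v1 v2 v3]] := IH m.+1 (fun i j => A i (lift ord0 j)) (ltnW Nm) (fun i j => FA i _).
  exists v; split=> // j; case: (unliftP ord0 j) => [k|] -> //.
  rewrite big1 // => i _; move: h; rewrite negb_exists => /forallP/(_ i).
  by rewrite negbK => /eqP->; rewrite mulr0.
set c := A i0 ord0 in Ai0.
have [|v [v1 [k v2] v3]] := IH m (fun i j => c * A (lift i0 i) (lift ord0 j) -
    A (lift i0 i) ord0 * A i0 (lift ord0 j)) Nm.
  by move=> i j; apply: FB; apply: FM; exact: FA.
pose s := \sum_i v i * A (lift i0 i) ord0.
exists (fun i => if unlift i0 i is Some i' then v i' * c else - s); split.
- move=> i; case: unliftP => [i'|] _; first by apply: FM => //; apply: FA.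
  by apply: FN; apply: big_ind => // i' _; apply: FM => //; apply: FA.
- by exists (lift i0 k); rewrite liftK mulf_neq0.
move=> j; rewrite (bigD1_ord i0) //= unlift_none.
rewrite (eq_bigr (fun i => v i * c * A (lift i0 i) j)); last by move=> i _; rewrite liftK.
case: (unliftP ord0 j) => [l|] ->.
  have := v3 l; rewrite (eq_bigr (fun i => v i * c * A (lift i0 i) (lift ord0 l) -
     v i * A (lift i0 i) ord0 * A i0 (lift ord0 l))); last by move=> i _; ring.
  rewrite sumrB -mulr_suml -/s => /eqP; rewrite subr_eq0 => /eqP ->.
  by rewrite mulNr addNr.
rewrite -/c (eq_bigr (fun i => v i * A (lift i0 i) ord0 * c)); last by move=> i _; ring.
by rewrite -mulr_suml -/s mulNr addNr.
Qed.

(** * Finite places and the size of 1 - z *)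

Section FinitePlaces.
Variables (R : realType) (K : fieldExtType rat) (p : nat) (pp : prime p).
Local Notation vp := (Some (exist _ p pp) : placeQ).
Variable w : K -> R.
Hypothesis w_place : places_above vp w.

Let hw : absolute_value w. Proof. by case: w_place. Qed.
Let p_gt0 : 0 < p%:R :> R. Proof. by rewrite ltr0n prime_gt0. Qed.
Let p_gt1 : 1 < p%:R :> R. Proof. by rewrite ltr1n prime_gt1. Qed.

Lemma place_rat q : w (ratr q) = absQ R vp q.
Proof. by case: w_place => _; apply. Qed.

Lemma place_nat m : (0 < m)%N -> w m%:R = p%:R ^- logn p m.
Proof.
move=> m0; rewrite -(ratr_nat K m) place_rat /absQ pnatr_eq0 gtn_eqF //=.
rewrite -[m%:R]/(m%:Z%:~R) denq_int numq_int /= logn1 sub0r.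
by case: (logn p m) => [|k]; rewrite ?oppr0 ?expr0z ?expr0 ?invr1 // NegzE.
Qed.

Lemma place_nat_le1 m : w m%:R <= 1.
Proof.
have [->|m0] := posnP m; first by rewrite (absv0 hw).
by rewrite place_nat // invf_le1 ?exprn_gt0 // exprn_ege1 // ltW.
Qed.

Lemma place_prime : w p%:R = p%:R^-1.
Proof. by rewrite place_nat ?prime_gt0 // (pfactorK 1 pp) expr1. Qed.

Lemma place_other_prime q : prime q -> q != p -> w q%:R = 1.
Proof.
move=> pq qp; rewrite place_nat ?prime_gt0 // logn_prime // eq_sym (negbTE qp) expr0 invr1 //.
Qed.

Lemma place_one_subX x k : w x = 1 -> w (1 - x ^+ k) <= w (1 - x).
Proof.
move=> x1; rewrite (absvBC hw) subrX1 (absvM hw) (absvBC hw) ler_piMr ?(absv_ge0 hw) //.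
apply: (ultrametric_sum hw place_nat_le1) => // i _.
by rewrite (absvX hw) x1 expr1n.
Qed.

Section Cyclotomic.
Variables (n : nat) (z : K).
Hypothesis z_prim : n.-primitive_root z.

Let n_gt0 : (0 < n)%N. Proof. exact: prim_order_gt0 z_prim. Qed.

Lemma place_zX k : w (z ^+ k) = 1.
Proof.
apply: (absv_unity_root hw n_gt0).
by rewrite exprAC (prim_expr_order z_prim) expr1n.
Qed.

Lemma place_one_sub_le1 : w (1 - z) <= 1.
Proof.
apply: (ultrametricB hw place_nat_le1); first by rewrite (absv1 hw).
by rewrite -[z]expr1 place_zX.
Qed.

Lemma place_max i j c d : z = (z ^+ i) ^+ c * (z ^+ j) ^+ d ->
  Num.max (w (z ^+ j - z ^+ i)) (Num.max (w (1 - z ^+ j)) (Num.max (w (z ^+ i - 1)) 0)) = w (1 - z).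
Proof.
move=> zE; set A := z ^+ i in zE *; set B := z ^+ j in zE *.
have z1 : w z = 1 by rewrite -[z]expr1 place_zX.
have hA : w (A - 1) <= w (1 - z) by rewrite (absvBC hw) place_one_subX.
have hB : w (1 - B) <= w (1 - z) by rewrite place_one_subX.
apply/eqP; rewrite eq_le !ge_max hA hB (absv_ge0 hw) andbT /=; apply/andP; split.
  have -> : B - A = - (1 - B) - (A - 1) by ring.
  by rewrite andbT; apply: (ultrametricB hw place_nat_le1); rewrite ?(absvN hw).
have -> : 1 - z = (1 - A ^+ c) + A ^+ c * (1 - B ^+ d) by rewrite {1}zE; ring.
have h1 : w (1 - A ^+ c) <= w (A - 1) by rewrite (absvBC hw A) place_one_subX // place_zX.
have h2 : w (A ^+ c * (1 - B ^+ d)) <= w (1 - B).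
  by rewrite (absvM hw) (absvX hw) place_zX expr1n mul1r place_one_subX // place_zX.
apply: (ultrametricD hw place_nat_le1); rewrite !le_max ?h1 ?h2 ?orbT //.
Qed.

(** For [x = z^(n/q)] the factors [1 - x^k] are integral at [p] with product [q], a unit at [p]. One
    of them is a multiple of [1 - z], which is therefore a unit too. *)
Lemma place_one_sub_eq1 q : prime q -> (q %| n)%N -> q != p -> w (1 - z) = 1.
Proof.
move=> pq qn qp; apply: le_anti; rewrite place_one_sub_le1 /=.
have prq := dvdn_prim_root z_prim qn; set x := z ^+ _ in prq.
have z1 : w z = 1 by rewrite -[z]expr1 place_zX.
have := place_other_prime pq qp; rewrite -(prod_one_sub_prim prq) (absv_prod hw).
rewrite leNgt => h; apply/negP => lt1.
suff : \prod_(1 <= i < q) w (1 - x ^+ i) <= w (1 - z) by rewrite h leNgt lt1.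
rewrite big_ltn ?prime_gt1 // expr1 -[leRHS]mulr1.
apply: ler_pM; rewrite ?prodr_ge0 ?place_one_subX ?(absv_ge0 hw) //.
  by move=> i _; apply: absv_ge0.
apply: prodr_ile1 => i _; rewrite (absv_ge0 hw) /= /x -exprM.
exact: le_trans (place_one_subX _ z1) place_one_sub_le1.
Qed.

Lemma place_one_sub_coprime k : coprime k n -> w (1 - z ^+ k) = w (1 - z).
Proof.
move=> kn; have prk : n.-primitive_root (z ^+ k) by rewrite prim_root_exp_coprime.
have [i zE] := prim_rootP prk (prim_expr_order z_prim).
have z1 : w z = 1 by rewrite -[z]expr1 place_zX.
apply: le_anti; rewrite place_one_subX //= {1}zE place_one_subX // place_zX //.
Qed.

Lemma place_one_sub_totient e : n = (p ^ e.+1)%N -> w (1 - z) ^+ totient n = p%:R^-1.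
Proof.
move=> nE; have charK m : (0 < m)%N -> m%:R != 0 :> K.
  move=> m0; rewrite -(absv_eq0 hw) place_nat // invr_eq0 expf_eq0.
  by rewrite (gt_eqF p_gt0) andbF.
rewrite -place_prime; move: z_prim; rewrite nE => zp.
rewrite -(prod_one_sub_prim_coprime pp zp) ?charK ?expn_gt0 ?prime_gt0 //.
rewrite (absv_prod hw) -nE (eq_bigr (fun=> w (1 - z))); last first.
  by move=> k; apply: place_one_sub_coprime.
by rewrite prodr_const card_coprime_totient.
Qed.
End Cyclotomic.
End FinitePlaces.

(** * The totally ramified place of prime power conductor *)

Section TotallyRamified.
Variables (R : realType) (K : fieldExtType rat) (toC : {rmorphism K -> algC}).
Variables (p : nat) (pp : prime p) (e : nat).
Local Notation vp := (Some (exist _ p pp) : placeQ).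
Local Notation n := (p ^ e.+1)%N.
Variable z : K.
Hypothesis z_prim : n.-primitive_root z.
Hypothesis z_gen : <<1%AS; z>>%VS = fullv.
Local Notation N := (totient n).

Let p_gt0 : 0 < p%:R :> R. Proof. by rewrite ltr0n prime_gt0. Qed.
Let p_gt1 : 1 < p%:R :> R. Proof. by rewrite ltr1n prime_gt1. Qed.
Let n_gt0 : (0 < n)%N. Proof. by rewrite expn_gt0 prime_gt0. Qed.
Let N_gt0 : (0 < N)%N. Proof. by rewrite totient_gt0. Qed.

Lemma uniformizer_expansion x : exists c : 'I_N -> rat,
  x = \sum_(i < N) (c i)%:A * (1 - z) ^+ i.
Proof.
pose u := 1 - z.
have ugen : <<1%AS; u>>%VS = fullv.
  apply/eqP; rewrite eqEsubv subvf -z_gen; apply/FadjoinP; split; first exact: subv_adjoin.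
  have -> : z = 1 - u by rewrite /u opprB addrC subrK.
  by rewrite rpredB ?rpred1 ?memv_adjoin.
have deg : adjoin_degree 1%AS u = N.
  have := dim_Fadjoin 1%AS u; rewrite ugen dimv1 muln1 => <-.
  exact: dim_cyclotomic toC _ _ z_prim z_gen.
have xin : x \in <<1%AS; u>>%VS by rewrite ugen memvf.
have /polyOver1P[q qE] := Fadjoin_polyOver 1%AS u x.
have sq : (size q <= N)%N.
  by have := size_Fadjoin_poly 1%AS u x; rewrite qE size_map_poly deg.
exists (fun i => q`_i); rewrite -[LHS](Fadjoin_poly_eq xin) qE.
rewrite (horner_coef_wide _ (n := N)) ?size_map_poly //.
by apply: eq_bigr => i _; rewrite coef_map.
Qed.

Lemma absQ_exp q : q != 0 -> exists a : int, absQ R vp q = p%:R ^ a.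
Proof. by rewrite /absQ => /negbTE->; eexists. Qed.

Lemma absQ_ge0 q : 0 <= absQ R vp q.
Proof. by rewrite /absQ; case: ifP => // _; rewrite exprz_ge0 // ltW. Qed.

Section OnePlace.
Variable w : K -> R.
Hypothesis w_place : places_above vp w.
Let hw : absolute_value w. Proof. by case: w_place. Qed.

Lemma uniformizer_exp : w (1 - z) ^+ N = p%:R^-1.
Proof. exact: (place_one_sub_totient w_place z_prim (erefl _)). Qed.

Lemma uniformizer_gt0 : 0 < w (1 - z).
Proof.
rewrite lt_def (absv_ge0 hw) andbT; apply/eqP => h.
by have := uniformizer_exp; rewrite h expr0n gtn_eqF // => /esym/eqP; rewrite invr_eq0 gt_eqF.
Qed.

Lemma place_term (q : rat) i : w (q%:A * (1 - z) ^+ i) = absQ R vp q * w (1 - z) ^+ i.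
Proof.
rewrite (absvM hw) (absvX hw) -(place_rat w_place); congr (w _ * _).
exact: (fmorph_eq_rat (in_alg K)).
Qed.

(* [w (1 - z)^N = 1 / p]: the terms of an expansion in powers of [1 - z] have
   valuations in distinct classes modulo [N], so the largest one dominates. *)
Lemma term_inj (q1 q2 : rat) (i j : nat) : (i < N)%N -> (j < N)%N -> q1 != 0 -> q2 != 0 ->
  absQ R vp q1 * w (1 - z) ^+ i = absQ R vp q2 * w (1 - z) ^+ j -> i = j.
Proof.
move=> iN jN /absQ_exp[a ->] /absQ_exp[b ->] /(congr1 (fun x => x ^+ N)).
rewrite !exprMn -!exprM ![(_ * N)%N]mulnC !exprM uniformizer_exp.
rewrite !exprVn !exprnN !exprnP !exprz_exp.
rewrite -!expfzDr ?gt_eqF // => /(ieexprIz p_gt0); rewrite gt_eqF // => /(_ isT) h.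
move: iN jN h; move: N => m iN jN h.
have [ab|ab|ab] := ltgtP a b; last by move: h; rewrite ab; lia.
  have h2 : (b - a) * m >= m%:Z by rewrite ler_peMl //; lia.
  by nia.
have h2 : (a - b) * m >= m%:Z by rewrite ler_peMl //; lia.
by nia.
Qed.

(** If the sum were smaller than its largest term, that term would equal the sum minus the other
    terms, all of which are strictly smaller because [term_inj] excludes ties; this contradicts the
    ultrametric inequality. *)
Lemma place_expansion_ge (c : 'I_N -> rat) i :
  absQ R vp (c i) * w (1 - z) ^+ i <= w (\sum_(i < N) (c i)%:A * (1 - z) ^+ i).
Proof.
pose t i := absQ R vp (c i) * w (1 - z) ^+ i.
have t_ge0 j : 0 <= t j by rewrite mulr_ge0 ?absQ_ge0 ?exprn_ge0 ?(absv_ge0 hw).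
case: (@arg_maxP _ _ _ i xpredT t isT) => i1 _ hmax.
apply: le_trans (hmax i isT) _; rewrite leNgt; apply/negP => lt1.
set S := \sum_i _ in lt1.
have t1 : 0 < t i1 := le_lt_trans (absv_ge0 hw _) lt1.
have c1 : c i1 != 0 by apply: contraTneq t1 => c0; rewrite /t c0 /absQ eqxx mul0r ltxx.
(* Seeding the maximum with [w S] makes [m] bound the sum as well as the remaining terms. *)
pose m := \big[Num.max/w S]_(j < N | j != i1) t j.
have wS : w S <= m by exact: bigmax_ge_id.
have m1 : m < t i1.
  apply: bigmax_lt => // j ji.
  rewrite lt_def (hmax j isT : t j <= t i1) andbT; apply: contraNneq ji => tE; apply/eqP/val_inj/esym.
  apply: (term_inj _ _ _ _ tE) => //; apply: contraTneq t1 => cj.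
  by rewrite tE /t cj /absQ eqxx mul0r ltxx.
have : w ((c i1)%:A * (1 - z) ^+ i1) <= m.
  have -> : (c i1)%:A * (1 - z) ^+ i1 = S - \sum_(j < N | j != i1) (c j)%:A * (1 - z) ^+ j.
    by rewrite /S (bigD1 i1) //= addrK.
  apply: (ultrametricB hw (place_nat_le1 w_place)) => //.
  apply: (ultrametric_sum hw (place_nat_le1 w_place)).
    exact: le_trans (absv_ge0 hw _) wS.
  by move=> j ji; rewrite place_term -/(t j); exact: (le_bigmax_cond (w S) t ji).
by rewrite place_term -/(t i1) leNgt m1.
Qed.

(* By [place_expansion_ge] the coefficients of a Cauchy sequence of [K] in powers of
   [1 - z] are Cauchy sequences of Q. *)
Lemma completion_span (L : fieldType) (j : {rmorphism K -> L}) (W : L -> R) :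
  is_completion w j W -> forall y, exists2 f : 'I_N -> L,
  (forall i, closureQ W (f i)) & y = \sum_(i < N) f i * j (1 - z) ^+ i.
Proof.
move=> [hW Wj dense compl] y; set r := w (1 - z).
have r0 : 0 < r := uniformizer_gt0.
have inv_small (d : R) : 0 < d -> exists M, forall m, (M <= m)%N -> m.+1%:R^-1 < d.
  move=> d0; exists (Num.truncn d^-1) => m hm.
  rewrite invf_plt ?posrE //; apply: lt_le_trans (truncnS_gt _) _.
  by rewrite ler_nat.
have ratrL (q : rat) : ratr q = j q%:A by exact/esym/(fmorph_eq_rat (j \o in_alg K)).
have /choice[x hx] : forall m : nat, exists x, W (y - j x) < m.+1%:R^-1.
  by move=> m; apply: dense; rewrite invr_gt0.
have /choice[c hc] : forall m, exists c : 'I_N -> rat,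
   x m = \sum_(i < N) (c i)%:A * (1 - z) ^+ i by move=> m; apply: uniformizer_expansion.
have W_diff i m l : W (ratr (c m i) - ratr (c l i)) * r ^+ i <= w (x m - x l).
  have -> : x m - x l = \sum_(i < N) (c m i - c l i)%:A * (1 - z) ^+ i.
    by rewrite !hc -sumrB; apply: eq_bigr => k _; rewrite scalerBl mulrBl.
  apply: le_trans (place_expansion_ge (fun i => c m i - c l i) i).
  rewrite -/r ler_wpM2r ?exprn_ge0 ?(ltW r0) //.
  have -> : ratr (c m i) - ratr (c l i) = j (c m i - c l i)%:A.
    by rewrite scalerBl rmorphB !ratrL.
  by rewrite Wj -(place_rat w_place) -(fmorph_eq_rat (in_alg K)).
have xc (d : R) : 0 < d -> exists M, forall a b, (M <= a)%N -> (M <= b)%N -> w (x a - x b) < d.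
  move=> d0; have d2 : 0 < d / 2 by rewrite divr_gt0.
  have [M hM] := inv_small _ d2; exists M => a b Ma Mb.
  rewrite -Wj rmorphB; apply: le_lt_trans (absv_dist hW _ y _) _.
  by rewrite [d]splitr ltrD // ?(absvBC hW (j _)); apply: lt_trans (hx _) (hM _ _).
have /choice[f hf] : forall i, exists l, converges_for W (fun m => ratr (c m i)) l.
  move=> i; apply: compl => d d0.
  have [|M hM] := xc (d * r ^+ i); first by rewrite mulr_gt0 ?exprn_gt0.
  exists M => a b Ma Mb.
  rewrite -(ltr_pM2r (exprn_gt0 i r0)); exact: le_lt_trans (W_diff _ _ _) (hM _ _ Ma Mb).
exists f.
  move=> i d d0; have [M hM] := hf i d d0; exists (c M i).
  by rewrite (absvBC hW) hM.
apply: (absv_eq hW) => d d0.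
have N1 : 0 < (N%:R + 1) :> R by rewrite ltr_wpDl.
pose d' := d / (N%:R + 1); have d'0 : 0 < d' by rewrite divr_gt0.
have /choice[M hM] : forall i, exists M, forall m, (M <= m)%N ->
    W (ratr (c m i) - f i) < d' / r ^+ i.
  by move=> i; apply: hf; rewrite divr_gt0 ?exprn_gt0.
have [M' hM'] := inv_small _ d'0.
pose m := maxn M' (\max_(i < N) M i).
apply: le_trans (absv_dist hW _ (j (x m)) _) _.
have -> : d = d' + \sum_(i < N) d'.
  by rewrite sumr_const card_ord -mulrS -mulr_natr -natr1 divfK // gt_eqF.
rewrite lerD //.
  by apply/ltW/(lt_trans (hx _)); apply: hM'; rewrite leq_maxl.
rewrite hc rmorph_sum -sumrB; apply: le_trans (absv_sum hW _ _ _) _.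
apply: ler_sum => i _; rewrite rmorphM rmorphXn /= -mulrBl (absvM hW) (absvX hW) Wj -/r.
rewrite -ler_pdivlMr ?exprn_gt0 // -ratrL; apply/ltW/hM.
by rewrite /m (leq_trans _ (leq_maxr _ _)) // (leq_bigmax i).
Qed.

Lemma closureQ_subring (L : fieldType) (W : L -> R) (j : {rmorphism K -> L}) :
  absolute_value W ->
  [/\ closureQ W 0, closureQ W 1,
      forall x y, closureQ W x -> closureQ W y -> closureQ W (x - y)
    & forall x y, closureQ W x -> closureQ W y -> closureQ W (x * y)].
Proof.
move=> hW.
pose iota : {rmorphism rat -> L} := j \o in_alg K.
have rE (q : rat) : ratr q = iota q by exact/esym/(fmorph_eq_rat iota).
split=> [d d0|d d0|x y hx hy d d0|x y hx hy d d0].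
- by exists 0; rewrite rE rmorph0 subrr (absv0 hW).
- by exists 1; rewrite rE rmorph1 subrr (absv0 hW).
- have d2 : 0 < d / 2 by rewrite divr_gt0.
  have [a ha] := hx _ d2; have [b hb] := hy _ d2; exists (a - b).
  have -> : x - y - ratr (a - b) = (x - ratr a) + (ratr b - y).
    by rewrite !rE rmorphB; ring.
  by apply: le_lt_trans (absvD hW _ _) _; rewrite [d]splitr ltrD // (absvBC hW).
pose d1 := Num.min 1 (d / (W x + W y + 2)).
have S0 : 0 < W x + W y + 2 by rewrite ltr_wpDl // addr_ge0 // absv_ge0.
have d10 : 0 < d1 by rewrite lt_min ltr01 divr_gt0.
have [a ha] := hx _ d10; have [b hb] := hy _ d10; exists (a * b).
have -> : x * y - ratr (a * b) = (x - ratr a) * y + ratr a * (y - ratr b).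
  by rewrite !rE rmorphM; ring.
apply: le_lt_trans (absvD hW _ _) _.
have hra : W (ratr a) <= W x + 1.
  rewrite -[ratr a](subrK x); apply: le_trans (absvD hW _ _) _.
  rewrite addrC lerD2l (absvBC hW); apply: le_trans (ltW ha) _.
  by rewrite ge_min lexx.
have dS : d1 * (W x + W y + 2) <= d.
  by rewrite -ler_pdivlMr // ge_min lexx orbT.
rewrite 2!(absvM hW); have x0 := absv_ge0 hW x; have y0 := absv_ge0 hW y.
have h1 : W (x - ratr a) * W y <= d1 * W y by rewrite ler_wpM2r // ltW.
have h2 : W (ratr a) * W (y - ratr b) <= (W x + 1) * d1.
  by apply: ler_pM; rewrite ?(absv_ge0 hW) // ltW.
by lra.
Qed.

(** All elements of the completion are combinations of [N] powers of [j (1 - z)] over the closure of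
    Q, so more than [N] of them satisfy a nontrivial relation over this closure. If there is no
    completion, the default 0 obeys the bound. *)
Lemma ramified_local_degree_le : (local_degree w <= N)%N.
Proof.
rewrite /local_degree; case: xgetP => // m -> [L [j [W [hLW [b [_ bfree]]]]]].
have hW : absolute_value W by case: hLW.
have [F0 F1 FB FM] := closureQ_subring j hW.
rewrite leqNgt; apply/negP => Nm.
have /choice[A hA] : forall i, exists f : 'I_N -> L, (forall k, closureQ W (f k)) /\
   b i = \sum_(k < N) f k * j (1 - z) ^+ k.
  by move=> i; have [f h1 h2] := completion_span hLW (b i); exists f.
have [v [v1 [i vi] v3]] := fraction_free_elimination F0 F1 FB FM Nm (fun i k => (hA i).1 k).
move: vi; rewrite (bfree v v1) ?eqxx //.
rewrite (eq_bigr (fun i => \sum_k v i * A i k * j (1 - z) ^+ k)); last first.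
  by move=> l _; rewrite (hA l).2 mulr_sumr; apply: eq_bigr => k _; rewrite mulrA.
by rewrite exchange_big big1 //= => k _; rewrite -mulr_suml v3 mul0r.
Qed.
End OnePlace.

(** Both places give the same size to each term of an expansion in powers of [1 - z]. The
    ultrametric inequality bounds one place above by the largest term, [place_expansion_ge] bounds
    the other below by it, and the roles can be exchanged. *)
Lemma ramified_place_unique (w w' : K -> R) :
  places_above vp w -> places_above vp w' -> w = w'.
Proof.
suff le_w (w1 w2 : K -> R) : places_above vp w1 -> places_above vp w2 -> forall x, w1 x <= w2 x.
  by move=> h h'; apply/funext => x; apply: le_anti; rewrite !le_w.
move=> h1 h2 x; have [c ->] := uniformizer_expansion x.
have hw1 : absolute_value w1 by case: h1.
have hw2 : absolute_value w2 by case: h2.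
have rE : w1 (1 - z) = w2 (1 - z).
  apply: (pexpIrn N_gt0); rewrite ?nnegrE ?absv_ge0 //.
  by rewrite (uniformizer_exp h1) (uniformizer_exp h2).
apply: (ultrametric_sum hw1 (place_nat_le1 h1)); first exact: absv_ge0.
move=> i _; rewrite (place_term h1) rE; exact: place_expansion_ge.
Qed.
End TotallyRamified.

(** * The height as a mean over a Galois orbit *)

(** The nesting and the final 0 are those of the maximum in [heightK] once unfolded over the three
    coordinates. *)
Definition maxchord (R : realType) (x y : R[i]) : R :=
  Num.max (cabs (y - x)) (Num.max (cabs (1 - y)) (Num.max (cabs (x - 1)) 0)).

Lemma cabs_conj (R : realType) (u : R[i]) : cabs (u^*)%C = cabs u.
Proof. by rewrite !cabsE; case: u => a b /=; rewrite sqrrN. Qed.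

Lemma maxchord_conj (R : realType) (x y : R[i]) :
  maxchord (x^*)%C (y^*)%C = maxchord x y.
Proof.
rewrite /maxchord -!rmorphB !cabs_conj /=.
have h1 u : cabs (1 - (u^*)%C) = cabs (1 - u) :> R by rewrite -[RHS]cabs_conj rmorphB rmorph1.
have h2 u : cabs ((u^*)%C - 1) = cabs (u - 1) :> R by rewrite -[RHS]cabs_conj rmorphB rmorph1.
by rewrite h1 h2.
Qed.

Lemma xi_rev (R : realType) n k : (0 < n)%N -> (k <= n)%N ->
  xi R n ^+ (n - k) = ((xi R n ^+ k)^*)%C.
Proof.
move=> n0 kn; rewrite !xiX natrB //.
have n0' : n%:R != 0 :> R by rewrite pnatr_eq0 gtn_eqF.
have -> : 2 * pi * (n%:R - k%:R) / n%:R = 2 * pi - 2 * pi * k%:R / n%:R :> R by field.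
rewrite /cis /= cosB sinB mulr_natl cos2pi sin2pi.
by rewrite !mul1r !mul0r addr0 sub0r.
Qed.

Lemma coprime_subn n k : (k <= n)%N -> coprime (n - k) n = coprime k n.
Proof.
by move=> /subnK nE; rewrite /coprime -{2 3}nE gcdnDl gcdnDr gcdnC.
Qed.

(** The indices [k] and [n - k] stand for conjugate embeddings, hence for one place. As [n > 2],
    neither 0 nor [n / 2] is prime to [n], and no index is its own partner. *)
Lemma sum_coprime_half (V : zmodType) n (F : nat -> V) : (2 < n)%N ->
  (forall k, (k <= n)%N -> F (n - k)%N = F k) ->
  \sum_(k < n | coprime k n) F k = (\sum_(k < n | coprime k n && (k.*2 < n)%N) F k) *+ 2.
Proof.
move=> n2 hF; rewrite (bigID (fun k : 'I_n => (k.*2 < n)%N)) /= mulr2n; congr (_ + _).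
have n0 : (0 < n)%N by apply: ltn_trans n2.
have nc0 : coprime 0 n = false by rewrite /coprime gcd0n; lia.
rewrite -(big_mkord (fun k => coprime k n && ~~ (k.*2 < n)%N)) -(big_mkord (fun k => coprime k n && (k.*2 < n)%N)).
rewrite big_mkcond [RHS]big_mkcond !(@big_ltn _ _ _ 0) // nc0 /= !add0r.
rewrite big_nat_rev; apply: eq_big_nat => k /andP[k1 kn] /=.
have -> : (1 + n - k.+1 = n - k)%N by lia.
have -> : coprime (n - k) n = coprime k n.
  exact/coprime_subn/ltnW.
rewrite hF; last exact: ltnW.
case: (boolP (coprime k n)) => //= cop.
have -> : (~~ ((n - k).*2 < n))%N = (k.*2 < n)%N => //.
rewrite -leqNgt ltn_neqAle; have -> : (k.*2 != n)%N.
  apply/eqP => kE; move: cop n2; rewrite -kE -muln2 /coprime gcdnMr => /eqP ->.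
  by [].
by lia.
Qed.

Section HeightFormula.
Variables (R : realType) (K : fieldExtType rat) (toC : {rmorphism K -> algC}).
Variables (n : nat) (z : K).
Hypothesis z_prim : n.-primitive_root z.
Hypothesis z_gen : <<1%AS; z>>%VS = fullv.
Hypothesis n_gt2 : (2 < n)%N.
Variables (i j c d : nat).
Hypothesis zE : z = (z ^+ i) ^+ c * (z ^+ j) ^+ d.

Let logmax (w : K -> R) : R :=
  ln (Num.max (w (z ^+ j - z ^+ i)) (Num.max (w (1 - z ^+ j)) (Num.max (w (z ^+ i - 1)) 0))).
Let term (w : K -> R) : R := (local_degree w)%:R / (\dim {: K})%:R * logmax w.
Let n_gt0 : (0 < n)%N. Proof. exact: ltn_trans n_gt2. Qed.
Let phi_gt0 : 0 < (totient n)%:R :> R. Proof. by rewrite ltr0n totient_gt0. Qed.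

(** The places are indexed by the [k < n / 2] prime to [n]. Each has local degree 2, which accounts
    for the conjugate index [n - k], so that the sum runs over all [k] prime to [n]. *)
Lemma arch_contribution :
  \sum_(w \in @places_above R K None) term w =
  (totient n)%:R^-1 * \sum_(k < n | coprime k n)
    ln (maxchord ((xi R n ^+ k) ^+ i) ((xi R n ^+ k) ^+ j)).
Proof.
have [E hE] := complex_embeddings R toC z_prim z_gen n_gt2.
pose wk k : K -> R := @cabs R \o E k.
pose D := [set k : nat | (k < n)%N /\ coprime k n && (k.*2 < n)%N].
pose F k := ln (maxchord ((xi R n ^+ k) ^+ i) ((xi R n ^+ k) ^+ j)).
have cop_rev k : (k <= n)%N -> coprime k n -> coprime (n - k) n.
  by move=> kn; rewrite coprime_subn.
have E_1sub k : coprime k n -> cabs (E k (1 - z)) ^+ 2 = 2 - 2 * cos (2 * pi * k%:R / n%:R).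
  move=> cop; rewrite rmorphB rmorph1 /= hE // xiX cabs_sqr ReB ImB /=.
  by have := cos2Dsin2 (2 * pi * k%:R / n%:R : R); nra.
(* The place determines [k]: its value at [1 - z] gives [cos (2 pi k / n)], and the cosine is
   injective on [[0, pi]]. *)
have wk_inj : {in D &, injective wk}.
  move=> k l; rewrite !inE => -[kn /andP[ck k2]] [ln0 /andP[cl l2]].
  move=> /(congr1 (fun w => w (1 - z) ^+ 2)) /=; rewrite !E_1sub // => h.
  have {}h : cos (2 * pi * k%:R / n%:R) = cos (2 * pi * l%:R / n%:R) :> R by lra.
  have bnd m : (m.*2 < n)%N -> 2 * pi * m%:R / n%:R \in `[(0 : R), pi].
    move=> mn; rewrite in_itv /= divr_ge0 ?mulr_ge0 ?pi_ge0 //=.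
    rewrite ler_pdivrMr ?ltr0n // mulrAC mulrC ler_wpM2l ?pi_ge0 //.
    by rewrite -natrM ler_nat mul2n ltnW.
  have := cos_inj (bnd k k2) (bnd l l2) h.
  have n0 : n%:R^-1 != 0 :> R by rewrite invr_eq0 pnatr_eq0 gtn_eqF.
  have p0 : 2 * pi != 0 :> R by rewrite mulf_neq0 ?pnatr_eq0 // gt_eqF // pi_gt0.
  by move=> /(mulIf n0)/(mulfI p0)/eqP; rewrite eqr_nat => /eqP.
have term_wk k : coprime k n -> term (wk k) = 2 / (totient n)%:R * F k.
  move=> cop; rewrite /term (embedding_local_degree z_prim z_gen n_gt2 hE cop).
  rewrite (dim_cyclotomic toC z_prim z_gen); congr (_ * _).
  rewrite /logmax /F /maxchord /wk /=.
  by rewrite !rmorphB !rmorphXn rmorph1 hE.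
have wk_rev k : (k < n)%N -> coprime k n -> wk (n - k)%N = wk k.
  move=> kn cop; have cop' := cop_rev _ (ltnW kn) cop.
  apply/funext => x; rewrite /wk /= -[RHS]cabs_conj; congr cabs.
  apply: (embedding_eq z_gen (s := E (n - k)%N) (t := @conjc R \o E k)).
  by rewrite /= !hE // xi_rev // ltnW.
have -> : \sum_(w \in @places_above R K None) term w = \sum_(w \in wk @` D) term w.
  apply/esym; apply: fsbig_widen.
    by move=> _ [k _ <-]; apply: embedding_place.
  move=> w [hw hD] /=; rewrite /term.
  rewrite (@arch_local_degree0 R K n z z_prim z_gen n_gt2 E hE w hw) ?mul0r //.
  move=> k kn cop wE; apply: hD.
  have k2n : (k.*2 != n)%N.
    apply/eqP => kE; move: cop n_gt2; rewrite -kE -muln2 /coprime gcdnMr => /eqP ->.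
    by [].
  have [lt|ge] := ltnP k.*2 n; first by exists k => //; split => //; rewrite cop.
  exists (n - k)%N; last by rewrite wE wk_rev.
  have k0 : (0 < k)%N by move: ge n_gt2; lia.
  split; first by lia.
  by rewrite cop_rev ?(ltnW kn) //=; lia.
rewrite fsbig_image; last by move=> a b ha hb; apply: wk_inj; rewrite inE in ha hb *.
transitivity (\sum_(k < n | coprime k n && (k.*2 < n)%N) 2 / (totient n)%:R * F k).
  rewrite (_ : D = `I_n `&` [set k | coprime k n && (k.*2 < n)%N]); last first.
    by apply/seteqP; split => k [].
  rewrite fsbig_mkcondr -fsbig_ord [RHS]big_mkcond; apply: eq_bigr => k _.
  case: ifPn; rewrite ?in_setE /=.
    by move=> h; rewrite h term_wk //; case/andP: h.
  by rewrite notin_setE /= => /negP/negbTE->.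
rewrite -mulr_sumr (@sum_coprime_half _ n F) //; first by rewrite -mulr_natl; ring.
by move=> k kn; rewrite /F xi_rev // -!rmorphXn maxchord_conj.
Qed.

Lemma finite_contribution0 p (pp : prime p) q : prime q -> (q %| n)%N -> q != p ->
  \sum_(w \in @places_above R K (Some (exist _ p pp))) term w = 0.
Proof.
move=> pq qn qp; apply: fsbig1 => w hw.
rewrite /term /logmax (place_max hw z_prim zE).
by rewrite (place_one_sub_eq1 hw z_prim pq qn qp) ln1 mulr0.
Qed.

(** For [n = p^(e+1)] one has [ln (w (1 - z)) = - ln p / totient n], weighted by a ratio of degrees
    at most 1. The factor 2 comes from [totient n >= n / 2]. *)
Lemma finite_contribution_le p (pp : prime p) : (p %| n)%N ->
  `|\sum_(w \in @places_above R K (Some (exist _ p pp))) term w| <= 2 * ln n%:R / n%:R.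
Proof.
move=> pn; have bound0 : 0 <= 2 * ln n%:R / n%:R :> R.
  apply: divr_ge0; last exact: ler0n.
  by apply: mulr_ge0; [exact: ler0n|apply: ln_ge0; rewrite ler1n; lia].
have [pnat|] := boolP (p.-nat n); last first.
  move=> h; have [q [pq qn qp]] : exists q, [/\ prime q, (q %| n)%N & q != p].
    apply: contrapT => hq; move/negP: h; apply; apply/pnatP => // q pq qn.
    by rewrite !inE; apply: contrapT => /negP qp; apply: hq; exists q.
  by rewrite (finite_contribution0 pp pq qn qp) normr0.
have [[|e] nE] := p_natP pnat; first by move: n_gt2; rewrite nE.
have [[w hw]|noplace] := pselect (exists w, @places_above R K (Some (exist _ p pp)) w); last first.
  rewrite fsbig1 ?normr0 // => w hw; case: noplace; by exists w.
move: z_prim bound0; rewrite /term (dim_cyclotomic toC z_prim z_gen) nE => zp bound0.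
have uniq w' := ramified_place_unique toC zp z_gen (w := w') (w' := w).
rewrite (_ : places_above _ = [set w]); last first.
  by apply/seteqP; split => w' /=; [move=> hw'; apply: uniq|move=> ->].
rewrite fsbig_set1 /logmax (place_max hw zp zE) normrM.
have phi0 : 0 < (totient (p ^ e.+1))%:R :> R by rewrite -nE.
have hln : ln (w (1 - z)) = - (ln p%:R / (totient (p ^ e.+1))%:R).
  have := congr1 (@ln R) (uniformizer_exp zp hw).
  rewrite lnXn ?(uniformizer_gt0 zp hw) // lnV ?posrE ?ltr0n ?prime_gt0 // => h.
  by rewrite -mulNr -h -(mulr_natr (ln (w (1 - z)))) mulfK // gt_eqF.
have lnp : 0 <= ln p%:R :> R by rewrite ln_ge0 // ler1n prime_gt0.
rewrite hln normrN (ger0_norm (divr_ge0 lnp (ltW phi0))).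
apply: le_trans (_ : ln p%:R / (totient (p ^ e.+1))%:R <= _).
  rewrite ler_piMl ?divr_ge0 ?(ltW phi0) // ger0_norm ?divr_ge0 // ler_pdivrMr // mul1r ler_nat.
  exact: (ramified_local_degree_le toC zp z_gen hw).
rewrite ler_pdivrMr // mulrAC ler_pdivlMr ?ltr0n ?expn_gt0 ?prime_gt0 //.
rewrite -[2 * _ * _]mulrA [X in _ <= X]mulrCA; apply: ler_pM => //.
  rewrite ler_ln ?posrE ?ltr0n ?expn_gt0 ?prime_gt0 // ler_nat.
  by rewrite expnS leq_pmulr // expn_gt0 prime_gt0.
rewrite -natrM ler_nat totient_pfactor //= expnS mulnA leq_mul2r.
by apply/orP; right; have := prime_gt1 pp; lia.
Qed.

Lemma height_terms_le :
  `| (\sum_(v \in [set: placeQ]) \sum_(w \in @places_above R K v) term w) -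
     (totient n)%:R^-1 * \sum_(k < n | coprime k n)
    ln (maxchord ((xi R n ^+ k) ^+ i) ((xi R n ^+ k) ^+ j)) | <= 2 * ln n%:R / n%:R.
Proof.
have n1 : (1 < n)%N by apply: ltn_trans n_gt2.
have pp : prime (pdiv n) by apply: pdiv_prime.
(* At every place other than that of [pdiv n], the prime divisor [pdiv n] of [n] makes [1 - z] a
   unit, so this finite place alone can contribute. *)
pose v0 : placeQ := Some (exist _ (pdiv n) pp).
have -> : \sum_(v \in [set: placeQ]) \sum_(w \in @places_above R K v) term w =
   \sum_(v \in [set None] `|` [set v0]) \sum_(w \in @places_above R K v) term w.
  apply/esym; apply: fsbig_widen => // -[[p pp']|] [_ /= hv]; last by case: hv; left.
  apply: (finite_contribution0 pp' pp (pdiv_dvd n)).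
  apply/eqP => pE; apply: hv; right; congr Some.
  by move: pp' ; rewrite -pE => pp'; congr exist; apply: bool_irrelevance.
rewrite fsbigU0 ?fsbig_set1; [|exact: finite_set1|exact: finite_set1|by move=> v [/= ->]].
rewrite arch_contribution addrAC subrr add0r.
exact: (finite_contribution_le pp (pdiv_dvd n)).
Qed.
End HeightFormula.

Lemma height_lineC_cap (R : realType) (om : algC * algC) (n i j c d : nat) (z : algC) :
  n.-primitive_root z -> (2 < n)%N -> om.1^-1 = z ^+ i -> om.2^-1 = z ^+ j ->
  z = (z ^+ i) ^+ c * (z ^+ j) ^+ d ->
  `| height R (lineC_cap om) - (totient n)%:R^-1 * \sum_(k < n | coprime k n)
    ln (maxchord ((xi R n ^+ k) ^+ i) ((xi R n ^+ k) ^+ j)) | <= 2 * ln n%:R / n%:R.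
Proof.
move=> prz n2 h1 h2 zE; rewrite /height.
case: num_field_exists => K [toC [s hs gen]].
have {}hs : [seq toC x | x <- s] = [:: z ^+ j - z ^+ i; 1 - z ^+ j; z ^+ i - 1].
  rewrite hs; apply: (@eq_from_nth _ 0) => [|k]; rewrite size_map size_enum_ord // => k3.
  rewrite (nth_map ord0) ?size_enum_ord // /lineC_cap !mxE nth_enum_ord // h1 h2.
  by case: k k3 => [|[|[|]]].
case: s gen hs => [|s0 [|s1 [|s2 [|]]]] //= gen [e0 e1 e2].
(* The coordinates give back [z^i] and [z^j], hence [z]; so the field they generate, in which
   [height] is computed, is exactly the cyclotomic field. *)
pose A := 1 + s2; pose B := 1 - s1; pose y := A ^+ c * B ^+ d.
have tA : toC A = z ^+ i by rewrite rmorphD rmorph1 e2 addrC subrK.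
have tB : toC B = z ^+ j by rewrite rmorphB rmorph1 e1 opprB addrC subrK.
have ty : toC y = z by rewrite rmorphM !rmorphXn /= tA tB -zE.
have pry : n.-primitive_root y by rewrite -(fmorph_primitive_root toC) ty.
have AE : A = y ^+ i by apply: (fmorph_inj toC); rewrite rmorphXn /= ty.
have BE : B = y ^+ j by apply: (fmorph_inj toC); rewrite rmorphXn /= ty.
have s0E : s0 = y ^+ j - y ^+ i by apply: (fmorph_inj toC); rewrite rmorphB !rmorphXn /= ty.
have s1E : s1 = 1 - y ^+ j by rewrite -BE /B opprB addrC subrK.
have s2E : s2 = y ^+ i - 1 by rewrite -AE /A addrC addKr.
have ygen : <<1%AS; y>>%VS = fullv.
  apply/eqP; rewrite eqEsubv subvf -gen; apply/Fadjoin_seqP; split; first exact: subv_adjoin.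
  have yX k : y ^+ k \in <<1; y>>%VS by rewrite rpredX ?memv_adjoin.
  by move=> x; rewrite !inE => /or3P[]/eqP->; rewrite ?s0E ?s1E ?s2E rpredB ?rpred1 ?yX.
have yE : y = (y ^+ i) ^+ c * (y ^+ j) ^+ d by rewrite -AE -BE.
have := height_terms_le R toC pry ygen n2 yE; congr (`|_ - _| <= _).
apply: eq_fsbigr => v _; apply: eq_fsbigr => w _; congr (_ * ln _).
by rewrite !big_ord_recl big_ord0 !mxE /= s0E s1E s2E.
Qed.

(** * Ramanujan sums and cyclotomic norms *)

Lemma sum_shift_periodic (V : zmodType) n (G : nat -> V) s :
  (forall k, G (k + n)%N = G k) -> \sum_(0 <= k < n) G (k + s)%N = \sum_(0 <= k < n) G k.
Proof.
move=> per; elim: s => [|s <-]; first by apply: eq_bigr => k _; rewrite addn0.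
case: n per => [|n] per; first by rewrite !big_geq.
rewrite big_nat_recr // [RHS]big_nat_recl //= addrC; congr (_ + _).
  by rewrite -(per (0 + s)%N) addnAC add0n addnS.
by apply: eq_bigr => k _; rewrite addSnnS.
Qed.

Lemma sum_periodic_mul (V : zmodType) n a (G : nat -> V) :
  (forall k, G (k + n)%N = G k) -> \sum_(0 <= k < a * n) G k = (\sum_(0 <= k < n) G k) *+ a.
Proof.
move=> per; have perM b k : G (k + b * n)%N = G k.
  by elim: b => [|b IH]; rewrite ?mul0n ?addn0 // mulSn addnCA addnC per.
rewrite big_nat_mul -[a in RHS]subn0 -sumr_const_nat; apply: eq_bigr => b _.
rewrite -{1}[(b * n)%N]add0n big_addn mulSn addnK.
by apply: eq_bigr => k _; rewrite perM.
Qed.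

Section RamanujanSum.
Variables (R : realType) (n m : nat).
Hypothesis n_gt0 : (0 < n)%N.

Let chi k : R[i] := xi R n ^+ (k * m).
Let chiD k l : chi (k + l)%N = chi k * chi l.
Proof. by rewrite /chi mulnDl exprD. Qed.
Let chi_eq1 k : (chi k == 1) = (n %| k * m)%N.
Proof. by rewrite /chi -(prim_order_dvd (xi_prim R n_gt0)). Qed.
Let chi_n k : chi (k + n)%N = chi k.
Proof. by rewrite chiD (eqP (_ : chi n == 1)) ?mulr1 // chi_eq1 dvdn_mulr. Qed.
Let cabs_chi k : cabs (chi k) = 1.
Proof.
apply: (absv_unity_root (@cabs_absv R) n_gt0).
by rewrite /chi exprAC (prim_expr_order (xi_prim R n_gt0)) expr1n.
Qed.

(** Translation by [s] preserves the sum and multiplies it by [chi s], which differs from 1. *)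
Lemma invariant_character_sum0 (P : pred nat) s :
  (forall k, P (k + n)%N = P k) -> (forall k, P (k + s)%N = P k) -> ~~ (n %| s * m)%N ->
  \sum_(0 <= k < n | P k) chi k = 0.
Proof.
move=> Pn Ps sm; set S := bigop _ _ _.
have SE : S = S * chi s.
  rewrite /S [in RHS]big_mkcond [LHS]big_mkcond /=.
  rewrite -[LHS](@sum_shift_periodic _ n (fun k => if P k then chi k else 0) s).
    rewrite mulr_suml; apply: eq_bigr => k _; rewrite Ps chiD.
    by case: ifP; rewrite ?mul0r.
  by move=> k; rewrite Pn chi_n.
apply/eqP; move: SE => /eqP; rewrite -subr_eq0 -{1}[S]mulr1 -mulrBr mulf_eq0 => /orP[//|].
by rewrite subr_eq0 eq_sym chi_eq1 (negbTE sm).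
Qed.

(* Some prime power [p^e], [e > 0], exactly dividing the order of the character does not
   divide [(2 M)!].  The sum over [k] prime to [n] is minus the sum over the multiples
   [k] of [p] prime to the rest of [n]; either it vanishes by translation invariance,
   or [e = 1], [p > 2 M] and it has [totient n / (p - 1)] terms. *)
Lemma ramanujan_sum_le M : (0 < M)%N -> ~~ (n %| (2 * M)`! * m)%N ->
  cabs (\sum_(k < n | coprime k n) xi R n ^+ (k * m)) <= (totient n)%:R / M%:R.
Proof.
(* [d] is the order of the character [chi]. *)
move=> M0 hM; pose d := (n %/ gcdn n m)%N.
have g0 : (0 < gcdn n m)%N by rewrite gcdn_gt0 n_gt0.
have nE : n = (d * gcdn n m)%N by rewrite divnK // dvdn_gcdl.
have dP x : (n %| x * m)%N = (d %| x)%N.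
  have mE : m = (m %/ gcdn n m * gcdn n m)%N by rewrite divnK // dvdn_gcdr.
  rewrite [X in (X %| _)%N]nE [X in (_ %| _ * X)%N]mE mulnA dvdn_pmul2r // Gauss_dvdl //.
  by rewrite /coprime -(eqn_pmul2r g0) muln_gcdl -nE -mE mul1n.
have d0 : (0 < d)%N by rewrite divn_gt0 // dvdn_leq // dvdn_gcdl.
have dn : (d %| n)%N by rewrite nE dvdn_mulr.
have [p pd hp] : exists2 p, p \in \pi(d) & ~~ (d`_p %| (2 * M)`!)%N.
  move: hM; rewrite dP => hd; apply: contrapT => h; case/negP: hd.
  apply/dvdn_partP => // p pd; apply: contrapT => h2; apply: h; exists p => //.
  exact/negP.
have /and3P[pp _ pdvd] : [&& prime p, (0 < d)%N & (p %| d)%N] by rewrite -mem_primes.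
have p0 := prime_gt0 pp; have p1 := prime_gt1 pp.
have [f [n' [pn' fE]]] : exists f n', coprime p n' /\ n = (p ^ f.+1 * n')%N.
  have [n' cop nE2] := pfactor_coprime pp n_gt0.
  exists (logn p n).-1, n'; rewrite prednK ?logn_gt0 ?mem_primes ?pp ?n_gt0 ?(dvdn_trans pdvd) //.
  by split; rewrite // mulnC.
have n'0 : (0 < n')%N by move: n_gt0; rewrite fE muln_gt0 => /andP[].
have n'n : (n' %| n)%N by rewrite fE dvdn_mull.
have pn'n : (p * n' %| n)%N by rewrite fE expnS -mulnA dvdn_pmul2l // dvdn_mull.
have pn : (p %| n)%N by rewrite (dvdn_trans pdvd).
have addmul_cop k a : coprime (k + a * n') n' = coprime k n'.
  by rewrite /coprime addnC gcdnC gcdnMDl gcdnC.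
have cop_n k : coprime k n = coprime k n' && ~~ (p %| k)%N.
  rewrite fE coprimeMr andbC; congr (_ && _).
  by rewrite coprime_pexpr // coprime_sym prime_coprime.
rewrite -(big_mkord (fun k => coprime k n) chi).
have T0 : \sum_(0 <= k < n | coprime k n') chi k = 0.
  apply: (@invariant_character_sum0 _ n') => [k|k|].
  - by case/dvdnP: n'n => a aE; rewrite [in (k + n)%N]aE addmul_cop.
  - by rewrite -{1}[n']mul1n addmul_cop.
  rewrite dP; apply/negP => /(dvdn_trans pdvd).
  by apply/negP; rewrite -prime_coprime.
set P1 := fun k => coprime k n' && (p %| k)%N.
have P1_per a : (n' %| a)%N -> (p %| a)%N -> forall k, P1 (k + a)%N = P1 k.
  by move=> /dvdnP[b bE] pa k; rewrite /P1 dvdn_addl // bE addmul_cop.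
have SE : \sum_(0 <= k < n | coprime k n) chi k = - \sum_(0 <= k < n | P1 k) chi k.
  apply/eqP; rewrite -addr_eq0; apply/eqP; apply: etrans T0; rewrite [RHS](bigID (fun k => p %| k)%N) /= addrC.
  by congr (_ + _); apply: eq_bigl => k; rewrite cop_n.
rewrite SE (absvN (@cabs_absv R)).
have phi0 : 0 <= (totient n)%:R / M%:R :> R by rewrite divr_ge0.
have [dpn|dpn] := boolP (d %| p * n')%N; last first.
  rewrite (@invariant_character_sum0 _ (p * n')%N) ?(absv0 (@cabs_absv R)) ?dP //.
    exact: P1_per.
  by apply: P1_per; [exact: dvdn_mull | exact: dvdn_mulr].
have dp : (d`_p = p)%N.
  have h1 : (logn p d <= 1)%N.
    have := dvdn_leq_log p (_ : 0 < p * n')%N dpn; rewrite muln_gt0 p0 n'0 => /(_ isT).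
    by rewrite lognM // (logn_coprime pn') (logn_prime p pp) eqxx addn0.
  have h2 : (0 < logn p d)%N by rewrite logn_gt0.
  by rewrite p_part (_ : logn p d = 1%N) ?expn1 //; lia.
have p2M : (2 * M < p)%N.
  by rewrite ltnNge; apply: contra hp => le; rewrite dp dvdn_fact // p0.
apply: le_trans (absv_sum (@cabs_absv R) _ _ _) _.
rewrite (eq_bigr (fun=> 1)); last by move=> k _; apply: cabs_chi.
(* The indices are [k = j p] with [j < p^f n'] prime to [n']: they fill [p^f] periods of length
   [n']. *)
have cnt : \sum_(0 <= k < n | P1 k) (1 : R) = (p ^ f * totient n')%:R.
  rewrite /P1 big_mkcondl /=.
  have nE3 : n = (p ^ f * n' * p)%N by rewrite fE expnS; lia.
  rewrite [in LHS]nE3 (@big_dvdn_mul _ _ _ p (p ^ f * n') (fun k => if coprime k n' then 1 else 0)) //.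
  rewrite (eq_bigr (fun j => if coprime j n' then 1 else 0)); last first.
    by move=> j _; rewrite coprimeMl pn' andbT.
  rewrite sum_periodic_mul; last first.
    by move=> k; rewrite -{1}[n' in (k + n')%N]mul1n addmul_cop.
  rewrite natrM mulr_natl; congr (_ *+ _).
  rewrite -big_mkcond big_mkord sumr_const; congr (_%:R); exact: card_coprime_totient.
rewrite cnt fE totient_coprime ?coprimeXl // totient_pfactor //= natrM [X in _ <= X / _]natrM.
rewrite mulrAC ler_wpM2r // ler_pdivlMr ?ltr0n // -natrM ler_nat mulnC leq_mul2r.
by apply/orP; right; clear -p2M M0; lia.
Qed.
End RamanujanSum.

Lemma mem_coprime_powers (F : fieldType) n (x y : F) : n.-primitive_root x ->
  (y \in [seq x ^+ k | k <- iota 0 n & coprime k n]) = n.-primitive_root y.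
Proof.
move=> prx; apply/mapP/idP => [[k]|pry].
  by rewrite mem_filter => /andP[kn _] ->; rewrite prim_root_exp_coprime.
have [k yE] := prim_rootP prx (prim_expr_order pry).
exists (val k) => //; rewrite mem_filter mem_iota /= add0n ltn_ord andbT.
by rewrite -(prim_root_exp_coprime _ prx) -yE.
Qed.

Lemma uniq_coprime_powers (F : fieldType) n (x : F) : n.-primitive_root x ->
  uniq [seq x ^+ k | k <- iota 0 n & coprime k n].
Proof.
move=> prx; rewrite map_inj_in_uniq ?filter_uniq ?iota_uniq // => k l.
rewrite !mem_filter !mem_iota /= !add0n => /andP[_ kn] /andP[_ ln] /eqP.
by rewrite (eq_prim_root_expr prx) !modn_small // => /eqP.
Qed.

Lemma size_coprime_powers (F : fieldType) n (x : F) : n.-primitive_root x ->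
  size [seq x ^+ k | k <- iota 0 n & coprime k n] = totient n.
Proof.
move=> prx; rewrite size_map size_filter -sum1_count -card_coprime_totient -sum1_card.
have -> : iota 0 n = index_iota 0 n by rewrite /index_iota subn0.
by rewrite big_mkord.
Qed.

Section CyclotomicNorm.
Variables (n i : nat).
Let p : {poly rat} := \prod_(0 <= k < n | coprime k n) (1 - 'X^(k * i)).
Let r := p %% map_poly intr 'Phi_n.

(* The norm is the value of a polynomial over Q of degree less than [totient n] taking
   the same value at all primitive roots; it is therefore constant, and the same
   rational number in every field. *)
Lemma cyclotomic_norm_rat (F : fieldType) (iota : {rmorphism rat -> F}) (x : F) :
  n.-primitive_root x ->
  \prod_(0 <= k < n | coprime k n) (1 - x ^+ (k * i)) = iota r`_0.
Proof.
move=> prx; set P := bigop _ _ _.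
have sPhi : size (map_poly (intr : int -> rat) 'Phi_n) = (totient n).+1.
  by rewrite size_map_inj_poly ?size_Cyclotomic //; apply: intr_inj.
have sr : (size r <= totient n)%N.
  by rewrite -ltnS -sPhi ltn_modp -size_poly_gt0 sPhi.
have n0 := prim_order_gt0 prx.
have p_at y : n.-primitive_root y -> (map_poly iota p).[y] = P.
  move=> pry; rewrite rmorph_prod horner_prod.
  rewrite (eq_bigr (fun k => 1 - (y ^+ k) ^+ i)); last first.
    by move=> k _; rewrite rmorphB rmorph1 /= map_polyXn !hornerE exprM.
  rewrite /P [RHS](eq_bigr (fun k => 1 - (x ^+ k) ^+ i)); last by move=> k _; rewrite exprM.
  rewrite -[LHS]big_filter -[RHS]big_filter.
  rewrite -(big_map (fun k => y ^+ k) xpredT (fun u => 1 - u ^+ i)).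
  rewrite -(big_map (fun k => x ^+ k) xpredT (fun u => 1 - u ^+ i)).
  apply: perm_big; apply: uniq_perm; rewrite /index_iota subn0 ?uniq_coprime_powers //.
  by move=> u; rewrite !mem_coprime_powers.
have r_at y : n.-primitive_root y -> (map_poly iota r).[y] = P.
  move=> pry; rewrite -(p_at y pry) [in RHS](divp_eq p (map_poly intr 'Phi_n)) -/r.
  rewrite rmorphD rmorphM /= hornerD hornerM -[map_poly iota (map_poly intr _)]map_poly_comp.
  rewrite (_ : map_poly (iota \o intr) 'Phi_n = map_poly intr 'Phi_n); last first.
    by apply: eq_map_poly => a /=; rewrite rmorph_int.
  by rewrite root_Cyclotomic_prim // mulr0 add0r.
have : map_poly iota r - P%:P = 0.
  apply/eqP; apply: contraT => nz.
  have := max_poly_roots nz _ (uniq_coprime_powers prx).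
  rewrite size_coprime_powers // => /(_ _)/wrap[].
    apply/allP => y; rewrite mem_coprime_powers // => pry.
    by rewrite /root !hornerE r_at // subrr.
  rewrite ltnNge => /negP[]; apply: leq_trans (size_polyD _ _) _.
  rewrite geq_max size_map_poly sr size_polyN.
  by rewrite (leq_trans (size_polyC_leq1 _)) // totient_gt0.
by move=> /eqP; rewrite subr_eq0 => /eqP/(congr1 (fun q : {poly F} => q`_0)); rewrite coef_map coefC.
Qed.
End CyclotomicNorm.

(** Integrality is available in [algC] and the size is wanted in [R[i]]; [cyclotomic_norm_rat]
    provides one rational number representing the norm in both. It is nonzero since no factor
    vanishes. *)
Lemma cyclotomic_norm_ge1 (R : realType) n i : (0 < n)%N -> ~~ (n %| i)%N ->
  1 <= \prod_(k < n | coprime k n) cabs (1 - xi R n ^+ (k * i)).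
Proof.
move=> n0 ni; have [z prz] := C_prim_root_exists n0.
have hz := cyclotomic_norm_rat i (ratr : {rmorphism rat -> algC}) prz.
have prx := xi_prim R n0.
pose iota : {rmorphism rat -> R[i]} := real_complex R \o (ratr : {rmorphism rat -> R}).
have hx := cyclotomic_norm_rat i iota prx.
set q := _`_0 in hz hx.
have : (ratr q : algC) \is a Num.int.
  apply: Cint_rat_Aint; first exact: Crat_rat.
  by rewrite -hz rpred_prod // => k _; rewrite rpredB ?rpred1 ?rpredX // (Aint_prim_root prz).
move=> /intrP[m]; rewrite -(ratr_int _ m) => /fmorph_inj qE.
rewrite -(big_mkord (fun k => coprime k n) (fun k => cabs (1 - xi R n ^+ (k * i)))).
rewrite -(absv_prod (@cabs_absv R)) hx cabs_real.
have q0 : q != 0.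
  rewrite -(fmorph_eq0 iota) -hx prodf_seq_neq0; apply/allP => k _.
  apply/implyP => cop; rewrite subr_eq0 eq_sym -(prim_order_dvd prx).
  by rewrite Gauss_dvdr // coprime_sym.
suff : 1 <= `|m%:~R : R| by rewrite -(ratr_int R) -qE.
rewrite norm_intr_ge1 ?intr_int // intr_eq0.
by apply: contraNneq q0 => m0; rewrite qE m0.
Qed.

(** * Chebyshev polynomials *)

Section Chebyshev.
Variable R : realType.
Implicit Types (t s r : R) (m M : nat).

(** The pair [(T_m t, T_(m+1) t)] of Chebyshev polynomials of the first kind turns their two-step
    recurrence into a structural recursion. *)
Fixpoint cheb_pair m t : R * R :=
  if m is m'.+1 then let: (a, b) := cheb_pair m' t in (b, 2 * t * b - a) else (1, t).
Definition cheb m t : R := (cheb_pair m t).1.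

Lemma cheb0 t : cheb 0 t = 1. Proof. by []. Qed.
Lemma cheb1 t : cheb 1 t = t. Proof. by []. Qed.
Lemma chebSS m t : cheb m.+2 t = 2 * t * cheb m.+1 t - cheb m t.
Proof. by rewrite /cheb /=; case: (cheb_pair m t). Qed.

Lemma cheb_cos m (a : R) : cheb m (cos a) = cos (m%:R * a).
Proof.
suff : cheb m (cos a) = cos (m%:R * a) /\ cheb m.+1 (cos a) = cos (m.+1%:R * a) by case.
elim: m => [|m [IH1 IH2]]; first by rewrite cheb0 cheb1 mul0r cos0 mul1r.
split=> //; rewrite chebSS IH1 IH2.
have -> : m.+2%:R * a = m.+1%:R * a + a by rewrite -[m.+2]addn1 natrD mulrDl mul1r.
have -> : m%:R * a = m.+1%:R * a - a by rewrite -[m.+1]addn1 natrD mulrDl mul1r addrK.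
rewrite [cos (_ - _)]cosB [cos (_ + a)]cosD; ring.
Qed.

Lemma cheb_le1 m t : -1 <= t <= 1 -> `|cheb m t| <= 1.
Proof. by move=> ht; rewrite -(acosK (x := t)) ?in_itv // cheb_cos cos_max. Qed.

(** The constant is crude; it only has to survive the recurrence, where
    [2 + 2 * 5^(m+1) + 5^m <= 5^(m+2)]. *)
Lemma cheb_lip m t s : -1 <= t <= 1 -> -1 <= s <= 1 ->
  `|cheb m t - cheb m s| <= 5 ^+ m * `|t - s|.
Proof.
move=> ht hs.
suff : `|cheb m t - cheb m s| <= 5 ^+ m * `|t - s| /\
       `|cheb m.+1 t - cheb m.+1 s| <= 5 ^+ m.+1 * `|t - s| by case.
elim: m => [|m [IH1 IH2]].
  by rewrite !cheb0 !cheb1 subrr normr0 expr0 expr1 mul1r normr_ge0 ler_peMl // ler1n.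
split=> //; rewrite !chebSS.
have -> : 2 * t * cheb m.+1 t - cheb m t - (2 * s * cheb m.+1 s - cheb m s) =
  2 * ((t - s) * cheb m.+1 t) + 2 * (s * (cheb m.+1 t - cheb m.+1 s)) - (cheb m t - cheb m s).
  by ring.
apply: le_trans (ler_normB _ _) _; apply: le_trans (lerD (ler_normD _ _) (lexx _)) _.
rewrite !normrM (ger0_norm (_ : 0 <= 2)) //.
have h1 : `|t - s| * `|cheb m.+1 t| <= `|t - s| by rewrite ler_piMr // cheb_le1.
have h2 : `|s| * `|cheb m.+1 t - cheb m.+1 s| <= `|cheb m.+1 t - cheb m.+1 s|.
  by rewrite ler_piMl // ler_norml.
have E : 1 <= 5 ^+ m :> R by rewrite exprn_ege1 // ler1n.
have N0 := normr_ge0 (t - s).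
move: IH1 IH2; rewrite !exprS => IH1 IH2; nra.
Qed.

Lemma quad_ge t s : -1 <= t <= 1 -> 0 <= s -> (1 - s) ^+ 2 <= 1 - 2 * s * t + s ^+ 2.
Proof. by move=> /andP[_ t1] s0; nra. Qed.

(** Truncated generating function: [t - s] is the value for the full series, and the last two terms
    are the remainder, of order [s^M]. *)
Lemma cheb_generating M t s :
  (1 - 2 * s * t + s ^+ 2) * (\sum_(m < M) s ^+ m * cheb m.+1 t) =
  t - s - s ^+ M * cheb M.+1 t + s ^+ M.+1 * cheb M t.
Proof.
elim: M => [|M IH]; first by rewrite big_ord0 cheb0 cheb1 expr0 expr1; ring.
by rewrite big_ord_recr /= mulrDr IH chebSS !exprS; ring.
Qed.

(* The derivative in [r] of the left-hand side telescopes by [cheb_generating], whose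
   remainder is bounded by means of [quad_ge]. *)
Lemma log_cheb_series M t r : -1 <= t <= 1 -> 0 <= r < 1 ->
  `|2^-1 * ln (1 - 2 * r * t + r ^+ 2) + \sum_(m < M) r ^+ m.+1 * (cheb m.+1 t / m.+1%:R)|
   <= 2 * r ^+ M / (1 - r) ^+ 2.
Proof.
move=> ht /andP[r0 r1].
have pos s : 0 <= s -> s < 1 -> 0 < 1 - 2 * s * t + s ^+ 2.
  by move=> s0 s1; apply: lt_le_trans (quad_ge ht s0); rewrite exprn_gt0 // subr_gt0.
pose f s := 2^-1 * ln (1 - 2 * s * t + s ^+ 2) + \sum_(m < M) s ^+ m.+1 * (cheb m.+1 t / m.+1%:R).
pose df s := (s - t) / (1 - 2 * s * t + s ^+ 2) + \sum_(m < M) s ^+ m * cheb m.+1 t.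
have dsum s : is_derive s 1 (fun s => \sum_(m < M) s ^+ m.+1 * (cheb m.+1 t / m.+1%:R))
     (\sum_(m < M) s ^+ m * cheb m.+1 t).
  elim: M {f df} => [|k IH].
    rewrite (_ : (fun _ => _) = cst 0); last by apply/funext => x; rewrite big_ord0.
    by rewrite big_ord0; apply: is_derive_cst.
  rewrite (_ : (fun _ => _) = (fun x => \sum_(m < k) x ^+ m.+1 * (cheb m.+1 t / m.+1%:R)) +
     (fun x => x ^+ k.+1 * (cheb k.+1 t / k.+1%:R))); last first.
    by apply/funext => x; rewrite big_ord_recr.
  rewrite big_ord_recr /=; apply: is_deriveD.
  set c := cheb k.+1 t / _.
  rewrite (_ : (fun _ => _) = c *: (@id R) ^+ k.+1); last first.
    by apply/funext => x; rewrite scalrfctE exprfctE mulrC.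
  have h := is_deriveZ c (is_deriveX k.+1 (is_derive_id s (1 : R))).
  apply: is_derive_eq h _; rewrite /GRing.scale /= mulr1 /c; field.
  by rewrite addrC natr1 pnatr_eq0.
have dln (s : R) : 0 <= s -> s < 1 -> is_derive s 1 (fun s : R => 2^-1 * ln (1 - 2 * s * t + s ^+ 2))
    ((s - t) / (1 - 2 * s * t + s ^+ 2)).
  move=> s0 s1; have := pos s s0 s1 => h.
  pose q := cst 1 - (2 * t) *: (@id R) + (@id R) ^+ 2.
  have qE x : q x = 1 - 2 * x * t + x ^+ 2.
    by have -> : q x = 1 - (2 * t) * x + x ^+ 2 by []; ring.
  have dq := is_deriveD (is_deriveB (is_derive_cst (1 : R) s 1)
    (is_deriveZ (2 * t) (is_derive_id s (1 : R)))) (is_deriveX 2 (is_derive_id s (1 : R))).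
  have dl : is_derive (q s) 1 (@ln R) (q s)^-1 by apply: is_derive1_ln; rewrite qE.
  have dc := is_derive1_comp dl dq.
  rewrite (_ : (fun _ => _) = 2^-1 *: (@ln R \o q)); last first.
    by apply/funext => x /=; rewrite -qE.
  have h2 := is_deriveZ 2^-1 dc.
  apply: is_derive_eq h2 _; rewrite qE /GRing.scale /= expr1 !mulr1 sub0r; field.
  by rewrite lt0r_neq0.
have df_f s : 0 <= s -> s < 1 -> is_derive s 1 f (df s).
  by move=> s0 s1; exact: is_deriveD (dln s s0 s1) (dsum s).
have df_le s : 0 <= s -> s <= r -> `|df s| <= 2 * r ^+ M / (1 - r) ^+ 2.
  move=> s0 sr; have s1 := le_lt_trans sr r1.
  have h := pos s s0 s1.
  have -> : df s = (- (s ^+ M * cheb M.+1 t) + s ^+ M.+1 * cheb M t) / (1 - 2 * s * t + s ^+ 2).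
    apply: (mulfI (lt0r_neq0 h)); rewrite mulrDr cheb_generating.
    by rewrite ![_ * (_ / _)]mulrC !divfK ?lt0r_neq0 //; ring.
  rewrite normrM normfV (gtr0_norm h) ler_pdivrMr //.
  have sM : 0 <= s ^+ M by rewrite exprn_ge0.
  have srM : s ^+ M <= r ^+ M by rewrite lerXn2r ?nnegrE.
  apply: le_trans (ler_normD _ _) _.
  rewrite normrN !normrM exprS !normrM (ger0_norm sM) (ger0_norm s0).
  have c1 := cheb_le1 M.+1 ht; have c2 := cheb_le1 M ht.
  have h1 : s ^+ M * `|cheb M.+1 t| <= r ^+ M by rewrite -[leRHS]mulr1 ler_pM.
  have h2 : s * s ^+ M * `|cheb M t| <= r ^+ M.
    by rewrite -[leRHS]mulr1 ler_pM ?mulr_ge0 // -[leRHS]mul1r ler_pM // ltW.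
  have h3 : 2 * r ^+ M <= 2 * r ^+ M / (1 - r) ^+ 2 * (1 - 2 * s * t + s ^+ 2).
    rewrite mulrAC ler_pdivlMr ?exprn_gt0 ?subr_gt0 //.
    rewrite ler_wpM2l ?mulr_ge0 ?exprn_ge0 //.
    apply: le_trans (quad_ge ht s0); rewrite lerXn2r ?nnegrE ?subr_ge0 ?(ltW s1) ?(ltW r1) //.
    by rewrite lerD2l lerN2.
  by apply: le_trans h3; lra.
have f0 : f 0 = 0.
  rewrite /f mulr0 mul0r subr0 expr0n addr0 ln1 mulr0 add0r big1 // => m _.
  by rewrite exprS !mul0r.
have [r_eq0|r_neq0] := eqVneq r 0.
  by rewrite r_eq0 -/(f 0) f0 normr0 subr0 expr1n divr1 mulr_ge0 // exprn_ge0.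
have r_gt0 : 0 < r by rewrite lt_def r_neq0.
have [||c cr] := @MVT R f df 0 r r_gt0.
- by move=> x; rewrite in_itv /= => /andP[x0 xr]; apply: df_f; [exact: ltW | exact: lt_trans r1].
- apply: derivable_within_continuous => x; rewrite in_itv /= => /andP[x0 xr].
  by have [] := df_f x x0 (le_lt_trans xr r1).
rewrite f0 !subr0 -/(f r) => ->; rewrite normrM (ger0_norm r0).
move: cr; rewrite in_itv /= => /andP[c0 cr].
rewrite -[leRHS]mulr1; apply: ler_pM => //; last exact: ltW.
by apply: df_le; exact: ltW.
Qed.
End Chebyshev.

(** * Equidistribution *)

Section Fejer.
Variable R : realType.
Implicit Types (x y u : R[i]) (m N : nat).
Local Notation conj := (@conjc R).
Let hc := @cabs_absv R.
Let eqW (a b : R) : a = b -> a <= b. Proof. by move=> ->. Qed.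

Let conjM x y : conj (x * y) = conj x * conj y. Proof. exact: rmorphM. Qed.
Let conjX x n : conj (x ^+ n) = conj x ^+ n. Proof. exact: rmorphXn. Qed.

Lemma cabs_sqrC u : (cabs u ^+ 2)%:C%C = u * conj u.
Proof.
apply/eqP; rewrite cabs_sqr eq_complex ReM ImM; case: u => a b /=.
by rewrite mulrN opprK -!expr2 mulrN mulrC addNr !eqxx.
Qed.

Lemma unit_conj u : cabs u = 1 -> u * conj u = 1.
Proof. by move=> u1; rewrite -cabs_sqrC u1 expr1n. Qed.

Lemma cabs_sum_sqr (T : finType) (E : T -> R[i]) :
  (cabs (\sum_s E s) ^+ 2)%:C%C = \sum_s \sum_t E s * conj (E t).
Proof.
rewrite cabs_sqrC rmorph_sum mulr_suml; apply: eq_bigr => s _.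
by rewrite mulr_sumr.
Qed.

Lemma cabs_xi n k : (0 < n)%N -> cabs (xi R n ^+ k) = 1.
Proof. by move=> n0; rewrite xiX cabs_cis. Qed.

Lemma xi_orthogonal N a b : (a < N)%N -> (b < N)%N ->
  \sum_(i < N) (xi R N ^+ i) ^+ a * conj ((xi R N ^+ i) ^+ b) = (N * (a == b))%:R.
Proof.
move=> aN bN; have N0 : (0 < N)%N by apply: leq_ltn_trans aN.
pose rho := xi R N ^+ a * conj (xi R N ^+ b).
rewrite (eq_bigr (fun i : 'I_N => rho ^+ i)); last first.
  by move=> i _; rewrite exprMn -rmorphXn -!exprM mulnC [(b * i)%N]mulnC.
have xb := unit_conj (cabs_xi b N0).
have [ab|ab] := eqVneq a b.
  rewrite /rho ab xb (eq_bigr (fun=> 1)); last by move=> i _; rewrite expr1n.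
  by rewrite sumr_const card_ord muln1.
rewrite muln0; apply/eqP.
have rhoN : rho ^+ N = 1.
  by rewrite exprMn -rmorphXn -!exprM ![(_ * N)%N]mulnC !exprM (prim_expr_order (xi_prim R N0)) !expr1n rmorph1 mulr1.
have : (rho - 1) * \sum_(i < N) rho ^+ i == 0 by rewrite -subrX1 rhoN subrr.
rewrite mulf_eq0 => /orP[|//]; rewrite subr_eq0 => /eqP rho1.
have : xi R N ^+ a == xi R N ^+ b.
  by rewrite -[X in X == _]mulr1 -[in X in X == _]xb mulrCA -/rho rho1 mulr1.
by rewrite (eq_prim_root_expr (xi_prim R N0)) !modn_small // (negbTE ab).
Qed.

(** The Fejer kernel on the unit circle, as a squared modulus: positivity is immediate and the
    geometric sum gives its second moment. *)
Definition fejer m u : R := cabs (\sum_(a < m) u ^+ a) ^+ 2 / m%:R.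

Lemma fejer_ge0 m u : 0 <= fejer m u.
Proof. by rewrite divr_ge0 ?exprn_ge0 ?(absv_ge0 hc). Qed.

(** All exponents are below [m <= N], so the orthogonality of characters on the [N]-th roots of
    unity leaves exactly the diagonal terms. *)
Lemma fejer_mean m N x : (0 < m <= N)%N -> cabs x = 1 ->
  \sum_(i < N) fejer m (x * conj (xi R N ^+ i)) = N%:R.
Proof.
move=> /andP[m0 mN] x1; rewrite -mulr_suml.
have m0' : m%:R != 0 :> R by rewrite pnatr_eq0 gtn_eqF.
apply: (mulIf m0'); rewrite divfK //; apply: (@complexI R).
rewrite rmorph_sum /=; under eq_bigr do rewrite cabs_sum_sqr.
rewrite exchange_big /=.
under eq_bigr do rewrite exchange_big /=.
transitivity (\sum_(a < m) \sum_(b < m) (x ^+ a * conj (x ^+ b)) * conj (N * (a == b :> nat))%:R).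
  apply: eq_bigr => a _; apply: eq_bigr => b _.
  rewrite -(@xi_orthogonal N a b) ?(leq_trans (ltn_ord _) mN) // rmorph_sum mulr_sumr.
  apply: eq_bigr => i _ /=; rewrite !(conjM, conjX, exprMn, conjcK).
  by rewrite mulrACA.
rewrite (eq_bigr (fun=> N%:R)); last first.
  move=> a _; rewrite (bigD1 a) //= eqxx muln1 rmorph_nat big1.
    by rewrite addr0 unit_conj ?mul1r // (absvX hc) x1 expr1n.
  by move=> b ba; rewrite eq_sym (negbTE (_ : b != a :> nat)) // muln0 rmorph0 mulr0.
by rewrite sumr_const card_ord -natrM rmorph_nat natrM mulr_natr.
Qed.

(** Multiplying the geometric sum by [u - 1] collapses it to [u^m - 1], of modulus at most 2. *)
Lemma fejer_moment2 m u : (0 < m)%N -> cabs u = 1 ->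
  cabs (u - 1) ^+ 2 * fejer m u <= 4 / m%:R.
Proof.
move=> m0 u1; rewrite /fejer mulrA ler_wpM2r ?invr_ge0 // -exprMn -(absvM hc) -subrX1.
have : cabs (u ^+ m - 1) <= 2.
  apply: le_trans (absvD hc _ _) _.
  by rewrite (absvN hc) (absvX hc) u1 expr1n (absv1 hc); lra.
have := absv_ge0 hc (u ^+ m - 1) => h0 h1; nra.
Qed.

(** A kernel of degree [q^2] keeps square roots out: with [d] the distance, [d <= 1/q + q d^2 / 4],
    and the second moment [4 / q^2] turns the last term into another [1/q]. *)
Lemma fejer_moment1 q N x : (0 < q)%N -> (q ^ 2 <= N)%N -> cabs x = 1 ->
  \sum_(i < N) cabs (x - xi R N ^+ i) * fejer (q ^ 2) (x * conj (xi R N ^+ i)) <= N%:R * (2 / q%:R).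
Proof.
move=> q0 qN x1; set m := (q ^ 2)%N.
have m0 : (0 < m)%N by rewrite expn_gt0 q0.
have N0 : (0 < N)%N by apply: leq_trans qN.
have q0' : 0 < q%:R :> R by rewrite ltr0n.
have step i : cabs (x - xi R N ^+ i) * fejer m (x * conj (xi R N ^+ i)) <=
    q%:R^-1 * fejer m (x * conj (xi R N ^+ i)) + q%:R^-1.
  set u := x * _; have z1 := cabs_xi i N0; have zz := unit_conj z1.
  have u1 : cabs u = 1 by rewrite (absvM hc) x1 cabs_conj z1 mulr1.
  have -> : cabs (x - xi R N ^+ i) = cabs (u - 1).
    by rewrite -[RHS]mulr1 -z1 -(absvM hc) mulrBl mul1r /u -mulrA [conj _ * _]mulrC zz mulr1.
  have h := fejer_moment2 m0 u1.
  have F0 := fejer_ge0 m u; set d := cabs (u - 1) in h *; set F := fejer m u in h F0 *.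
  have am : d <= q%:R^-1 + q%:R / 4 * d ^+ 2.
    rewrite -(ler_pM2r q0') mulrDl mulVf ?gt_eqF //.
    have := sqr_ge0 (d * q%:R / 2 - 1); nra.
  have h2 : q%:R / 4 * (d ^+ 2 * F) <= q%:R^-1.
    apply: le_trans (_ : q%:R / 4 * (4 / m%:R) <= _).
      by rewrite ler_wpM2l // divr_ge0 // ltW.
    rewrite /m natrX; apply: eqW; field; exact: lt0r_neq0.
  have h3 : d * F <= (q%:R^-1 + q%:R / 4 * d ^+ 2) * F by rewrite ler_wpM2r.
  by apply: le_trans h3 _; rewrite mulrDl lerD2l -mulrA.
apply: le_trans (ler_sum _ _) _; first by move=> i _; apply: step.
rewrite big_split /= -mulr_sumr fejer_mean ?m0 // sumr_const card_ord.
by rewrite -mulr_natr; apply: eqW; ring.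
Qed.

Section Equidistribution.
Variables (f : R[i] -> R[i] -> R) (L : R).
Hypothesis L_ge0 : 0 <= L.
Hypothesis f_le1 : forall x y, cabs x = 1 -> cabs y = 1 -> `|f x y| <= 1.
Hypothesis f_lip : forall x y x' y', cabs x = 1 -> cabs y = 1 -> cabs x' = 1 -> cabs y' = 1 ->
  `|f x y - f x' y'| <= L * (cabs (x - x') + cabs (y - y')).

(* The mean over the [N]-torsion points replaces the Haar integral. *)
Definition torsion_mean N : R :=
  (\sum_(i < N) \sum_(j < N) f (xi R N ^+ i) (xi R N ^+ j)) / N%:R ^+ 2.

Let fejer2 q N x y (i j : 'I_N) := fejer (q ^ 2) (x * conj (xi R N ^+ i)) *
  fejer (q ^ 2) (y * conj (xi R N ^+ j)).

Lemma fejer_approx q N x y : (0 < q)%N -> (q ^ 2 <= N)%N -> cabs x = 1 -> cabs y = 1 ->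
  `|N%:R ^+ 2 * f x y - \sum_(i < N) \sum_(j < N) f (xi R N ^+ i) (xi R N ^+ j) * fejer2 q x y i j|
   <= N%:R ^+ 2 * (4 * L / q%:R).
Proof.
move=> q0 qN x1 y1; set m := (q ^ 2)%N.
have m0 : (0 < m <= N)%N by rewrite expn_gt0 q0.
have N0 : (0 < N)%N by case/andP: m0 => /leq_trans; apply.
pose F (i : 'I_N) := fejer m (x * conj (xi R N ^+ i)).
pose G (j : 'I_N) := fejer m (y * conj (xi R N ^+ j)).
have sF : \sum_i F i = N%:R by apply: fejer_mean.
have sG : \sum_j G j = N%:R by apply: fejer_mean.
have -> : N%:R ^+ 2 * f x y = \sum_(i < N) \sum_(j < N) f x y * (F i * G j).
  transitivity (f x y * ((\sum_i F i) * (\sum_j G j))); first by rewrite sF sG; ring.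
  by rewrite big_distrlr mulr_sumr; apply: eq_bigr => i _; rewrite mulr_sumr.
rewrite -sumrB; under eq_bigr do rewrite -sumrB.
apply: le_trans (ler_norm_sum _ _ _) _.
apply: (@le_trans _ _ (\sum_(i < N) \sum_(j < N)
   (L * (cabs (x - xi R N ^+ i) * F i) * G j + L * F i * (cabs (y - xi R N ^+ j) * G j)))).
  apply: ler_sum => i _; apply: le_trans (ler_norm_sum _ _ _) _; apply: ler_sum => j _.
  rewrite /fejer2 -/(F i) -/(G j) -mulrBl normrM.
  have FG : 0 <= F i * G j by rewrite mulr_ge0 // fejer_ge0.
  rewrite (ger0_norm FG).
  apply: le_trans (ler_wpM2r FG (f_lip x1 y1 (cabs_xi i N0) (cabs_xi j N0))) _.
  by apply: eqW; ring.
have hF := fejer_moment1 q0 qN x1; have hG := fejer_moment1 q0 qN y1.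
under eq_bigr do rewrite big_split /= -!mulr_sumr sG.
rewrite big_split /= -!mulr_suml -!mulr_sumr sF.
have N0' : 0 <= N%:R :> R by [].
have h1 : L * (\sum_(i < N) cabs (x - xi R N ^+ i) * F i) * N%:R <= L * (N%:R * (2 / q%:R)) * N%:R.
  by rewrite ler_wpM2r // ler_wpM2l.
have h2 : L * N%:R * (\sum_(j < N) cabs (y - xi R N ^+ j) * G j) <= L * N%:R * (N%:R * (2 / q%:R)).
  by rewrite ler_wpM2l // mulr_ge0.
apply: le_trans (lerD h1 h2) _; apply: eqW; ring.
Qed.

Variables (I : finType) (P : pred I) (X Y : I -> R[i]) (eta : R).
Hypothesis X1 : forall k, P k -> cabs (X k) = 1.
Hypothesis Y1 : forall k, P k -> cabs (Y k) = 1.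
Hypothesis P_gt0 : (0 < #|P|)%N.
Hypothesis eta_ge0 : 0 <= eta.

(** At each orbit point [f] is replaced by its Fejer mean over the torsion points, at a cost of
    [4 L / q]. Summing over the orbit leaves the orbit means of the kernels, which are 1 up to [m^4]
    character means divided by [m^2], that is [q^4 * eta]. The bound does not involve [N], so [N]
    may grow independently. *)
Lemma equidistribution q N : (0 < q)%N -> (q ^ 2 <= N)%N ->
  (forall a b c d : 'I_(q ^ 2), (a, c) != (b, d) ->
   cabs (\sum_(k | P k) (X k ^+ a * Y k ^+ c) * conj (X k ^+ b * Y k ^+ d)) <= eta * #|P|%:R) ->
  `|(\sum_(k | P k) f (X k) (Y k)) / #|P|%:R - torsion_mean N| <=
    4 * L / q%:R + (q ^ 4)%:R * eta.
Proof.
move=> q0 qN heta; set m := (q ^ 2)%N in heta *.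
have m0 : (0 < m <= N)%N by rewrite expn_gt0 q0.
have mR0 : 0 < m%:R :> R by rewrite ltr0n; case/andP: m0.
have N0 : (0 < N)%N by case/andP: m0 => /leq_trans; apply.
have N0' : 0 < N%:R ^+ 2 :> R by rewrite exprn_gt0 // ltr0n.
have c0 : 0 < #|P|%:R :> R by rewrite ltr0n.
have mean_kernel (i j : 'I_N) :
   `|\sum_(k | P k) fejer2 q (X k) (Y k) i j - #|P|%:R| <= m%:R ^+ 2 * eta * #|P|%:R.
  pose e (s : 'I_m * 'I_m) k := X k ^+ s.1 * Y k ^+ s.2.
  pose cf (s : 'I_m * 'I_m) := conj (xi R N ^+ i) ^+ s.1 * conj (xi R N ^+ j) ^+ s.2.
  have cf1 s : cabs (cf s) = 1.
    by rewrite (absvM hc) !(absvX hc) !cabs_conj !cabs_xi // !expr1n mulr1.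
  have e1 s k : P k -> cabs (e s k) = 1.
    by move=> Pk; rewrite (absvM hc) !(absvX hc) X1 // Y1 // !expr1n mulr1.
  (* The product of the two kernels is one squared modulus of a sum indexed by pairs of exponents;
     expanding it gives the characters bounded by [heta]. *)
  have fE k : fejer2 q (X k) (Y k) i j = cabs (\sum_s cf s * e s k) ^+ 2 / m%:R ^+ 2.
    rewrite /fejer2 /fejer -/m mulrACA -invfM -exprMn -(absvM hc) -expr2; congr (cabs _ ^+ 2 / _).
    rewrite big_distrlr pair_big /=; apply: eq_bigr => -[a c] _ /=.
    by rewrite !exprMn mulrACA mulrC.
  under eq_bigr do rewrite fE.
  rewrite -mulr_suml.
  have key : `|\sum_(k | P k) cabs (\sum_s cf s * e s k) ^+ 2 - m%:R ^+ 2 * #|P|%:R| <=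
      m%:R ^+ 2 * (m%:R ^+ 2 * eta * #|P|%:R).
    rewrite -cabs_real rmorphB rmorph_sum /=.
    under eq_bigr do rewrite cabs_sum_sqr.
    rewrite exchange_big /=; under eq_bigr do rewrite exchange_big /=.
    have -> : (m%:R ^+ 2 * #|P|%:R)%:C%C = \sum_(s : 'I_m * 'I_m) \sum_(t : 'I_m * 'I_m)
        (if t == s then #|P|%:R else 0) :> R[i].
      rewrite (eq_bigr (fun=> #|P|%:R)); last by move=> s _; rewrite -big_mkcond big_pred1_eq.
      by rewrite sumr_const card_prod card_ord expr2 -!natrM -(mulr_natl #|P|%:R) -natrM rmorph_nat.
    rewrite -sumrB; under eq_bigr do rewrite -sumrB.
    apply: le_trans (absv_sum hc _ _ _) _.
    apply: le_trans (ler_sum _ (fun s _ => absv_sum hc _ _ _)) _.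
    apply: le_trans (_ : \sum_(s : 'I_m * 'I_m) \sum_(t : 'I_m * 'I_m) eta * #|P|%:R <= _).
      apply: ler_sum => s _; apply: ler_sum => t _; case: eqP => [->|/eqP ts].
        rewrite (eq_bigr (fun=> 1)); last first.
          by move=> k Pk; rewrite unit_conj // (absvM hc) cf1 e1 // mulr1.
        by rewrite sumr_const subrr (absv0 hc) mulr_ge0.
      rewrite subr0; case: s t ts => [a c] [b d] ts.
      rewrite (eq_bigr (fun k => (cf (a, c) * conj (cf (b, d))) *
         (e (a, c) k * conj (e (b, d) k)))); last by move=> k _; rewrite rmorphM /= mulrACA.
      have cfcf : cabs (cf (a, c) * conj (cf (b, d))) = 1.
        by rewrite (absvM hc) cabs_conj !cf1 mulr1.
      rewrite -mulr_sumr (absvM hc) cfcf mul1r; apply: heta.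
      by apply: contraNneq ts => -[-> ->].
    rewrite !sumr_const card_prod card_ord; apply: eqW.
    by rewrite -mulrnA -[LHS]mulr_natl natrM (natrM _ m m); ring.
  rewrite -(ler_pM2l (exprn_gt0 2 mR0)); apply: le_trans key.
  rewrite -[X in X * _](ger0_norm (exprn_ge0 2 (ltW mR0))) -normrM mulrBr mulrC divfK //.
  by rewrite expf_neq0 // lt0r_neq0.
pose S := \sum_(k | P k) f (X k) (Y k).
(* The first sum is the error of the Fejer approximation at the orbit points, the second the defect
   of the orbit means of the kernels. *)
have split_diff : N%:R ^+ 2 * #|P|%:R * (S / #|P|%:R - torsion_mean N) =
    \sum_(k | P k) (N%:R ^+ 2 * f (X k) (Y k) -
      \sum_(i < N) \sum_(j < N) f (xi R N ^+ i) (xi R N ^+ j) * fejer2 q (X k) (Y k) i j) +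
    \sum_(i < N) \sum_(j < N) f (xi R N ^+ i) (xi R N ^+ j) *
      (\sum_(k | P k) fejer2 q (X k) (Y k) i j - #|P|%:R).
  rewrite sumrB -mulr_sumr -/S.
  have -> : \sum_(i < N) \sum_(j < N) f (xi R N ^+ i) (xi R N ^+ j) *
      (\sum_(k | P k) fejer2 q (X k) (Y k) i j - #|P|%:R) =
    \sum_(k | P k) \sum_(i < N) \sum_(j < N) f (xi R N ^+ i) (xi R N ^+ j) * fejer2 q (X k) (Y k) i j
    - (\sum_(i < N) \sum_(j < N) f (xi R N ^+ i) (xi R N ^+ j)) * #|P|%:R.
    rewrite [in RHS]exchange_big mulr_suml -sumrB; apply: eq_bigr => i _ /=.
    rewrite exchange_big mulr_suml -sumrB; apply: eq_bigr => j _ /=.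
    by rewrite mulrBr mulr_sumr.
  rewrite addrA subrK /torsion_mean; field.
  by rewrite !pnatr_eq0 -!lt0n N0 P_gt0.
have NP0 : 0 < N%:R ^+ 2 * #|P|%:R :> R by rewrite mulr_gt0.
rewrite -(ler_pM2l NP0) -{1}(ger0_norm (ltW NP0)) -normrM split_diff.
apply: le_trans (ler_normD _ _) _; rewrite mulrDr lerD //.
  apply: le_trans (ler_norm_sum _ _ _) _.
  apply: le_trans (_ : \sum_(k | P k) N%:R ^+ 2 * (4 * L / q%:R) <= _).
    by apply: ler_sum => k Pk; apply: fejer_approx => //; [apply: X1 | apply: Y1].
  by rewrite sumr_const -mulr_natl; apply: eqW; ring.
apply: le_trans (ler_norm_sum _ _ _) _.
apply: le_trans (_ : \sum_(i < N) \sum_(j < N) m%:R ^+ 2 * eta * #|P|%:R <= _).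
  apply: ler_sum => i _; apply: le_trans (ler_norm_sum _ _ _) _; apply: ler_sum => j _.
  rewrite normrM -[leRHS]mul1r; apply: ler_pM => //; first by apply: f_le1; apply: cabs_xi.
rewrite !sumr_const card_ord -mulrnA -[leLHS]mulr_natl (natrM _ N N) /m (natrX _ q 2) (natrX _ q 4).
by apply: eqW; ring.
Qed.
End Equidistribution.
End Fejer.

(** * Means over torsion points *)

Section LatticeMean.
Variable R : realType.
Implicit Types (m N M : nat).
Local Notation conj := (@conjc R).

(** On the unit circle [conj x * y] is [y / x]. Unlike the logarithm of the longest chord, this
    quantity is Lipschitz, hence so are its Chebyshev polynomials. *)
Definition min_Re (x y : R[i]) : R :=
  Num.min (complex.Re x) (Num.min (complex.Re y) (complex.Re (conj x * y))).

Lemma min_Re_sym x y : min_Re x y = min_Re y x.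
Proof.
rewrite /min_Re; have -> : complex.Re (conj x * y) = complex.Re (conj y * x).
  by case: x => a b; case: y => c d /=; ring.
by rewrite !minA; congr Num.min; rewrite minC.
Qed.

Definition cosN N (A : nat) : R := cos (2 * pi * A%:R / N%:R).

Lemma cosN_rev N A : (0 < N)%N -> (A <= N)%N -> cosN N (N - A) = cosN N A.
Proof.
move=> N0 AN; rewrite /cosN natrB // mulrBr mulrBl mulfK ?pnatr_eq0 -?lt0n //.
by rewrite cosB mulr_natl cos2pi sin2pi mul1r mul0r addr0.
Qed.

(** The hypotheses say that [B] is at least as close to 0 modulo [N] as [A]. Replacing [A] by
    [N - A] reduces to the half circle on which the cosine decreases. *)
Lemma cosN_le N A B : (0 < N)%N -> (A <= N)%N -> (B <= A)%N -> (B + A <= N)%N ->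
  cosN N A <= cosN N B.
Proof.
move=> N0 AN BA BAN; wlog A2 : A AN BA BAN / (A.*2 <= N)%N.
  move=> H; have [h|A2] := leqP A.*2 N; first exact: H.
  by rewrite -(cosN_rev N0 AN); apply: H; lia.
have N0' : 0 < N%:R :> R by rewrite ltr0n.
have bnd C : (C.*2 <= N)%N -> 2 * pi * C%:R / N%:R \in `[(0 : R), pi].
  move=> CN; rewrite in_itv /= divr_ge0 ?mulr_ge0 ?pi_ge0 //=.
  rewrite ler_pdivrMr // mulrAC mulrC ler_wpM2l ?pi_ge0 //.
  by rewrite -natrM ler_nat mul2n.
rewrite /cosN leNgt ltr_cos ?bnd //; last by lia.
by rewrite -leNgt ler_pM2r ?invr_gt0 // ler_pM2l ?mulr_gt0 ?pi_gt0 // ler_nat.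
Qed.

Lemma cosN_max3 N a b c : (0 < N)%N -> (a + b + c = N)%N ->
  Num.min (cosN N a) (Num.min (cosN N b) (cosN N c)) = cosN N (maxn a (maxn b c)).
Proof.
move=> N0 abc; apply/eqP; rewrite eq_le; apply/andP; split.
  by rewrite !ge_min; case: (leqP b c) => bc; case: leqP => abc'; rewrite lexx ?orbT.
set m := maxn _ _.
have key x : (x == m) || ((x <= m) && (x + m <= N))%N -> cosN N m <= cosN N x.
  move=> /orP[/eqP-> //|/andP[h1 h2]]; apply: cosN_le => //.
  by rewrite /m !geq_max; lia.
by rewrite !le_min !key //; rewrite /m; lia.
Qed.

Lemma Re_xiX N k : complex.Re (xi R N ^+ k) = cosN N k.
Proof. by rewrite xiX. Qed.

Lemma min_Re_xi N i j : (0 < N)%N -> (i <= j)%N -> (j <= N)%N ->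
  min_Re (xi R N ^+ i) (xi R N ^+ j) = cosN N (maxn i (maxn (j - i) (N - j))).
Proof.
move=> N0 ij jN; rewrite -(cosN_max3 N0); last by lia.
rewrite /min_Re !Re_xiX.
have -> : conj (xi R N ^+ i) * xi R N ^+ j = xi R N ^+ (j - i).
  rewrite -{1}(subnK ij) exprD mulrCA [conj _ * _]mulrC unit_conj ?mulr1 //.
  exact: cabs_xi.
rewrite Re_xiX (cosN_rev N0 jN); congr Num.min; exact: minC.
Qed.

(* [a], [b] and [c = N - a - b] are the lengths of the arcs cut out by three torsion points. *)
Definition simplex_sum N (h : nat -> nat -> nat -> R) : R :=
  \sum_(0 <= a < N.+1) \sum_(0 <= b < N.+1 - a) h a b (N - a - b)%N.

Lemma simplex_sum_ord N h : simplex_sum N h =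
  \sum_(0 <= a < N.+1) \sum_(0 <= b < N.+1) (if (a + b <= N)%N then h a b (N - a - b)%N else 0).
Proof.
apply: eq_big_nat => a /andP[_ aN].
rewrite -big_mkcond /= (@big_nat_widen _ _ _ _ (N.+1 - a) N.+1) ?leq_subr //.
by apply: eq_bigl => b; lia.
Qed.

Lemma simplex_sum_swap12 N h : simplex_sum N (fun a b c => h b a c) = simplex_sum N h.
Proof.
rewrite !simplex_sum_ord exchange_big /=; apply: eq_bigr => b _; apply: eq_bigr => a _.
by rewrite addnC subnAC.
Qed.

Lemma simplex_sum_swap23 N h : simplex_sum N (fun a b c => h a c b) = simplex_sum N h.
Proof.
apply: eq_big_nat => a /andP[_ aN]; rewrite big_nat_rev /=; apply: eq_big_nat => b /andP[_ bN].
by congr (h _ _ _); lia.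
Qed.

Lemma simplex_sum_le N h h' :
  (forall a b c, (a + b + c = N)%N -> h a b c <= h' a b c) ->
  simplex_sum N h <= simplex_sum N h'.
Proof.
move=> H; apply: ler_sum_nat => a aN; apply: ler_sum_nat => b bN.
by apply: H; lia.
Qed.

Lemma simplex_sum_norm N h : `|simplex_sum N h| <= simplex_sum N (fun a b c => `|h a b c|).
Proof.
apply: le_trans (ler_norm_sum _ _ _) _; apply: ler_sum => a _; exact: ler_norm_sum.
Qed.

Lemma simplex_sumD N h h' :
  simplex_sum N (fun a b c => h a b c + h' a b c) = simplex_sum N h + simplex_sum N h'.
Proof. by rewrite -big_split; apply: eq_bigr => a _ /=; rewrite -big_split. Qed.

Lemma simplex_sumB N h h' :
  simplex_sum N (fun a b c => h a b c - h' a b c) = simplex_sum N h - simplex_sum N h'.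
Proof. by rewrite -sumrB; apply: eq_bigr => a _ /=; rewrite -sumrB. Qed.

Lemma count_interval lo hi B : (\sum_(0 <= b < B) (lo <= b < hi) = minn hi B - lo)%N.
Proof.
elim: B => [|B IH]; first by rewrite big_geq // minn0 sub0n.
by rewrite big_nat_recr //= IH; case: (boolP (lo <= B < hi)%N) => /=; lia.
Qed.

Lemma simplex_sum_tie N : simplex_sum N (fun a b c => (b == c)%:R) <= N.+1%:R.
Proof.
apply: le_trans (_ : \sum_(0 <= a < N.+1) (1 : R) <= _); last first.
  by rewrite sumr_const_nat subn0.
apply: ler_sum_nat => a aN; rewrite -natr_sum -[leRHS]/(1%:R) ler_nat.
(* For fixed [a], a tie [b = c] forces [b = (N - a) / 2], so there is at most one. *)
have := count_interval (N - a)./2 ((N - a)./2).+1 (N.+1 - a); set s := bigop _ _ _ => hs.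
apply: leq_trans (_ : s <= 1)%N; last by lia.
by apply: leq_sum => b _; case: eqP => // h; rewrite lt0b; lia.
Qed.

Section MaxOnSimplex.
Variables (N : nat) (g : nat -> R).
Hypothesis g_le1 : forall a, `|g a| <= 1.

Let gmax a b c := g (maxn a (maxn b c)).
Let dom a b c := ((b <= a) && (c <= a))%N.

(** The sum is split according to which arc is longest, and the three parts agree by symmetry. Only
    ties are counted more than once; they lie on three lines with at most [N + 1] points each. *)
Lemma simplex_sum_max :
  `|simplex_sum N gmax - 3 * simplex_sum N (fun a b c => if dom a b c then g a else 0)| <=
  3 * N.+1%:R.
Proof.
pose h1 a b c := if dom a b c then g a else 0.
pose h2 a b c := if dom b a c then g b else 0.
pose h3 a b c := if dom c b a then g c else 0.
have e2 : simplex_sum N h2 = simplex_sum N h1.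
  by rewrite -(simplex_sum_swap12 N h1).
have e3 : simplex_sum N h3 = simplex_sum N h1.
  rewrite -e2 -(simplex_sum_swap23 N h2); apply: eq_bigr => a _; apply: eq_bigr => b _.
  by rewrite /h3 /h2 /dom andbC.
pose tie (a b c : nat) : R := (b == c)%:R + (a == c)%:R + (a == b)%:R.
have -> : 3 * simplex_sum N h1 = simplex_sum N (fun a b c => h1 a b c + h2 a b c + h3 a b c).
  by rewrite !simplex_sumD e2 e3; ring.
rewrite -simplex_sumB; apply: le_trans (simplex_sum_norm _ _) _.
apply: le_trans (_ : simplex_sum N tie <= _).
  apply: simplex_sum_le => a b c _; rewrite /gmax /h1 /h2 /h3 /dom /tie.
  set m := maxn _ _.
  have -> : ((b <= a) && (c <= a))%N = (a == m) by rewrite /m; lia.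
  have -> : ((a <= b) && (c <= b))%N = (b == m) by rewrite /m; lia.
  have -> : ((b <= c) && (a <= c))%N = (c == m) by rewrite /m; lia.
  have ifE x : (if x == m then g x else 0) = (x == m)%:R * g m.
    by case: eqP => [->|_]; rewrite ?mul1r ?mul0r.
  pose s := ((a == m) + (b == m) + (c == m))%N.
  have s1 : (1 <= s)%N by rewrite /s /m; lia.
  have -> : g m - ((if a == m then g a else 0) + (if b == m then g b else 0) +
      (if c == m then g c else 0)) = - ((s - 1)%:R * g m).
    by rewrite !ifE natrB // /s !natrD; ring.
  rewrite normrN normrM ger0_norm // -!natrD -[leRHS]mulr1; apply: ler_pM => //.
  by rewrite ler_nat /s; lia.
rewrite !simplex_sumD.
have t1 := simplex_sum_tie N.
have t2 : simplex_sum N (fun a b c => (a == c)%:R) = simplex_sum N (fun a b c => (b == c)%:R).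
  by rewrite -(simplex_sum_swap12 N (fun a b c => (b == c)%:R)).
have t3 : simplex_sum N (fun a b c => (a == b)%:R) = simplex_sum N (fun a b c => (b == c)%:R).
  by rewrite -t2 -(simplex_sum_swap23 N (fun a b c => (a == c)%:R)).
rewrite t2 t3; lra.
Qed.
End MaxOnSimplex.

(* Up to 1, the number of [(b, c)] with [b, c <= a] and [a + b + c = 6 M]; both
   subtractions are truncated. *)
Definition tent M (a : nat) : R := 3 * (a - 2 * M)%:R - 4 * (a - 3 * M)%:R.

Lemma simplex_sum_dom M (g : nat -> R) : (forall a, `|g a| <= 1) ->
  `|simplex_sum (6 * M) (fun a b c => if ((b <= a) && (c <= a))%N then g a else 0) -
    \sum_(0 <= a < (6 * M).+1) g a * tent M a| <= (6 * M).+1%:R.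
Proof.
move=> g1; rewrite -sumrB.
apply: le_trans (ler_norm_sum _ _ _) _.
apply: le_trans (_ : \sum_(0 <= a < (6 * M).+1) (1 : R) <= _); last first.
  by rewrite sumr_const_nat subn0.
apply: ler_sum_nat => a aN.
(* With [a] longest, the admissible [b] run from [N - 2a], truncated at 0, to the smaller of [a] and
   [N - a]. *)
have -> : \sum_(0 <= b < (6 * M).+1 - a) (if ((b <= a) && (6 * M - a - b <= a))%N then g a else 0) =
    g a * (minn a.+1 ((6 * M).+1 - a) - (6 * M - a - a))%:R.
  rewrite -count_interval natr_sum mulr_sumr; apply: eq_big_nat => b bN.
  have -> : ((b <= a) && (6 * M - a - b <= a))%N = (6 * M - a - a <= b < a.+1)%N by lia.
  by case: ifP; rewrite ?mulr1 ?mulr0.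
rewrite -mulrBr normrM -[leRHS]mulr1; apply: ler_pM => //.
rewrite /tent; set X := (minn _ _ - _)%N.
have h1 : (X + 4 * (a - 3 * M) <= 3 * (a - 2 * M) + 1)%N by rewrite /X; lia.
have h2 : (3 * (a - 2 * M) <= X + 4 * (a - 3 * M) + 1)%N by rewrite /X; lia.
move: h1 h2; rewrite -!(ler_nat R) => h1 h2.
by rewrite ler_norml; apply/andP; split; lra.
Qed.

(** Multiplication by [(1 - rho)^2] takes second differences; a ramp has a single kink, so only this
    kink and the boundary at the upper end survive. *)
Lemma ramp_sum (F : fieldType) (rho : F) K n :
  (1 - rho) ^+ 2 * \sum_(0 <= a < K.+1 + n) rho ^+ a * (a - K)%:R =
  rho ^+ K.+1 - rho ^+ (K.+1 + n) - (1 - rho) * rho ^+ (K.+1 + n) * n%:R.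
Proof.
elim: n => [|n IH].
  rewrite addn0 subrr mulr0 subr0 big_nat big1 ?mulr0 // => a /andP[_ aK].
  by rewrite (_ : (a - K = 0)%N) ?mulr0n ?mulr0 //; lia.
rewrite addnS big_nat_recr //= mulrDr IH.
have -> : (K.+1 + n - K = n.+1)%N by lia.
rewrite (exprS _ (K.+1 + n)) -natr1.
by move: (rho ^+ (K.+1 + n)) (rho ^+ K.+1) => t u; ring.
Qed.

Lemma Re_cube_root1 (u : R[i]) : u ^+ 3 = 1 ->
  complex.Re u = 3 / 2 * (u == 1)%:R - 1 / 2.
Proof.
move=> u3; have [->|u1] := eqVneq u 1; first by rewrite /= mulr1; lra.
have uu : u * conj u = 1.
  by apply/unit_conj/(absv_unity_root (@cabs_absv R) _ u3).
have u0 : u != 0 by apply: contraTneq (oner_neq0 R[i]) => u0; rewrite -u3 u0 expr0n eqxx.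
have cu : conj u = u ^+ 2 by apply: (mulfI u0); rewrite uu -exprS.
have /eqP : (u - 1) * (1 + u + u ^+ 2) = u ^+ 3 - 1 by ring.
rewrite u3 subrr mulf_eq0 subr_eq0 (negbTE u1) /= -cu => /eqP/(congr1 (@complex.Re R)).
by case: {u3 u1 uu u0 cu} u => a b /=; lra.
Qed.

Lemma Re_square_root1 (u : R[i]) : u ^+ 2 = 1 -> complex.Re u = 2 * (u == 1)%:R - 1.
Proof.
move=> /eqP; rewrite sqrf_eq1 => /orP[]/eqP->; first by rewrite eqxx /=; lra.
have -> : (-1 == 1 :> R[i]) = false by apply/negbTE; rewrite eqNr oner_eq0.
by rewrite /=; lra.
Qed.

(** The kinks of the tent lie at [2M], [3M] and [6M], with slope changes 3, -4 and 1. For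
    [rho = xi^m] the powers [rho^(2M)] and [rho^(3M)] are a cube and a square root of unity, with
    real parts [3/2 [3|m] - 1/2] and [2 [2|m] - 1]; these produce the three constants. *)
Lemma tent_sum m M : (0 < M)%N -> ~~ (6 * M %| m)%N ->
  \sum_(0 <= a < (6 * M).+1) cosN (6 * M) (m * a) * tent M a =
  (8 * (2 %| m)%:R - 9 / 2 * (3 %| m)%:R - 7 / 2) / cabs (1 - xi R (6 * M) ^+ m) ^+ 2.
Proof.
move=> M0 hm; set N := (6 * M)%N in hm *.
have N0 : (0 < N)%N by rewrite /N; lia.
have prx := xi_prim R N0; pose rho := xi R N ^+ m.
have rhoN : rho ^+ N = 1 by rewrite /rho exprAC (prim_expr_order prx) expr1n.
have rho1 : 1 - rho != 0 by rewrite subr_eq0 eq_sym -(prim_order_dvd prx).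
pose S : R[i] := \sum_(0 <= a < N) rho ^+ a * (3 * (a - 2 * M)%:R - 4 * (a - 3 * M)%:R).
have SE : \sum_(0 <= a < N.+1) cosN N (m * a) * tent M a = complex.Re S.
  rewrite big_nat_recr //= (_ : tent M N = 0) ?mulr0 ?addr0; last first.
    have a1 : (N - 2 * M = 4 * M)%N by rewrite /N; lia.
    have a2 : (N - 3 * M = 3 * M)%N by rewrite /N; lia.
    by rewrite /tent a1 a2; ring.
  rewrite /S (big_morph (@complex.Re R) (@ReD R) erefl); apply: eq_bigr => a _.
  rewrite /rho -exprM -Re_xiX /tent.
  have -> : 3 * (a - 2 * M)%:R - 4 * (a - 3 * M)%:R =
      (3 * (a - 2 * M)%:R - 4 * (a - 3 * M)%:R)%:C%C :> R[i].
    by rewrite rmorphB !rmorphM /= !rmorph_nat.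
  by rewrite ReM /= mulr0 subr0.
have S2 : (1 - rho) ^+ 2 * S = rho * (3 * rho ^+ (2 * M) - 4 * rho ^+ (3 * M) + 1).
  have -> : S = 3 * (\sum_(0 <= a < N) rho ^+ a * (a - 2 * M)%:R) -
               4 * (\sum_(0 <= a < N) rho ^+ a * (a - 3 * M)%:R).
    by rewrite !mulr_sumr -sumrB; apply: eq_bigr => a _; ring.
  have h1 := ramp_sum rho (2 * M) (4 * M).-1.
  have h2 := ramp_sum rho (3 * M) (3 * M).-1.
  rewrite (_ : ((2 * M).+1 + (4 * M).-1 = N)%N) in h1; last by rewrite /N; lia.
  rewrite (_ : ((3 * M).+1 + (3 * M).-1 = N)%N) in h2; last by rewrite /N; lia.
  rewrite mulrBr ![(1 - rho) ^+ 2 * (_ * _)]mulrCA h1 h2 rhoN !exprS.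
  rewrite -!subn1 !natrB ?muln_gt0 ?M0 // !natrM; ring.
have rr : rho * conj rho = 1 by apply/unit_conj/cabs_xi.
have D0 : cabs (1 - rho) ^+ 2 != 0 by rewrite expf_neq0 // (absv_eq0 (@cabs_absv R)).
have rho0 : rho != 0 by apply: contraTneq (oner_neq0 R[i]) => u0; rewrite -rr u0 mul0r eqxx.
(* On the unit circle [rho * |1 - rho|^2 = - (1 - rho)^2], which explains the sign and the
   disappearance of the factor [rho]. *)
have DS : (cabs (1 - rho) ^+ 2)%:C%C * S = - (3 * rho ^+ (2 * M) - 4 * rho ^+ (3 * M) + 1).
  apply: (mulfI rho0); rewrite mulrN -S2 mulrA -mulNr; congr (_ * _).
  rewrite cabs_sqrC rmorphB rmorph1.
  have -> : rho * ((1 - rho) * (1 - conj rho)) = (1 - rho) * (rho - rho * conj rho) by ring.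
  by rewrite rr; ring.
have natC k (u : R[i]) : complex.Re (k%:R * u) = k%:R * complex.Re u.
  by rewrite -(rmorph_nat (real_complex R)) ReM /= mul0r subr0.
have c3 : complex.Re (rho ^+ (2 * M)) = 3 / 2 * (3 %| m)%:R - 1 / 2.
  rewrite Re_cube_root1; last by rewrite -exprM (_ : (2 * M * 3 = N)%N) // /N; lia.
  rewrite /rho -exprM -(prim_order_dvd prx) (_ : N = (3 * (2 * M))%N); last by rewrite /N; lia.
  by rewrite dvdn_pmul2r // muln_gt0.
have c2 : complex.Re (rho ^+ (3 * M)) = 2 * (2 %| m)%:R - 1.
  rewrite Re_square_root1; last by rewrite -exprM (_ : (3 * M * 2 = N)%N) // /N; lia.
  rewrite /rho -exprM -(prim_order_dvd prx) (_ : N = (2 * (3 * M))%N); last by rewrite /N; lia.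
  by rewrite dvdn_pmul2r // muln_gt0.
rewrite SE; apply: (mulIf D0); rewrite divfK // mulrC.
have := congr1 (@complex.Re R) DS.
have -> : complex.Re ((cabs (1 - rho) ^+ 2)%:C%C * S) = cabs (1 - rho) ^+ 2 * complex.Re S.
  by rewrite ReM /= mul0r subr0.
have ReN (u : R[i]) : complex.Re (- u) = - complex.Re u by case: u.
by move=> ->; rewrite ReN ReD ReB !natC c3 c2 /=; lra.
Qed.

Definition cheb_min m (x y : R[i]) : R := cheb m (min_Re x y).

Lemma cheb_cosN m N A : cheb m (cosN N A) = cosN N (m * A).
Proof. by rewrite /cosN cheb_cos natrM; congr cos; rewrite !mulrA [m%:R * _]mulrC; ring. Qed.

Lemma cosN_bounds N A : `|cosN N A| <= 1. Proof. exact: cos_max. Qed.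

Lemma cheb_min_xi m N i j : (0 < N)%N -> (i <= j)%N -> (j <= N)%N ->
  cheb_min m (xi R N ^+ i) (xi R N ^+ j) = cosN N (m * maxn i (maxn (j - i) (N - j))).
Proof. by move=> N0 ij jN; rewrite /cheb_min min_Re_xi // cheb_cosN. Qed.

(** Pairs [i <= j] are points of the simplex with arcs [i], [j - i], [N - j], and symmetry gives the
    factor 2. The error collects the diagonal, counted twice, and the extra pairs with [j = N]: at
    most [N + 2 (N + 1)]. *)
Lemma torsion_sum_simplex m N : (0 < N)%N ->
  `|\sum_(i < N) \sum_(j < N) cheb_min m (xi R N ^+ i) (xi R N ^+ j) -
    2 * simplex_sum N (fun a b c => cosN N (m * maxn a (maxn b c)))| <= 3 * N.+1%:R.
Proof.
move=> N0; pose F i j := cheb_min m (xi R N ^+ i) (xi R N ^+ j).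
have Fsym i j : F i j = F j i by rewrite /F /cheb_min min_Re_sym.
pose G i j : R := if (i <= j)%N then F i j else 0.
have F1 i j : (i <= N)%N -> (j <= N)%N -> `|F i j| <= 1.
  move=> iN jN; wlog ij : i j iN jN / (i <= j)%N.
    by move=> H; have [h|h] := leqP i j; [|rewrite Fsym]; apply: H => //; apply: ltnW.
  by rewrite /F cheb_min_xi // cosN_bounds.
have -> : simplex_sum N (fun a b c => cosN N (m * maxn a (maxn b c))) =
    \sum_(0 <= i < N.+1) \sum_(0 <= j < N.+1) G i j.
  apply: eq_big_nat => a aN; rewrite [RHS](@big_cat_nat _ _ _ a) //=; last by lia.
  rewrite [X in _ = X + _]big_nat [X in _ = X + _]big1 ?add0r; last first.
    by move=> j ja; rewrite /G ifF //; lia.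
  rewrite (_ : \sum_(a <= j < N.+1) G a j = \sum_(0 <= b < N.+1 - a) G a (b + a)%N); last first.
    by rewrite -(@big_addn _ _ _ _ _ a xpredT (G a)) add0n.
  apply: eq_big_nat => b bN.
  rewrite /G ifT ?leq_addl // /F cheb_min_xi ?leq_addl //; last by lia.
  by congr (cosN _ (_ * maxn _ (maxn _ _))); lia.
have -> : \sum_(i < N) \sum_(j < N) cheb_min m (xi R N ^+ i) (xi R N ^+ j) =
    2 * (\sum_(0 <= i < N) \sum_(0 <= j < N) G i j) - \sum_(0 <= i < N) F i i.
  rewrite !big_mkord.
  under [X in 2 * X]eq_bigr do rewrite big_mkord.
  rewrite (_ : 2 * _ = \sum_(i < N) \sum_(j < N) G i j + \sum_(i < N) \sum_(j < N) G j i); last first.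
    by rewrite [X in _ = _ + X]exchange_big mulr_natl mulr2n.
  rewrite -big_split -sumrB; apply: eq_bigr => i _ /=.
  rewrite -big_split /= [RHS]addrC (bigD1 i) //= [X in _ = _ + X](bigD1 i) //= /G !leqnn.
  rewrite addrA; congr (_ + _); first by rewrite -/(F i i) addrA addNr add0r.
  apply: eq_bigr => j ji; rewrite -/(F i j) [F j i]Fsym.
  by case: (ltngtP i j) => h; rewrite ?addr0 ?add0r //; case/eqP: ji; apply: val_inj.
rewrite big_nat_recr //= [X in 2 * (_ + X)]big_nat_recr //=.
rewrite [X in 2 * (_ + (X + _))]big_nat [X in 2 * (_ + (X + _))]big1 ?add0r; last first.
  by move=> j jN; rewrite /G ifF //; lia.
have -> : \sum_(0 <= i < N) \sum_(0 <= j < N.+1) G i j =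
    \sum_(0 <= i < N) \sum_(0 <= j < N) G i j + \sum_(0 <= i < N) F i N.
  rewrite -big_split; apply: eq_big_nat => i iN /=.
  by rewrite big_nat_recr //= {2}/G ifT //; lia.
rewrite {3}/G leqnn.
set A := \sum_(0 <= i < N) \sum_(0 <= j < N) G i j.
have -> : 2 * A - \sum_(0 <= i < N) F i i - 2 * (A + \sum_(0 <= i < N) F i N + F N N) =
  - (\sum_(0 <= i < N) F i i + 2 * (\sum_(0 <= i < N) F i N + F N N)) by ring.
have bnd (H : nat -> R) : (forall i, (i <= N)%N -> `|H i| <= 1) -> `|\sum_(0 <= i < N) H i| <= N%:R.
  move=> H1; apply: le_trans (ler_norm_sum _ _ _) _.
  rewrite -[leRHS](_ : \sum_(0 <= i < N) (1 : R) = _); last by rewrite sumr_const_nat subn0.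
  by apply: ler_sum_nat => i iN; apply: H1; lia.
have b1 := bnd (fun i => F i i) (fun i iN => F1 i i iN iN).
have b2 := bnd (fun i => F i N) (fun i iN => F1 i N iN (leqnn N)).
have b3 := F1 N N (leqnn N) (leqnn N).
rewrite normrN -natr1; apply: le_trans (ler_normD _ _) _.
rewrite normrM (ger0_norm (_ : 0 <= 2)) //.
by have := ler_normD (\sum_(0 <= i < N) F i N) (F N N); lra.
Qed.

Lemma torsion_mean_cheb m M : (0 < M)%N -> ~~ (6 * M %| m)%N ->
  `|torsion_mean (cheb_min m) (6 * M) -
    6 * (8 * (2 %| m)%:R - 9 / 2 * (3 %| m)%:R - 7 / 2) /
      ((6 * M)%:R ^+ 2 * cabs (1 - xi R (6 * M) ^+ m) ^+ 2)| <= 15 * (6 * M).+1%:R / (6 * M)%:R ^+ 2.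
Proof.
move=> M0 hm; have ts := tent_sum M0 hm; set N := (6 * M)%N in hm ts *.
have N0 : (0 < N)%N by rewrite /N; lia.
have h1 := torsion_sum_simplex m N0.
have h2 := @simplex_sum_max N (fun a => cosN N (m * a)) (fun a => cosN_bounds _ _).
have h3 := @simplex_sum_dom M (fun a => cosN N (m * a)) (fun a => cosN_bounds _ _).
rewrite -/N ts in h3.
set T := \sum_(i < N) _ in h1; set S1 := simplex_sum _ _ in h1.
rewrite -/S1 in h2; set S2 := simplex_sum _ _ in h2; rewrite -/S2 in h3.
set D := cabs _ ^+ 2 in h3 *; set c := _ - 7 / 2 in h3 *.
have -> : torsion_mean (cheb_min m) N - 6 * c / (N%:R ^+ 2 * D) = (T - D^-1 * (6 * c)) / N%:R ^+ 2.
  rewrite /torsion_mean -/T (invfM (N%:R ^+ 2) D) mulrBl; congr (_ - _).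
  by rewrite mulrA mulrAC [_ / D]mulrC.
have NN0 : 0 < N%:R ^+ 2 :> R by rewrite exprn_gt0 // ltr0n.
rewrite normrM [`|_^-1|]ger0_norm ?invr_ge0 ?(ltW NN0) // ler_pM2r ?invr_gt0 //.
(* The three errors are [3], [2 * 3] and [6 * 1] times [N + 1], whence 15; the factor 6 is 2
   orderings times 3 choices of the longest arc. *)
have -> : T - D^-1 * (6 * c) = (T - 2 * S1) + 2 * (S1 - 3 * S2) + 6 * (S2 - c / D) by ring.
apply: le_trans (ler_normD _ _) _; apply: le_trans (lerD (ler_normD _ _) (lexx _)) _.
by rewrite !normrM !(ger0_norm (ler0n _ _)); lra.
Qed.
End LatticeMean.

(** * Limits and zeta values *)

Section Limits.
Variable R : realType.
Implicit Types (m n N M : nat) (x : R).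
Local Notation conj := (@conjc R).
Let hc := @cabs_absv R.

Lemma cvg_harmonic_bound (u : nat -> R) (l C : R) (n0 : nat) :
  (forall n, (n0 <= n)%N -> `|u n - l| <= C / n.+1%:R) -> u @ \oo --> l.
Proof.
move=> hu; apply/cvgrPdist_lt => e e0.
have C0 : 0 < `|C| + 1 by rewrite ltr_wpDl.
exists (maxn n0 (Num.truncn ((`|C| + 1) / e)).+1) => // n /=; rewrite geq_max => /andP[n0n nn].
rewrite distrC; apply: le_lt_trans (hu n n0n) _.
rewrite ltr_pdivrMr ?ltr0n // mulrC -ltr_pdivrMr //.
apply: (@le_lt_trans _ _ ((`|C| + 1) / e)).
  rewrite ler_pM2r ?invr_gt0 //; apply: le_trans (ler_norm _) _; by rewrite lerDl.
by apply: lt_le_trans (truncnS_gt _) _; rewrite ler_nat ltnW.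
Qed.

Lemma sin_le_id x : 0 <= x -> sin x <= x.
Proof.
rewrite le_eqVlt => /predU1P[<-|x0]; first by rewrite sin0.
have [|c _] := @MVT R sin cos 0 x x0.
  exact: continuous_subspaceT (@continuous_sin R).
by rewrite sin0 !subr0 => ->; rewrite ler_piMl ?cos_le1 // ltW.
Qed.

Lemma id_le_tan x : 0 <= x -> x < pi / 2 -> x <= tan x.
Proof.
rewrite le_eqVlt => /predU1P[<-|x0 x2]; first by rewrite tan0.
have cos_pos y : 0 <= y -> y <= x -> 0 < cos y.
  move=> y0 yx; apply: cos_gt0_pihalf; have := pi_gt0 R; move=> p0; apply/andP; split; lra.
have [||c] := @MVT R tan (fun y => (cos y) ^- 2) 0 x x0.
- move=> y; rewrite in_itv /= => /andP[y0 yx]; apply: is_derive_tan.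
  by rewrite gt_eqF // cos_pos ?ltW.
- apply: derivable_within_continuous => y; rewrite in_itv /= => /andP[y0 yx].
  by apply: derivable_tan; rewrite gt_eqF // cos_pos.
rewrite in_itv /= => /andP[c0 cx]; rewrite tan0 !subr0 => ->.
have cc := cos_pos c (ltW c0) (ltW cx).
by rewrite ler_peMl ?(ltW x0) // invf_ge1 ?exprn_gt0 // exprn_ile1 ?cos_le1 // ltW.
Qed.

Lemma xcos_le_sin x : 0 <= x -> x < pi / 2 -> x * cos x <= sin x.
Proof.
move=> x0 x2; have := id_le_tan x0 x2.
have c0 : 0 < cos x by apply: cos_gt0_pihalf; apply/andP; split => //; have := pi_gt0 R; lra.
by rewrite /tan ler_pdivlMr.
Qed.

Lemma one_sub_cos_le x : 0 <= x -> 1 - cos x <= x ^+ 2 / 2.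
Proof.
move=> x0; have h := sin_le_id (_ : 0 <= x / 2); have {}h := h (divr_ge0 x0 (ler0n R 2)).
have h2 : - (x / 2) <= sin (x / 2).
  have [p|p] := leP (x / 2) pi.
    apply: le_trans (_ : 0 <= _); first by rewrite oppr_le0 divr_ge0.
    by apply: sin_ge0_pi; rewrite p divr_ge0.
  apply: le_trans (sin_geN1 _); rewrite lerN2; apply: le_trans (ltW p).
  by have := pi_ge2 R; lra.
have -> : cos x = 1 - 2 * sin (x / 2) ^+ 2.
  have -> : x = x / 2 + x / 2 by rewrite -splitr.
  by rewrite cosD -!expr2 cos2sin2 -splitr; ring.
nra.
Qed.

Lemma chord_xi N m : cabs (1 - xi R N ^+ m) ^+ 2 = 4 * sin (pi * m%:R / N%:R) ^+ 2.
Proof.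
rewrite xiX cabs_sqr ReB ImB /=; set y := pi * m%:R / N%:R.
have -> : 2 * pi * m%:R / N%:R = y + y by rewrite /y; ring.
by rewrite cosD sinD; have := cos2Dsin2 y; nra.
Qed.

Lemma cvg_chord m : (0 < m)%N ->
  (fun M => (6 * M.+1)%:R * sin (pi * m%:R / (6 * M.+1)%:R) : R) @ \oo --> pi * m%:R.
Proof.
move=> m0; apply: (@cvg_harmonic_bound _ _ ((pi * m%:R) ^+ 3) m) => M mM.
set N := (6 * M.+1)%N; set a := pi * m%:R.
have p0 := pi_gt0 R; have a0 : 0 < a by rewrite mulr_gt0 // ltr0n.
have N0 : 0 < N%:R :> R by rewrite ltr0n /N.
have x0 : 0 <= a / N%:R by rewrite divr_ge0 // ltW.
have x2 : a / N%:R < pi / 2.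
  rewrite ltr_pdivrMr // mulrAC -mulrA ltr_pM2l // ltr_pdivlMr // -natrM ltr_nat /N; lia.
have h1 := xcos_le_sin x0 x2; have h2 := sin_le_id x0; have h3 := one_sub_cos_le x0.
have NM : N%:R = 6 * M.+1%:R :> R by rewrite /N natrM.
have aN : a = N%:R * (a / N%:R) by rewrite mulrC divfK ?gt_eqF.
rewrite ler0_norm ?opprB; last first.
  by rewrite subr_le0 [leRHS]aN ler_pM2l.
apply: (@le_trans _ _ (a * ((a / N%:R) ^+ 2 / 2))).
  apply: le_trans (_ : a * (1 - cos (a / N%:R)) <= _); last by rewrite ler_wpM2l // ltW.
  rewrite mulrBr mulr1 lerD2l lerN2 {1}aN -mulrA ler_pM2l //.
have M1 : 1 <= M.+1%:R :> R by rewrite ler1n.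
have E (y : R) : y != 0 -> a * ((a / y) ^+ 2 / 2) = a ^+ 3 * (y ^+ 2 * 2)^-1 by move=> y0; field.
rewrite E ?gt_eqF //.
rewrite ler_pM2l ?exprn_gt0 // lef_pV2 ?posrE ?mulr_gt0 ?exprn_gt0 ?ltr0n //.
by rewrite NM; nra.
Qed.

Definition tent_coef m : R := 8 * (2 %| m)%:R - 9 / 2 * (3 %| m)%:R - 7 / 2.

Lemma cvg_torsion_mean m : (0 < m)%N ->
  (fun M => torsion_mean (@cheb_min R m) (6 * M.+1)) @ \oo --> 6 * tent_coef m / (4 * (pi * m%:R) ^+ 2).
Proof.
move=> m0; pose s M : R := (6 * M.+1)%:R * sin (pi * m%:R / (6 * M.+1)%:R).
have hs : s @ \oo --> pi * m%:R := cvg_chord m0.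
have a0 : 4 * (pi * m%:R) ^+ 2 != 0 :> R.
  by rewrite mulf_neq0 ?expf_neq0 ?mulf_neq0 ?gt_eqF ?pi_gt0 ?ltr0n.
have h1 : (fun M => 6 * tent_coef m / (4 * s M ^+ 2)) @ \oo --> 6 * tent_coef m / (4 * (pi * m%:R) ^+ 2).
  apply: cvgM; first exact: cvg_cst.
  apply: cvgV => //; apply: cvgM; first exact: cvg_cst.
  exact: cvgM.
have h2 : (fun M => torsion_mean (@cheb_min R m) (6 * M.+1) - 6 * tent_coef m / (4 * s M ^+ 2)) @ \oo --> (0 : R).
  apply: (@cvg_harmonic_bound _ _ 5 m) => M mM; rewrite subr0.
  have nd : ~~ (6 * M.+1 %| m)%N by apply/negP => /(dvdn_leq m0); lia.
  have := torsion_mean_cheb R (ltn0Sn M) nd.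
  have -> : (6 * M.+1)%:R ^+ 2 * cabs (1 - xi R (6 * M.+1) ^+ m) ^+ 2 = 4 * s M ^+ 2.
    by rewrite chord_xi /s exprMn; ring.
  move=> /le_trans; apply.
  have N0 : 0 < (6 * M.+1)%:R :> R by rewrite ltr0n.
  rewrite ler_pdivrMr ?exprn_gt0 // mulrAC ler_pdivlMr ?ltr0n //.
  rewrite -[in leLHS]natr1 natrM; have M1 : 1 <= M.+1%:R :> R by rewrite ler1n.
  nra.
rewrite -[X in _ --> X]add0r.
rewrite (_ : (fun M => _) = (fun M => (torsion_mean (@cheb_min R m) (6 * M.+1) - 6 * tent_coef m / (4 * s M ^+ 2)) +
    6 * tent_coef m / (4 * s M ^+ 2))); last by apply/funext => M; rewrite subrK.
exact: cvgD.
Qed.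

(* Parseval for [i |-> i], whose Fourier coefficient at [k] is [N / (xi^k - 1)]. *)
Lemma sum_inv_chord N : (0 < N)%N ->
  \sum_(1 <= k < N) (cabs (1 - xi R N ^+ k) ^+ 2)^-1 = (N%:R ^+ 2 - 1) / 12.
Proof.
move=> N0; have N0' : N%:R != 0 :> R by rewrite pnatr_eq0 -lt0n.
pose s k := \sum_(i < N) i%:R * (xi R N ^+ k) ^+ i.
have sqs k : (cabs (s k) ^+ 2)%:C%C = \sum_(i < N) \sum_(j < N) i%:R * j%:R *
    ((xi R N ^+ k) ^+ i * conj ((xi R N ^+ k) ^+ j)).
  rewrite cabs_sum_sqr; apply: eq_bigr => i _; apply: eq_bigr => j _.
  by rewrite rmorphM rmorph_nat mulrACA.
have parseval : \sum_(k < N) cabs (s k) ^+ 2 = N%:R * \sum_(i < N) i%:R ^+ 2 :> R.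
  apply: (@complexI R); rewrite rmorph_sum /=; under eq_bigr do rewrite sqs.
  rewrite exchange_big /=; under eq_bigr do rewrite exchange_big /=.
  rewrite rmorphM rmorph_nat rmorph_sum mulr_sumr; apply: eq_bigr => i _ /=.
  rewrite (bigD1 i) //= -mulr_sumr xi_orthogonal // eqxx muln1 big1 ?addr0; last first.
    move=> j ji; rewrite -mulr_sumr xi_orthogonal //.
    by rewrite eq_sym (negbTE (_ : j != i :> nat)) // muln0 mulr0.
  by rewrite rmorphXn /= rmorph_nat; ring.
have s0 : cabs (s 0%N) = N%:R * (N%:R - 1) / 2.
  have -> : s 0%N = (\sum_(i < N) i%:R : R)%:C%C.
    rewrite rmorph_sum; apply: eq_bigr => i _.
    by rewrite expr0 expr1n mulr1 /= rmorph_nat.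
  have -> : \sum_(i < N) i%:R = N%:R * (N%:R - 1) / 2 :> R.
    elim: {s sqs parseval N0'} N N0 => // -[|N] IH _; first by rewrite big_ord1 subrr mulr0 mul0r.
    by rewrite big_ord_recr /= IH // -[N.+2%:R]natr1 -[N.+1%:R]natr1; field.
  by rewrite cabs_real ger0_norm // divr_ge0 ?mulr_ge0 // subr_ge0 ler1n.
have sk k : (0 < k < N)%N -> cabs (s k) ^+ 2 = N%:R ^+ 2 * (cabs (1 - xi R N ^+ k) ^+ 2)^-1.
  move=> /andP[k0 kN]; set rho := xi R N ^+ k.
  have prx := xi_prim R N0.
  have rho1 : 1 - rho != 0.
    rewrite subr_eq0 eq_sym -(prim_order_dvd prx); apply/negP => /(dvdn_leq k0).
    by rewrite leqNgt kN.
  have rhoN : rho ^+ N = 1 by rewrite /rho exprAC (prim_expr_order prx) expr1n.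
  have := ramp_sum rho 0 N.-1; rewrite add1n prednK // rhoN expr1 mulr1 big_mkord.
  have -> : \sum_(i < N) rho ^+ i * (i - 0)%:R = s k.
    by apply: eq_bigr => i _; rewrite subn0 mulrC.
  have -> : rho - 1 - (1 - rho) * N.-1%:R = (1 - rho) * (- N%:R).
    by rewrite -[in RHS](prednK N0) -natr1; ring.
  rewrite expr2 -mulrA => /(mulfI rho1) h.
  have -> : s k = (- N%:R) / (1 - rho) by rewrite -h mulrC mulKf.
  by rewrite (absvM hc) (absvN hc) (absvV hc) -(rmorph_nat (real_complex R)) cabs_real exprMn exprVn ger0_norm.
have sq : \sum_(i < N) i%:R ^+ 2 = N%:R * (N%:R - 1) * (2 * N%:R - 1) / 6 :> R.
  elim: {s sqs parseval N0' s0 sk N0} N => [|N IH]; first by rewrite big_ord0; ring.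
  by rewrite big_ord_recr /= IH -[N.+1%:R]natr1; field.
move: parseval; rewrite -(big_mkord xpredT (fun k => cabs (s k) ^+ 2)) big_ltn // s0 sq.
rewrite (eq_big_nat _ _ sk) -mulr_sumr => h.
have N2 : N%:R ^+ 2 != 0 :> R by rewrite expf_neq0.
apply: (mulfI N2).
by move: h => /(canRL (addKr _)) ->; field.
Qed.

(* [cot^2 x <= 1/x^2 <= 1/sin^2 x] at [x = pi k / N], summed by [sum_inv_chord]. *)
Lemma basel_bounds n N : N = n.*2.+1 ->
  (N%:R ^+ 2 - 1) / 6 - n%:R <= N%:R ^+ 2 / (pi : R) ^+ 2 * \sum_(1 <= k < n.+1) (k%:R ^+ 2)^-1 <= ((N%:R ^+ 2 - 1) / 6 : R).
Proof.
move=> NE; have N0 : (0 < N)%N by rewrite NE.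
have N0' : 0 < N%:R :> R by rewrite ltr0n.
have p0 := pi_gt0 R.
(* As [N] is odd, the chords of [k] and [N - k] pair off without a middle term; with
   [|1 - xi^k|^2 = 4 sin^2] the value [(N^2 - 1) / 12] is doubled. *)
have S2 : \sum_(1 <= k < n.+1) (sin (pi * k%:R / N%:R) ^+ 2)^-1 = (N%:R ^+ 2 - 1) / 6 :> R.
  have := sum_inv_chord N0.
  rewrite (@big_cat_nat _ _ _ n.+1) //=; last by lia.
  have -> : \sum_(n.+1 <= k < N) (cabs (1 - xi R N ^+ k) ^+ 2)^-1 =
            \sum_(1 <= k < n.+1) (cabs (1 - xi R N ^+ k) ^+ 2)^-1.
    rewrite -{1}[n.+1]add1n big_addn big_nat_rev /=.
    have -> : (N - n = n.+1)%N by lia.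
    apply: eq_big_nat => k kn; have -> : (1 + n.+1 - k.+1 + n = N - k)%N by lia.
    rewrite xi_rev //; last by lia.
    by rewrite -[in RHS]cabs_conj rmorphB rmorph1.
  under eq_bigr do rewrite chord_xi invfM.
  rewrite -mulr_sumr => h; lra.
have term k : (1 <= k < n.+1)%N ->
   (sin ((pi : R) * k%:R / N%:R) ^+ 2)^-1 - 1 <= N%:R ^+ 2 / (pi : R) ^+ 2 * (k%:R ^+ 2)^-1 <= ((sin (pi * k%:R / N%:R) ^+ 2)^-1 : R).
  move=> /andP[k0 kn]; set x := pi * k%:R / N%:R.
  have x0 : 0 < x by rewrite divr_gt0 // mulr_gt0 // ltr0n.
  have x2 : x < pi / 2.
    rewrite ltr_pdivrMr // mulrAC -mulrA ltr_pM2l // ltr_pdivlMr // -natrM ltr_nat; lia.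
  have -> : N%:R ^+ 2 / pi ^+ 2 * (k%:R ^+ 2)^-1 = (x ^+ 2)^-1.
    by rewrite /x !exprMn exprVn !invfM invrK; ring.
  have s0 : 0 < sin x by apply: sin_gt0_pi; apply/andP; split => //; lra.
  have c0 : 0 < cos x by apply: cos_gt0_pihalf; apply/andP; split => //; lra.
  have h1 := sin_le_id (ltW x0); have h2 := xcos_le_sin (ltW x0) x2.
  apply/andP; split; last first.
    by rewrite lef_pV2 ?posrE ?exprn_gt0 // lerXn2r ?nnegrE // ltW.
  have -> : (sin x ^+ 2)^-1 - 1 = (cos x / sin x) ^+ 2.
    rewrite exprMn exprVn -[cos x ^+ 2](addrK (sin x ^+ 2)) cos2Dsin2 mulrBl mul1r divff //.
    by rewrite expf_neq0 // gt_eqF.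
  have xi0 : 0 <= x^-1 by rewrite invr_ge0 ltW.
  have q0 : 0 <= cos x / sin x by apply: divr_ge0; apply: ltW.
  rewrite -exprVn lerXn2r ?nnegrE //.
  by rewrite ler_pdivrMr // mulrC ler_pdivlMr // mulrC.
rewrite mulr_sumr; apply/andP; split; last first.
  by rewrite -S2; apply: ler_sum_nat => k kn; case/andP: (term k kn).
have -> : (N%:R ^+ 2 - 1) / 6 - n%:R = \sum_(1 <= k < n.+1) ((sin (pi * k%:R / N%:R) ^+ 2)^-1 - 1) :> R.
  by rewrite sumrB S2 sumr_const_nat subn1.
by apply: ler_sum_nat => k kn; case/andP: (term k kn).
Qed.

Lemma basel : zeta R 2 = pi ^+ 2 / 6.
Proof.
apply: cvg_lim => //; apply: (@cvg_harmonic_bound _ _ (pi ^+ 2) 0) => n _.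
have -> : series (fun k : nat => (k.+1%:R : R) ^- 2) n = \sum_(1 <= k < n.+1) (k%:R ^+ 2)^-1.
  by rewrite /series /= big_add1.
have := basel_bounds (erefl n.*2.+1); set S := \sum_(1 <= k < n.+1) _ => /= /andP[h1 h2].
have p0 : 0 < pi ^+ 2 :> R by rewrite exprn_gt0 // pi_gt0.
have N0 : 0 < n.*2.+1%:R ^+ 2 :> R by rewrite exprn_gt0 // ltr0n.
rewrite mulrAC ler_pdivlMr // in h1; rewrite mulrAC ler_pdivrMr // in h2.
have Nn : n.*2.+1%:R = 2 * n%:R + 1 :> R by rewrite -natr1 -mul2n natrM.
rewrite Nn in N0 h1 h2.
have n0 : 0 <= n%:R :> R by [].
rewrite ler_pdivlMr ?ltr0n // -(ger0_norm (ler0n R n.+1)) -normrM ler_norml -[n.+1%:R]natr1.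
move: n0 p0 N0 h1 h2; move: (n%:R : R) (pi ^+ 2 : R) S => y p S y0 p0 N0 h1 h2.
have e : forall a b : R, a * (2 * y + 1) ^+ 2 <= b * (2 * y + 1) ^+ 2 -> a <= b.
  by move=> a b; rewrite ler_pM2r.
have y1 : 0 <= y + 1 by lra.
have h3 := ler_wpM2r y1 h1; have h4 := ler_wpM2r y1 h2.
have py : 0 <= p * y by rewrite mulr_ge0 // ltW.
have pyy : 0 <= p * y * y by rewrite mulr_ge0.
by apply/andP; split; apply: e; lra.
Qed.
End Limits.

Section ZetaThree.
Variable R : realType.

(** The term at 0 is 0, the inverse of 0 being 0. Starting there lets [big_dvdn_mul] extract
    multiples without boundary terms. *)
Definition inv_cubes n : R := \sum_(0 <= k < n) (k%:R ^+ 3)^-1.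

Lemma inv_cubesS n : inv_cubes n.+1 = series (fun k : nat => (k.+1%:R : R) ^- 3) n.
Proof. by rewrite /inv_cubes big_ltn // expr0n /= invr0 add0r big_add1 /series /=. Qed.

Lemma sum_inv_sqr_le n : \sum_(0 <= k < n) (k%:R ^+ 2)^-1 <= 2 :> R.
Proof.
(* The strengthened bound telescopes, since [1 / (n+1)^2 <= 2 / ((n+1) (n+2))]. *)
suff h : \sum_(0 <= k < n.+1) (k%:R ^+ 2)^-1 <= 2 - 2 / n.+1%:R :> R.
  have h2 : 2 - 2 / n.+1%:R <= 2 :> R by rewrite gerBl divr_ge0.
  apply: le_trans (le_trans h h2); rewrite [leRHS]big_nat_recr //= lerDl invr_ge0.
  by rewrite exprn_ge0.
elim: n => [|n IH].
  by rewrite big_nat1 expr0n /= invr0 divr1 subrr.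
rewrite big_nat_recr //=; apply: le_trans (lerD IH (lexx _)) _.
have -> : n.+2%:R = n.+1%:R + 1 :> R by rewrite -natr1.
have : 1 <= n.+1%:R :> R by rewrite ler1n.
move: (n.+1%:R : R) => x x1; rewrite -subr_ge0.
have x0 : 0 < x by lra.
have xn : x != 0 by rewrite gt_eqF.
have yn : x + 1 != 0 by rewrite gt_eqF //; lra.
have -> : 2 - 2 / (x + 1) - (2 - 2 / x + (x ^+ 2)^-1) = (x - 1) / (x ^+ 2 * (x + 1)).
  by field; rewrite xn yn.
by rewrite divr_ge0 ?subr_ge0 ?mulr_ge0 ?exprn_ge0 ?(ltW x0) //; lra.
Qed.

Lemma inv_cubes_le n : inv_cubes n <= 2.
Proof.
apply: le_trans (sum_inv_sqr_le n); apply: ler_sum => -[|k] _; first by rewrite !expr0n /= invr0.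
rewrite lef_pV2 ?posrE ?exprn_gt0 ?ltr0n // [_ ^+ 3]exprS ler_peMl ?exprn_ge0 //.
by rewrite ler1n.
Qed.

Lemma cvg_inv_cubes : inv_cubes @ \oo --> zeta R 3.
Proof.
rewrite -(cvg_shiftS inv_cubes).
rewrite (_ : [sequence inv_cubes n.+1]_n = series (fun k : nat => (k.+1%:R : R) ^- 3)); last first.
  by apply/funext => n; rewrite /mk_sequence inv_cubesS.
apply: nondecreasing_is_cvgn.
  by apply: nondecreasing_series => k _ _; rewrite invr_ge0 exprn_ge0.
by exists 2 => _ [n _ <-]; rewrite -inv_cubesS; apply: inv_cubes_le.
Qed.

(** A cut-off divisible by 6 turns the multiples of 2 and of 3 into complete partial sums; the
    coefficients are [8 / 2^3 = 1] and [(9/2) / 3^3 = 1/6]. *)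
Lemma sum_tent_coef_inv_cubes n :
  \sum_(0 <= m < n * 6) tent_coef R m * (m%:R ^+ 3)^-1 =
  inv_cubes (n * 3) - 6^-1 * inv_cubes (n * 2) - 7 / 2 * inv_cubes (n * 6).
Proof.
have h p a : (0 < p)%N ->
    \sum_(0 <= m < a * p) (p %| m)%:R * (m%:R ^+ 3)^-1 = (p%:R ^+ 3)^-1 * inv_cubes a.
  move=> p0; have E := @big_dvdn_mul R 0 +%R p a (fun m => (m%:R ^+ 3)^-1) p0.
  rewrite big_mkcond in E; rewrite /inv_cubes mulr_sumr.
  apply: etrans (etrans _ E) _; apply: eq_bigr => k _.
    by case: (p %| k)%N; rewrite ?mul1r ?mul0r.
  by rewrite natrM exprMn invfM mulrC.
have h2 := h 2 (n * 3)%N isT; have h3 := h 3 (n * 2)%N isT.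
rewrite -mulnA in h2; rewrite -mulnA in h3.
have -> : \sum_(0 <= m < n * 6) tent_coef R m * (m%:R ^+ 3)^-1 =
  8 * (\sum_(0 <= m < n * 6) (2 %| m)%:R * (m%:R ^+ 3)^-1)
  - 9 / 2 * (\sum_(0 <= m < n * 6) (3 %| m)%:R * (m%:R ^+ 3)^-1) - 7 / 2 * inv_cubes (n * 6).
  rewrite /inv_cubes !mulr_sumr -!sumrB; apply: eq_bigr => m _; rewrite /tent_coef; ring.
rewrite h2 h3; lra.
Qed.

Definition cheb_coef m : R := 6 * tent_coef R m / (4 * (pi * m%:R) ^+ 2).

Lemma cheb_coef_div m : cheb_coef m / m%:R = 3 / (2 * pi ^+ 2) * (tent_coef R m * (m%:R ^+ 3)^-1).
Proof.
rewrite /cheb_coef; have p0 : pi != 0 :> R by rewrite gt_eqF ?pi_gt0.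
have [->|m0] := eqVneq (m%:R : R) 0; first by rewrite invr0 expr0n /= invr0 !mulr0.
by move: (pi : R) p0 (tent_coef R m) (m%:R : R) m0 => p p0 g x x0; field; rewrite x0 p0.
Qed.

Lemma cvg_sum_cheb_coef :
  (fun n => \sum_(0 <= m < n * 6) cheb_coef m / m%:R) @ \oo --> - ((2 * zeta R 3) / (3 * zeta R 2)).
Proof.
rewrite (_ : (fun n => _) = fun n => 3 / (2 * pi ^+ 2) * 
   (inv_cubes (n * 3) - 6^-1 * inv_cubes (n * 2) - 7 / 2 * inv_cubes (n * 6))); last first.
  apply/funext => n; rewrite -sum_tent_coef_inv_cubes mulr_sumr; apply: eq_bigr => m _; exact: cheb_coef_div.
(* Here [1 - 1/6 - 7/2 = - 8/3], and [zeta R 2 = pi^2 / 6] makes both sides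
   [- 4 zeta R 3 / pi^2]. *)
have -> : - ((2 * zeta R 3) / (3 * zeta R 2)) =
   3 / (2 * pi ^+ 2) * (zeta R 3 - 6^-1 * zeta R 3 - 7 / 2 * zeta R 3).
  rewrite basel; have p0 : pi != 0 :> R by rewrite gt_eqF ?pi_gt0.
  move: (pi : R) p0 (zeta R 3) => q q0 z; field; exact: q0.
have sub p : (0 < p)%N -> (fun n => inv_cubes (n * p)) @ \oo --> zeta R 3.
  move=> p0; apply: (cvg_comp (fun n => (n * p)%N) inv_cubes _ cvg_inv_cubes).
  apply/cvgnyPge => A; exists A => // n /= An; exact: leq_trans An (leq_pmulr _ p0).
apply: cvgMr; apply: cvgB; [apply: cvgB|]; [exact: sub|apply: cvgMr; exact: sub|apply: cvgMr; exact: sub].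
Qed.

(** Absolute convergence makes the passage from [r < 1] to 1 uniform in the truncation. The bound
    [3 / m^2] of a term comes from [|tent_coef| <= 8] and [pi^2 >= 4]. *)
Lemma sum_norm_cheb_coef M : \sum_(0 <= m < M) `|cheb_coef m| <= 6.
Proof.
have bound m : `|cheb_coef m| <= 3 * (m%:R ^+ 2)^-1.
  rewrite /cheb_coef; have [->|m0] := eqVneq (m%:R : R) 0.
    by rewrite mulr0 expr0n /= mulr0 invr0 !mulr0 normr0.
  have m20 : 0 < m%:R ^+ 2 :> R by rewrite exprn_gt0 // lt0r m0 ler0n.
  have gam8 : `|tent_coef R m| <= 8.
    by rewrite /tent_coef; case: (2 %| m)%N; case: (3 %| m)%N => /=; rewrite ler_norml; lra.
  have p2 : 2 <= pi :> R by exact: pi_ge2.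
  have p4 : 4 <= pi ^+ 2 :> R by nra.
  rewrite normrM normfV [`|4 * _|]ger0_norm; last first.
    by rewrite mulr_ge0 ?exprn_ge0 ?mulr_ge0 // pi_ge0.
  rewrite normrM [`|6|]ger0_norm // exprMn.
  rewrite ler_pdivrMr; last first.
    by apply: mulr_gt0 => //; apply: mulr_gt0 => //; apply: lt_le_trans p4.
  rewrite [X in _ <= X](_ : _ = 12 * pi ^+ 2); last first.
    by move: m20 => /gt_eqF/negbT h; move: (m%:R ^+ 2 : R) (pi ^+ 2 : R) h => x q h; field.
  lra.
apply: le_trans (_ : 3 * \sum_(0 <= m < M) (m%:R ^+ 2)^-1 <= _).
  by rewrite mulr_sumr; apply: ler_sum => m _; exact: bound.
have := sum_inv_sqr_le M; lra.
Qed.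
End ZetaThree.

(** * Convergence of the mean over strict orbits *)

Section Chords.
Variable R : realType.
Local Notation conj := (@conjc R).

Lemma min_lip (a b a' b' D : R) : `|a - a'| <= D -> `|b - b'| <= D ->
  `|Num.min a b - Num.min a' b'| <= D.
Proof. by rewrite /Num.min; case: ifP; case: ifP; rewrite !ler_norml; lra. Qed.

Lemma min_Re_lip (x y x' y' : R[i]) : cabs x = 1 -> cabs y = 1 -> cabs x' = 1 -> cabs y' = 1 ->
  `|min_Re x y - min_Re x' y'| <= cabs (x - x') + cabs (y - y').
Proof.
have hc := @cabs_absv R; move=> x1 y1 x1' y1'.
have ReL (u v : R[i]) : `|complex.Re u - complex.Re v| <= cabs (u - v).
  by rewrite -ReB; exact: Re_le_cabs.
apply: min_lip; first by apply: le_trans (ReL _ _) _; rewrite lerDl absv_ge0.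
apply: min_lip; first by apply: le_trans (ReL _ _) _; rewrite lerDr absv_ge0.
apply: le_trans (ReL _ _) _.
have -> : conj x * y - conj x' * y' = conj (x - x') * y + conj x' * (y - y').
  by rewrite rmorphB /=; ring.
apply: le_trans (absvD hc _ _) _.
by rewrite !(absvM hc) !cabs_conj y1 x1' mulr1 mul1r.
Qed.

Lemma Re_unit_bounds (x : R[i]) : cabs x = 1 -> -1 <= complex.Re x <= 1.
Proof. by move=> x1; rewrite -ler_norml -x1 Re_le_cabs. Qed.

Lemma min_Re_bounds (x y : R[i]) : cabs x = 1 -> cabs y = 1 -> -1 <= min_Re x y <= 1.
Proof.
move=> x1 y1; have hc := @cabs_absv R.
have /andP[h1 h2] := Re_unit_bounds x1; have /andP[h3 h4] := Re_unit_bounds y1.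
have /Re_unit_bounds/andP[h5 h6] : cabs (conj x * y) = 1 by rewrite (absvM hc) cabs_conj x1 y1 mulr1.
by rewrite /min_Re !le_min h1 h3 h5 /= ge_min h2.
Qed.

Lemma Re_sum (T : finType) (P : pred T) (F : T -> R[i]) :
  complex.Re (\sum_(k | P k) F k) = \sum_(k | P k) complex.Re (F k).
Proof. by apply: (big_morph (@complex.Re R)) => // x y; rewrite ReD. Qed.

Lemma chord_sqr (x y : R[i]) : cabs x = 1 -> cabs y = 1 ->
  complex.Re (conj x * y) = 1 - cabs (y - x) ^+ 2 / 2.
Proof.
move=> x1 y1; have := cabs_sqr x; have := cabs_sqr y; have := cabs_sqr (y - x).
rewrite x1 y1 ReM ReB ImB; case: (x) => a b; case: (y) => c d /= -> h1 h2.
lra.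
Qed.

Lemma min_Re_maxchord (x y : R[i]) : cabs x = 1 -> cabs y = 1 ->
  min_Re x y = 1 - maxchord x y ^+ 2 / 2.
Proof.
move=> x1 y1; have hc := @cabs_absv R.
have fmax (a b : R) : 0 <= a -> 0 <= b ->
    1 - Num.max a b ^+ 2 / 2 = Num.min (1 - a ^+ 2 / 2) (1 - b ^+ 2 / 2).
  move=> a0 b0; rewrite /Num.max /Num.min; case: ltP => ab; case: ltP => //; nra.
rewrite /maxchord /min_Re [Num.max _ 0]max_l ?absv_ge0 //.
rewrite !fmax ?le_max ?absv_ge0 // -(chord_sqr x1 y1).
have -> : 1 - cabs (1 - y) ^+ 2 / 2 = complex.Re y.
  by rewrite -chord_sqr ?absv1 // ReM /= ; case: (y) => a b /=; ring.
have -> : 1 - cabs (x - 1) ^+ 2 / 2 = complex.Re x.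
  by rewrite -chord_sqr ?absv1 // conjc1 mul1r.
by rewrite [LHS]minCA [RHS]minCA; congr Num.min; exact: minC.
Qed.

Lemma ln_half_sqr (D : R) : 0 < D -> ln D = 2^-1 * ln (D ^+ 2).
Proof. by move=> D0; have := lnXn 2 D0; lra. Qed.

(** The quadratic is [(1 - r)^2 + r D^2], which is at least [r D^2]. *)
Lemma ln_chord_le (r D : R) : 0 < r < 1 -> 0 < D ->
  ln D <= 2^-1 * ln (1 - 2 * r * (1 - D ^+ 2 / 2) + r ^+ 2) - 2^-1 * ln r.
Proof.
move=> /andP[r0 r1] D0; rewrite (ln_half_sqr D0) -mulrBr ler_pM2l ?invr_gt0 // lerBrDr.
have D20 : 0 < D ^+ 2 by rewrite exprn_gt0.
rewrite -lnM ?posrE // ler_ln ?posrE ?mulr_gt0 //; first by nra.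
by nra.
Qed.

(** The quotient [((1 - r)^2 + r D^2) / D^2] decreases in [D]. Comparing its values at [d] and [D]
    trades [ln D] for [ln d], whose mean is controlled arithmetically. *)
Lemma ln_chord_ratio_le (r d D : R) : 0 < r < 1 -> 0 < d <= D ->
  2^-1 * ln (1 - 2 * r * (1 - D ^+ 2 / 2) + r ^+ 2) -
  2^-1 * ln (1 - 2 * r * (1 - d ^+ 2 / 2) + r ^+ 2) + ln d <= ln D.
Proof.
move=> /andP[r0 r1] /andP[d0 dD]; have D0 : 0 < D by exact: lt_le_trans dD.
rewrite (ln_half_sqr D0) (ln_half_sqr d0) -mulrBr -mulrDr ler_pM2l ?invr_gt0 //.
have D20 : 0 < D ^+ 2 by rewrite exprn_gt0.
have d20 : 0 < d ^+ 2 by rewrite exprn_gt0.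
have dD2 : d ^+ 2 <= D ^+ 2 by rewrite lerXn2r // nnegrE ltW.
have Qpos a : 0 < a -> 0 < 1 - 2 * r * (1 - a / 2) + r ^+ 2 by nra.
have E a : 1 - 2 * r * (1 - a / 2) + r ^+ 2 = (1 - r) ^+ 2 + r * a by field.
rewrite addrAC lerBlDr -!lnM ?posrE ?Qpos // ler_ln ?posrE ?mulr_gt0 ?Qpos // !E.
rewrite mulrDl mulrDr [r * D ^+ 2 * _]mulrAC -[r * d ^+ 2 * _]mulrC; 
have h := ler_wpM2l (sqr_ge0 (1 - r)) dD2; lra.
Qed.

Lemma one_sub_expr_le (r : R) m : 0 <= r <= 1 -> 1 - r ^+ m <= m%:R * (1 - r).
Proof.
move=> /andP[r0 r1]; elim: m => [|m IH]; first by rewrite expr0 mul0r subrr.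
rewrite exprS -natr1; have h := exprn_ge0 m r0.
have h2 : r ^+ m <= 1 by exact: exprn_ile1.
nra.
Qed.
End Chords.

Section OrbitMeans.
Variables (R : realType) (n i j : nat -> nat).
Local Notation conj := (@conjc R).
Hypothesis n_gt0 : forall l, (0 < n l)%N.
(* The exponent [(n l).-1] stands for [-1]: no nontrivial character of fixed exponents,
   even raised to the power [M], is trivial on the orbit for large [l]. *)
Hypothesis generic : forall a b c d M, (a, c) != (b, d) -> (0 < M)%N ->
  \forall l \near \oo,
    ~~ (n l %| M * (i l * a + j l * c + (n l).-1 * (i l * b + j l * d)))%N.

Let X l k : R[i] := (xi R (n l) ^+ k) ^+ i l.
Let Y l k : R[i] := (xi R (n l) ^+ k) ^+ j l.

Definition orbit_mean l (F : R[i] -> R[i] -> R) : R :=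
  (totient (n l))%:R^-1 * \sum_(k < n l | coprime k (n l)) F (X l k) (Y l k).

(** An order at most [B] divides [B!], against [generic] for the first coordinate raised to the
    power [B!]. *)
Lemma orbit_order_gt B : \forall l \near \oo, (B < n l)%N.
Proof.
have := @generic 1 0 0 0 B`! isT (fact_gt0 B); apply: filterS => l.
by apply: contraNT; rewrite -leqNgt => le; rewrite dvdn_mulr // dvdn_fact // n_gt0.
Qed.

Let totient_gt0R l : 0 < (totient (n l))%:R :> R.
Proof. by rewrite ltr0n totient_gt0. Qed.

Let unitX l k : cabs (X l k) = 1. Proof. by rewrite /X -exprM cabs_xi. Qed.
Let unitY l k : cabs (Y l k) = 1. Proof. by rewrite /Y -exprM cabs_xi. Qed.

Lemma orbit_character_small a b c d (e : R) : (a, c) != (b, d) -> 0 < e ->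
  \forall l \near \oo,
    cabs (\sum_(k < n l | coprime k (n l))
            X l k ^+ a * Y l k ^+ c * conj (X l k ^+ b * Y l k ^+ d)) <=
    e * (totient (n l))%:R.
Proof.
move=> ne e0; pose M := (Num.bound e^-1).+1.
have eM : M%:R^-1 <= e.
  rewrite invf_ple ?posrE ?ltr0n //; apply: ltW; apply: lt_le_trans (archi_boundP _) _.
    by rewrite invr_ge0 ltW.
  by rewrite ler_nat.
have := @generic a b c d (2 * M)`! ne (fact_gt0 _); apply: filterS => l h.
have := ramanujan_sum_le R (n_gt0 l) (M := M) isT h => le.
rewrite (eq_bigr (fun k : 'I_(n l) => xi R (n l) ^+ (k *
   (i l * a + j l * c + (n l).-1 * (i l * b + j l * d))))); last first.
  move=> k _; have cj m : conj (xi R (n l) ^+ m) = xi R (n l) ^+ ((n l).-1 * m).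
    by rewrite rmorphXn exprM -subn1 xi_rev // expr1.
  rewrite /X /Y -!exprM -!exprD cj -exprD; congr (_ ^+ _); ring.
apply: le_trans le _; rewrite mulrC ler_wpM2r //.
Qed.

Lemma orbit_mean_le l F G :
  (forall k, coprime k (n l) -> F (X l k) (Y l k) <= G (X l k) (Y l k)) ->
  orbit_mean l F <= orbit_mean l G.
Proof.
move=> h; rewrite ler_wpM2l ?invr_ge0 //; apply: ler_sum => k kn; exact: h.
Qed.

Lemma orbit_mean_cst l c : orbit_mean l (fun _ _ => c) = c.
Proof.
rewrite /orbit_mean sumr_const card_coprime_totient -[c *+ _]mulr_natr mulrCA mulVf ?mulr1 //.
by rewrite gt_eqF.
Qed.

Lemma orbit_meanD l F G :
  orbit_mean l (fun x y => F x y + G x y) = orbit_mean l F + orbit_mean l G.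
Proof. by rewrite /orbit_mean big_split mulrDr. Qed.

Lemma orbit_meanB l F G :
  orbit_mean l (fun x y => F x y - G x y) = orbit_mean l F - orbit_mean l G.
Proof. by rewrite /orbit_mean sumrB mulrBr. Qed.

Lemma orbit_mean_sum l M (c : nat -> R) (F : nat -> R[i] -> R[i] -> R) :
  orbit_mean l (fun x y => \sum_(m < M) c m * F m x y) =
  \sum_(m < M) c m * orbit_mean l (F m).
Proof.
rewrite /orbit_mean exchange_big mulr_sumr; apply: eq_bigr => m _.
by rewrite -mulr_sumr mulrCA.
Qed.

(** The error is shared in three: [q] makes the Fejer error small, [eta] is chosen for the finitely
    many characters of exponents below [q^2], and the level of the torsion mean is taken large
    independently of [l]. *)
Lemma orbit_mean_cheb_min m : (0 < m)%N ->
  orbit_mean l (cheb_min m) @[l --> \oo] --> cheb_coef R m.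
Proof.
move=> m0; apply/cvgrPdist_le => e e0.
pose L : R := 5 ^+ m; have L0 : 0 < L by rewrite exprn_gt0.
pose q := (Num.bound (12 * L / e)).+1.
have q0 : 0 < q%:R :> R by rewrite ltr0n.
have hq : 4 * L / q%:R <= e / 3.
  have : 12 * L / e < q%:R.
    apply: lt_le_trans (archi_boundP _) _; last by rewrite ler_nat.
    by rewrite divr_ge0 ?mulr_ge0 // ltW.
  rewrite ltr_pdivrMr // ler_pdivrMr //; lra.
pose eta : R := e / 3 / (q ^ 4)%:R.
have q40 : 0 < (q ^ 4)%:R :> R by rewrite ltr0n expn_gt0.
have eta0 : 0 < eta by rewrite divr_gt0 // divr_gt0.
have char : \forall l \near \oo, forall t : 'I_(q ^ 2) * 'I_(q ^ 2) * 'I_(q ^ 2) * 'I_(q ^ 2),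
   (t.1.1.1, t.1.2) != (t.1.1.2, t.2) ->
   cabs (\sum_(k < n l | coprime k (n l)) X l k ^+ t.1.1.1 * Y l k ^+ t.1.2 * 
      conj (X l k ^+ t.1.1.2 * Y l k ^+ t.2)) <= eta * (totient (n l))%:R.
  apply: filter_forall => t; have [eqt|ne] := eqVneq (t.1.1.1, t.1.2) (t.1.1.2, t.2).
    exact: filterE.
  have ne' : (val t.1.1.1, val t.1.2) != (val t.1.1.2, val t.2).
    by move: ne; rewrite !xpair_eqE -!val_eqE.
  by apply: filterS (orbit_character_small ne' eta0) => l h _.
have /cvgrPdist_le lim := @cvg_torsion_mean R m m0.
have e3 : 0 < e / 3 by rewrite divr_gt0.
have [N _ hN] := lim _ e3.
apply: filterS char => l hl.
pose M := maxn N (q ^ 2).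
have hM := hN M (leq_maxl _ _).
have fle1 (x y : R[i]) : cabs x = 1 -> cabs y = 1 -> `|cheb_min m x y| <= 1.
  by move=> x1 y1; apply: cheb_le1; apply: min_Re_bounds.
have flip (x y x' y' : R[i]) : cabs x = 1 -> cabs y = 1 -> cabs x' = 1 -> cabs y' = 1 ->
    `|cheb_min m x y - cheb_min m x' y'| <= L * (cabs (x - x') + cabs (y - y')).
  move=> x1 y1 x1' y1'; apply: le_trans (cheb_lip _ (min_Re_bounds x1 y1) (min_Re_bounds x1' y1')) _.
  by rewrite ler_pM2l //; apply: min_Re_lip.
have cardE : #|[pred k : 'I_(n l) | coprime k (n l)]| = totient (n l) by exact: card_coprime_totient.
have := @equidistribution R (cheb_min m) L (ltW L0) fle1 flip _ 
  (fun k : 'I_(n l) => coprime k (n l)) (fun k => X l k) (fun k => Y l k) eta (fun k _ => unitX l k)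
  (fun k _ => unitY l k) _ (ltW eta0) q (6 * M.+1) isT.
rewrite cardE totient_gt0 n_gt0 => /(_ isT) E.
have qM : (q ^ 2 <= 6 * M.+1)%N.
  by apply: leq_trans (_ : M <= _)%N; [exact: leq_maxr|clear; lia].
have {E} := E qM (fun a b c d => hl (a, b, c, d)).
rewrite /orbit_mean [_^-1 * _]mulrC.
set A := _ / _; set T := torsion_mean _ _ in hM *.
have -> : (q ^ 4)%:R * eta = e / 3 by rewrite /eta mulrC divfK // gt_eqF.
move: hM hq; rewrite /cheb_coef.
move: (6 * _ / _) (4 * L / _) => c B; rewrite !ler_norml => /andP[h1 h2] h3 /andP[h4 h5].
by apply/andP; split; lra.
Qed.

(** On the unit circle [cheb m (Re x)] is the real part of [x^m], so a single character is
    involved. *)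
Lemma orbit_mean_cheb_Re m : (0 < m)%N ->
  orbit_mean l (fun x _ => cheb m (complex.Re x)) @[l --> \oo] --> (0 : R).
Proof.
move=> m0; apply/cvgrPdist_le => e e0.
have := @orbit_character_small m 0 0 0 e _ e0; rewrite xpair_eqE (gtn_eqF m0) => /(_ isT).
apply: filterS => l h; rewrite sub0r normrN.
have -> : orbit_mean l (fun x _ => cheb m (complex.Re x)) =
   (totient (n l))%:R^-1 * complex.Re (\sum_(k < n l | coprime k (n l)) X l k ^+ m).
  rewrite Re_sum; congr (_ * _); apply: eq_bigr => k _.
  rewrite /X -exprM xiX cheb_cos cisX; congr cos.
rewrite normrM ger0_norm ?invr_ge0 // mulrC ler_pdivrMr //.
apply: le_trans (Re_le_cabs _) _; apply: le_trans h; rewrite le_eqVlt; apply/orP; left; apply/eqP; congr cabs.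
by apply: eq_bigr => k _; rewrite !expr0 mulr1 rmorphM rmorph1 !mulr1.
Qed.

Let log_partial r M l (F : nat -> R[i] -> R[i] -> R) : R :=
  \sum_(m < M) r ^+ m.+1 / m.+1%:R * orbit_mean l (F m.+1).

(** [E] bounds the truncation error of the Chebyshev series of [g_r]. The lower bound uses this
    series twice, at [min_Re x y] and at [Re x], hence [2 * E]; [- ln r / 2] is the loss of
    [ln_chord_le]. *)
Lemma log_mean_bounds r M l S T E : 0 < r < 1 -> ~~ (n l %| i l)%N ->
  S = log_partial r M l (@cheb_min R) ->
  T = log_partial r M l (fun m x _ => cheb m (complex.Re x)) ->
  E = 2 * r ^+ M / (1 - r) ^+ 2 ->
  - S + T - 2 * E <= orbit_mean l (fun x y => ln (maxchord x y)) <= - S + E - 2^-1 * ln r.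
Proof.
move=> r01 ni SE TE EE; have /andP[r0 r1] := r01; have hc := @cabs_absv R.
have r01' : 0 <= r < 1 by rewrite ltW.
pose Q t := 2^-1 * ln (1 - 2 * r * t + r ^+ 2).
pose K t := \sum_(m < M) r ^+ m.+1 / m.+1%:R * cheb m.+1 t.
have QK t : -1 <= t <= 1 -> - K t - E <= Q t <= - K t + E.
  move=> ht; have := log_cheb_series M ht r01'.
  have -> : \sum_(m < M) r ^+ m.+1 * (cheb m.+1 t / m.+1%:R) = K t.
    by apply: eq_bigr => m _; rewrite mulrA mulrAC.
  rewrite -/(Q t) -EE ler_norml => /andP[h1 h2]; apply/andP; split; lra.
have {}SE : orbit_mean l (fun x y => K (min_Re x y)) = S 
  by rewrite SE; exact: (orbit_mean_sum l M (fun m => r ^+ m.+1 / m.+1%:R) (fun m => @cheb_min R m.+1)).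
have {}TE : orbit_mean l (fun x _ => K (complex.Re x)) = T.
  by rewrite TE; exact: (orbit_mean_sum l M (fun m => r ^+ m.+1 / m.+1%:R) (fun m x _ => cheb m.+1 (complex.Re x))).
have dpos k : coprime k (n l) -> 0 < cabs (X l k - 1).
  move=> kn; rewrite absv_gt0 // subr_eq0 /X -exprM.
  by rewrite -(prim_order_dvd (xi_prim R (n_gt0 l))) Gauss_dvdr // coprime_sym.
have dD k : cabs (X l k - 1) <= maxchord (X l k) (Y l k).
  by rewrite /maxchord !le_max lexx !orbT.
apply/andP; split; last first.
  apply: le_trans (_ : orbit_mean l (fun x y => (0 - K (min_Re x y)) + (E - 2^-1 * ln r)) <= _); last first.
    by rewrite orbit_meanD orbit_meanB !orbit_mean_cst SE; lra.
  apply: orbit_mean_le => k kn.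
  have := ln_chord_le r01 (lt_le_trans (dpos k kn) (dD k)).
  rewrite -min_Re_maxchord // -/(Q _); have /andP[_] := QK _ (min_Re_bounds (unitX l k) (unitY l k)); lra.
have dmean : 0 <= orbit_mean l (fun x _ => ln (cabs (x - 1))).
  rewrite /orbit_mean mulr_ge0 ?invr_ge0 //.
  have := ln_ge0 (cyclotomic_norm_ge1 R (n_gt0 l) ni).
  have lnp (I : Type) (s : seq I) (P : pred I) (F : I -> R) : (forall k, P k -> 0 < F k) ->
      ln (\prod_(k <- s | P k) F k) = \sum_(k <- s | P k) ln (F k).
    move=> F0; elim: s => [|k s IH]; first by rewrite !big_nil ln1.
    rewrite !big_cons; case: ifP => // Pk.
    by rewrite lnM ?IH // posrE; [exact: F0|apply: prodr_gt0].
  rewrite lnp; last first.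
    move=> k kn; have := dpos k kn; by rewrite (absvBC hc) /X -exprM.
  rewrite (eq_bigr (fun k : 'I_(n l) => ln (cabs (X l k - 1)))) // => k kn.
  by rewrite (absvBC hc) /X -exprM.
apply: le_trans (_ : orbit_mean l (fun x y => ((0 - K (min_Re x y)) + K (complex.Re x) - 2 * E) + ln (cabs (x - 1))) <= _).
  by rewrite orbit_meanD orbit_meanB orbit_meanD orbit_meanB !orbit_mean_cst SE TE; lra.
apply: orbit_mean_le => k kn.
have d0D : 0 < cabs (X l k - 1) <= maxchord (X l k) (Y l k) by rewrite dpos ?dD.
have := ln_chord_ratio_le r01 d0D; rewrite -min_Re_maxchord // -/(Q _).
have <- : complex.Re (X l k) = 1 - cabs (X l k - 1) ^+ 2 / 2.
  by rewrite -chord_sqr ?absv1 // conjc1 mul1r.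
rewrite -/(Q _).
have /andP[h1 _] := QK _ (min_Re_bounds (unitX l k) (unitY l k)).
have /andP[_ h2] := QK _ (Re_unit_bounds (unitX l k)); lra.
Qed.

Lemma cvg_log_mean : orbit_mean l (fun x y => ln (maxchord x y)) @[l --> \oo] -->
  (2 * zeta R 3) / (3 * zeta R 2).
Proof.
set V := _ / _; apply/cvgrPdist_le => e e0.
(* As [sum_norm_cheb_coef] gives 6, replacing [r] by 1 in the limit series costs at most
   [6 * dlt <= e / 6]; [dlt <= 1/2] gives [1/r - 1 <= 2 * dlt], which controls [ln r]. *)
pose dlt := Num.min 2^-1 (e / 36).
have dlt0 : 0 < dlt by rewrite lt_min; apply/andP; split; lra.
have dlt2 : dlt <= 2^-1 by rewrite ge_min lexx.
have dlte : dlt <= e / 36 by rewrite ge_min lexx orbT.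
pose r := 1 - dlt; have r01 : 0 < r < 1 by apply/andP; split; rewrite /r; lra.
have /andP[r0 r1] := r01.
have rn : 0 <= r <= 1 by rewrite !ltW.
have lnr : - 2^-1 * ln r <= e / 6.
  have : ln r^-1 <= r^-1 - 1.
    have := @le_ln1Dx R (r^-1 - 1); rewrite addrCA subrr addr0; apply.
    by rewrite ltrBrDr addrC subrr invr_gt0.
  rewrite lnV ?posrE //.
  have : r^-1 - 1 <= 2 * dlt.
    rewrite lerBlDr -[r^-1]mul1r ler_pdivrMr // /r; nra.
  lra.
have e6 : 0 < e / 6 by rewrite divr_gt0.
have /cvgrPdist_le/(_ _ e6)[n1 _ hn1] := @cvg_sum_cheb_coef R.
pose c0 := 2 / (1 - r) ^+ 2.
have : c0 * r ^+ n @[n --> \oo] --> c0 * 0.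
  by apply: cvgMr; apply: cvg_expr; rewrite ger0_norm // ltW.
rewrite mulr0 => /cvgrPdist_le/(_ _ e6)[n2 _ hn2].
(* [M + 1] is a multiple of 6, the cut-offs at which [cvg_sum_cheb_coef] holds; the shift by one
   comes from the zero term at index 0. *)
pose N := maxn n1 n2; pose M := (N.+1 * 6).-1.
have EM : 2 * r ^+ M / (1 - r) ^+ 2 <= e / 6.
  have n2M : (n2 <= M)%N by rewrite /M /N; clear; lia.
  have := hn2 M n2M; rewrite /= sub0r normrN /c0 mulrAC => h.
  by apply: le_trans h; rewrite ler_norm.
pose S0 := \sum_(m < M) r ^+ m.+1 / m.+1%:R * cheb_coef R m.+1.
have S0V : `|S0 + V| <= e / 3.
  have := hn1 N.+1 _; rewrite /= => /(_ (leqW (leq_maxl _ _))).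
  have -> : \sum_(0 <= m < N.+1 * 6) cheb_coef R m / m%:R = \sum_(m < M) cheb_coef R m.+1 / m.+1%:R.
    rewrite -[(N.+1 * 6)%N]prednK // -/M big_ltn // invr0 mulr0 add0r big_add1 /= big_mkord.
    by [].
  set S1 := \sum_(m < M) _ => h.
  have : `|S0 - S1| <= e / 6.
    rewrite -sumrB; apply: le_trans (ler_norm_sum _ _ _) _.
    apply: le_trans (_ : \sum_(m < M) (1 - r) * `|cheb_coef R m.+1| <= _).
      apply: ler_sum => m _.
      have -> : r ^+ m.+1 / m.+1%:R * cheb_coef R m.+1 - cheb_coef R m.+1 / m.+1%:R =
         - ((1 - r ^+ m.+1) / m.+1%:R * cheb_coef R m.+1) by ring.
      rewrite normrN normrM ler_wpM2r // ger0_norm; last first.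
        by rewrite divr_ge0 // subr_ge0 exprn_ile1 // ltW.
      by rewrite ler_pdivrMr // mulrC one_sub_expr_le.
    rewrite -mulr_sumr; have := sum_norm_cheb_coef R M.+1.
    rewrite big_ltn // big_add1 /= big_mkord => h6.
    have : \sum_(m < M) `|cheb_coef R m.+1| <= 6 by apply: le_trans h6; rewrite lerDr.
    have : 0 <= \sum_(m < M) `|cheb_coef R m.+1| by apply: sumr_ge0.
    rewrite /r; nra.
  move: h; rewrite -/V; move: (V) (S0) (S1) => a b c; rewrite !ler_norml => /andP[h1 h2] /andP[h3 h4].
  by apply/andP; split; lra.
have cS : log_partial r M l (@cheb_min R) @[l --> \oo] --> S0.
  apply: cvg_big => [|m _]; first exact: add_continuous.
  apply: cvgMr; exact: orbit_mean_cheb_min.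
have cT : log_partial r M l (fun m x _ => cheb m (complex.Re x)) @[l --> \oo] --> \sum_(m < M) r ^+ m.+1 / m.+1%:R * 0.
  apply: cvg_big => [|m _]; first exact: add_continuous.
  apply: cvgMr; exact: orbit_mean_cheb_Re.
rewrite [X in _ --> X]big1 in cT; last by move=> m _; rewrite mulr0.
have ni := @generic 1 0 0 0 1 isT isT.
move/cvgrPdist_le: cS => /(_ _ e6) cS; move/cvgrPdist_le: cT => /(_ _ e6) cT.
near=> l.
have nil : ~~ (n l %| i l)%N.
  have : ~~ (n l %| 1 * (i l * 1 + j l * 0 + (n l).-1 * (i l * 0 + j l * 0)))%N by near: l.
  by rewrite !(muln0, addn0, muln1, mul1n).
have := log_mean_bounds r01 nil (erefl _) (erefl _) (erefl (2 * r ^+ M / (1 - r) ^+ 2)).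
have : `|S0 - log_partial r M l (@cheb_min R)| <= e / 6 by near: l.
have : `|0 - log_partial r M l (fun m x _ => cheb m (complex.Re x))| <= e / 6 by near: l.
move: EM lnr S0V; move: (log_partial _ _ _ _) (log_partial _ _ _ _) (orbit_mean _ _) (ln r) (2 * _ / _) => s t o L E.
rewrite !ler_norml => h1 h2 /andP[h3 h4] /andP[h5 h6] /andP[h7 h8] /andP[h9 h10].
by apply/andP; split; lra.
Unshelve. all: by end_near.
Qed.
End OrbitMeans.

(** * From strict sequences of torsion points to Galois orbits *)

Lemma torsion_cyclic (om : algC * algC) : torsion_point om ->
  exists n i j c d (z : algC),
    [/\ n.-primitive_root z, om.1^-1 = z ^+ i, om.2^-1 = z ^+ j &
        z = (z ^+ i) ^+ c * (z ^+ j) ^+ d].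
Proof.
move=> [[n1 n1_gt0 /unity_rootP A1] [n2 n2_gt0 /unity_rootP B1]].
pose N := (n1 * n2)%N; have N0 : (0 < N)%N by rewrite muln_gt0 n1_gt0.
have [zeta zP] := C_prim_root_exists N0.
have AN : om.1^-1 ^+ N = 1 by rewrite exprVn /N exprM A1 expr1n invr1.
have BN : om.2^-1 ^+ N = 1 by rewrite exprVn /N mulnC exprM B1 expr1n invr1.
have [[i' /= _] AE] := prim_rootP zP AN; have [[j' /= _] BE] := prim_rootP zP BN.
(* Two Bezout relations express [g = gcd (i', j', N)]. Both have the form of a sum divisible by the
   modulus, so all exponents are natural numbers, and inverses modulo [N] appear as multiplication
   by [N.-1]. *)
pose h := gcdn j' N; have h0 : (0 < h)%N by rewrite gcdn_gt0 N0 orbT.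
have [a _ /dvdnP[t ha]] := Bezoutr i' h0.
have [b _ /dvdnP[s hb]] := Bezoutr j' N0.
set g := gcdn i' h in ha; have g0 : (0 < g)%N by rewrite gcdn_gt0 h0 orbT.
have gi : (g %| i')%N := dvdn_gcdl _ _.
have gj : (g %| j')%N := dvdn_trans (dvdn_gcdr _ _) (dvdn_gcdl _ _).
have gN : (g %| N)%N := dvdn_trans (dvdn_gcdr _ _) (dvdn_gcdr _ _).
have gE : zeta ^+ g = (om.1^-1) ^+ (a * N.-1) * (om.2^-1) ^+ (t * b * N.-1).
  have e1 : zeta ^+ g * ((om.1^-1) ^+ a * (om.2^-1) ^+ (t * b)) = 1.
    rewrite AE BE -!exprM -!exprD addnA [(i' * a)%N]mulnC ha.
    have -> : (t * h + j' * (t * b) = t * s * N)%N by rewrite -mulnA -hb /h; ring.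
    by rewrite mulnC exprM (prim_expr_order zP) expr1n.
  have inv (x : algC) m : x ^+ N = 1 -> x ^+ m * x ^+ (m * N.-1) = 1.
    by move=> xN; rewrite -exprD -mulnS prednK // mulnC exprM xN expr1n.
  move: e1 (inv _ a AN) (inv _ (t * b)%N BN); move: (zeta ^+ g) (om.1^-1 ^+ a) (om.2^-1 ^+ (t * b)).
  move: (_ ^+ (a * _)) (_ ^+ (t * b * _)) => A' B' u A B e1 eA eB.
  rewrite -[RHS]mul1r -e1 -[LHS]mulr1 -[in LHS]eA -[LHS]mulr1 -[in LHS]eB; ring.
exists (N %/ g)%N, (i' %/ g)%N, (j' %/ g)%N, (a * N.-1)%N, (t * b * N.-1)%N, (zeta ^+ g).
have zi : zeta ^+ g ^+ (i' %/ g) = om.1^-1 by rewrite -exprM mulnC divnK.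
have zj : zeta ^+ g ^+ (j' %/ g) = om.2^-1 by rewrite -exprM mulnC divnK.
split; rewrite ?zi ?zj //.
have := dvdn_prim_root zP (dvdn_div gN); rewrite divnA // mulKn //.
Qed.

Lemma strict_generic (om : nat -> algC * algC) a b c d M :
  strict_sequence om -> (a, c) != (b, d) -> (0 < M)%N ->
  \forall l \near \oo, torus (om l) ->
    ((om l).1 ^+ a * (om l).2 ^+ c) ^+ M != ((om l).1 ^+ b * (om l).2 ^+ d) ^+ M.
Proof.
move=> strict ne M0.
pose H : set (algC * algC) :=
  [set x | torus x /\ (x.1 ^+ a * x.2 ^+ c) ^+ M = (x.1 ^+ b * x.2 ^+ d) ^+ M].
have Hgroup : algebraic_subgroup H.
  split=> [x []//||||].
  - pose p a c : {poly {poly algC}} := ('X ^+ a)%:P * 'X ^+ c.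
    have pE a' c' (x : algC * algC) : (p a' c').[x.2%:P].[x.1] = x.1 ^+ a' * x.2 ^+ c'.
      by rewrite /p hornerM hornerC hornerXn !hornerE.
    have PE (x : algC * algC) : (p a c ^+ M - p b d ^+ M).[x.2%:P].[x.1] =
        (x.1 ^+ a * x.2 ^+ c) ^+ M - (x.1 ^+ b * x.2 ^+ d) ^+ M.
      rewrite hornerD hornerN (horner_exp (p a c)) (horner_exp (p b d)) hornerD hornerN.
      by rewrite !horner_exp !pE.
    exists [set (p a c) ^+ M - (p b d) ^+ M]; apply/seteqP; split => x [tx hx]; split => //.
      by move=> _ ->; rewrite PE hx subrr.
    move: (hx _ (erefl _)); rewrite PE => /eqP.
    by rewrite subr_eq0 => /eqP.
  - by split; [split; exact: oner_neq0|rewrite /= !expr1n].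
  - move=> x y [[x1 x2] hx] [[y1 y2] hy]; split; first by split; rewrite mulf_neq0.
    have mulE a' c' : (x.1 * y.1) ^+ a' * (x.2 * y.2) ^+ c' =
        (x.1 ^+ a' * x.2 ^+ c') * (y.1 ^+ a' * y.2 ^+ c') by rewrite !exprMn mulrACA.
    by rewrite /= !mulE exprMn hx hy -exprMn.
  - move=> x [[x1 x2] hx]; split; first by split; rewrite /= invr_eq0.
    by rewrite /= !exprVn -!invfM !exprVn hx.
have HT : H <> torus.
  move=> HE.
  (* Powers of 2 separate exponents: the points (2, 1) and (1, 2) of the torus show that the
     subgroup cut out by a nontrivial relation is proper. *)
  have two m k : (2 : algC) ^+ m ^+ M = 2 ^+ k ^+ M -> m = k.
    rewrite -!exprM -!natrX => /eqP; rewrite eqC_nat eqn_exp2l // eqn_pmul2r // => /eqP. by [].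
  have h1 : H (2, 1) by rewrite HE; split; rewrite ?oner_neq0 // pnatr_eq0.
  have h2 : H (1, 2) by rewrite HE; split; rewrite ?oner_neq0 // pnatr_eq0.
  case: h1 => _; rewrite /= !expr1n !mulr1 => /two ab.
  case: h2 => _; rewrite /= !expr1n !mul1r => /two cd.
  by rewrite ab cd eqxx in ne.
have [l0 _ hl] := strict H Hgroup HT.
exists l0 => // l /= ll tl; apply/eqP => e; exact: (hl l ll (conj tl e)).
Qed.

Lemma torsion_torus (om : algC * algC) : torsion_point om -> torus om.
Proof.
have h (z : algC) m : (0 < m)%N -> m.-unity_root z -> z != 0.
  move=> m0 /unity_rootP z1; apply/eqP => z0; move/eqP: z1.
  by rewrite z0 expr0n (gtn_eqF m0) eq_sym oner_eq0.
by move=> [[n1 p1 h1] [n2 p2 h2]]; split; [exact: h h1|exact: h h2].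
Qed.

Lemma torsion_relation (om : algC * algC) n i j (z : algC) a b c d M :
  (0 < n)%N -> n.-primitive_root z -> om.1^-1 = z ^+ i -> om.2^-1 = z ^+ j ->
  (n %| M * (i * a + j * c + n.-1 * (i * b + j * d)))%N ->
  (om.1 ^+ a * om.2 ^+ c) ^+ M = (om.1 ^+ b * om.2 ^+ d) ^+ M.
Proof.
move=> n0 zP omi omj /dvdnP[t ht]; apply: invr_inj.
rewrite -!exprVn !invfM -!exprVn omi omj -!exprM -!exprD -!exprM.
have zn m : z ^+ (m * n) = 1 by rewrite mulnC exprM (prim_expr_order zP) expr1n.
have := zn t; rewrite -ht mulnDr exprD => h.
rewrite -[LHS]mulr1 -(zn (M * (i * b + j * d))%N) -[RHS]mul1r -h -!exprD; congr (_ ^+ _).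
rewrite -[X in (_ + _ * X)%N = _](prednK n0); ring.
Qed.

(** With [s] the square root of [n], [ln n = 2 ln s <= 2 s], so that the quotient is at most
    [4 / s]. *)
Lemma ln_div_small (R : realType) (e : R) : 0 < e ->
  exists B, forall n, (B < n)%N -> 2 * ln n%:R / n%:R <= e.
Proof.
move=> e0; exists (Num.bound ((4 / e) ^+ 2)) => n hn.
have n0 : 0 < n%:R :> R by rewrite ltr0n; apply: leq_ltn_trans hn.
have h : (4 / e) ^+ 2 <= n%:R.
  apply: ltW; apply: lt_trans (archi_boundP (sqr_ge0 _)) _; by rewrite ltr_nat.
pose s := Num.sqrt (n%:R : R); have s0 : 0 < s by rewrite sqrtr_gt0.
have sE : s ^+ 2 = n%:R by rewrite sqr_sqrtr // ltW.
have hs : 4 / e <= s.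
  by have := ler_wsqrtr h; rewrite sqrtr_sqr ger0_norm // divr_ge0 // ltW.
have lns : ln s <= s - 1.
  have := @le_ln1Dx R (s - 1); rewrite addrCA subrr addr0; apply.
  by rewrite ltrBrDr addrC subrr.
have ln2 : ln (s ^+ 2) = 2 * ln s by have := lnXn 2 s0; lra.
rewrite -sE ln2 ler_pdivrMr ?exprn_gt0 //.
rewrite ler_pdivrMr // in hs; nra.
Qed.

Theorem theorem2 (R : realType) (omega : nat -> algC * algC)
  (omega_tors : forall l : nat, (1 <= l)%N ->
     torsion_point (omega l) /\ omega l <> (1, 1))
  (omega_strict : strict_sequence omega) :
  height R (lineC_cap (omega l)) @[l --> \oo]
    --> (2 * zeta R 3) / (3 * zeta R 2).
Proof.
(* The term of index 0 is unconstrained, so the sequence is reindexed from 1. *)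
rewrite -(cvg_shiftS (fun l => height R (lineC_cap (omega l)))) /=.
pose P l (t : nat * nat * nat * nat * nat * algC) :=
  let: (n, i, j, c, d, z) := t in
  [/\ n.-primitive_root z, (omega l.+1).1^-1 = z ^+ i, (omega l.+1).2^-1 = z ^+ j &
      z = (z ^+ i) ^+ c * (z ^+ j) ^+ d].
have /boolp.choice[f fP] : forall l, exists t, P l t.
  move=> l; have [om_tors _] := omega_tors l.+1 isT.
  by have [n [i [j [c [d [z h]]]]]] := torsion_cyclic om_tors; exists (n, i, j, c, d, z).
pose n l := (f l).1.1.1.1.1; pose i l := (f l).1.1.1.1.2; pose j l := (f l).1.1.1.2.
have data l : exists c d z, [/\ (n l).-primitive_root z, (omega l.+1).1^-1 = z ^+ i l,
    (omega l.+1).2^-1 = z ^+ j l & z = (z ^+ i l) ^+ c * (z ^+ j l) ^+ d].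
  by have := fP l; rewrite /n /i /j; case: (f l) => [[[[[? ?] ?] c] d] z] h; exists c, d, z.
have n_gt0 l : (0 < n l)%N by have [c [d [z [zP _ _ _]]]] := data l; exact: prim_order_gt0 zP.
have generic a b c d M : (a, c) != (b, d) -> (0 < M)%N -> \forall l \near \oo,
    ~~ (n l %| M * (i l * a + j l * c + (n l).-1 * (i l * b + j l * d)))%N.
  move=> ne M0; have [l0 _ h] := strict_generic omega_strict ne M0.
  exists l0 => // l /= ll; apply/negP => dv.
  have [om_tors _] := omega_tors l.+1 isT.
  move/eqP: (h l.+1 (leqW ll) (torsion_torus om_tors)); apply.
  have [c' [d' [z [zP omi omj _]]]] := data l; exact: torsion_relation (n_gt0 l) zP omi omj dv.
have lim := @cvg_log_mean R n i j n_gt0 generic.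
apply/cvgrPdist_le => e e0; have e2 : 0 < e / 2 by rewrite divr_gt0.
move/cvgrPdist_le: lim => /(_ _ e2) lim.
have [B hB] := ln_div_small e2.
have big := orbit_order_gt n_gt0 generic (maxn 2 B).
near=> l.
have h1 : (maxn 2 B < n l)%N by near: l; exact: big.
have n2 : (2 < n l)%N by apply: leq_ltn_trans h1; exact: leq_maxl.
have nB : (B < n l)%N by apply: leq_ltn_trans h1; exact: leq_maxr.
have [c [d [z [zP omi omj zE]]]] := data l.
have := le_trans (height_lineC_cap R zP n2 omi omj zE) (hB _ nB).
have : `|2 * zeta R 3 / (3 * zeta R 2) - orbit_mean n i j l (fun x y : R[i] => ln (maxchord x y))| <= e / 2 by near: l.
rewrite -/(orbit_mean n i j l (fun x y : R[i] => ln (maxchord x y))).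
move: (orbit_mean _ _ _ _ _) (height _ _) (2 * _ / _) => A H V.
rewrite !ler_norml => /andP[h3 h4] /andP[h5 h6].
by apply/andP; split; lra.
Unshelve. all: by end_near.
Qed.
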